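(* Let $h:(0,1)\to(0,\infty)$ be a continuous function with $\lim_{t\to 0^+}h(t)=0$. Let $(z_n)_{n\ge 1}$, $z_n=r_ne^{i\theta_n}$ with $r_n\in(0,1)$ and $\theta_n\in\mathbb{R}$, be a Carleson sequence in the unit disc $\mathbb{D}$ such that $\sum_{n=1}^{\infty}h(1-r_n)<\infty$, let $B$ be the Blaschke product with zeros $(z_n)_{n\ge1}$, and let $K_B=H^2\ominus BH^2$. Let $p\in(2/3,1)$, $\sigma=2p/(p+2)$ and $-1<\gamma<2\sigma-2$ be such that $h(t)/t^{p/2}$ is decreasing and $h(t)/t^{(1-p)+(1+\gamma)(1+p/2)}$ is increasing on $(0,1)$. Then there exist constants $C>0$ and $r_0\in(0,1)$, independent of $f$ and $r$, such that for all $f\in K_B$ and all $r\in(r_0,1)$, \[ \left(\int_{0}^{1}\int_{0}^{2\pi}|f'(r\rho e^{i\theta})|^{\sigma}\,\rho(1-\rho^2)^{\gamma}\,d\theta\,d\rho\right)^{1/\sigma}\le\frac{C\,\|f\|_2}{\big((1-r)^{-(1-p)-(1+\gamma)(1+p/2)}\,h(1-r)\big)^{1/p}}. \]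
   Context: $\mathbb{D}$ is the open unit disc in $\mathbb{C}$. A Blaschke sequence is a sequence $(z_n)_{n\ge1}$ in $\mathbb{D}\setminus\{0\}$ with $\sum_{n}(1-|z_n|)<\infty$; the Blaschke product with these zeros is $B(z)=\prod_{n=1}^{\infty}\frac{|z_n|}{z_n}\,\frac{z_n-z}{1-\bar z_n z}$, $z\in\mathbb{D}$. A Carleson (or interpolating) sequence is a Blaschke sequence satisfying the Carleson condition $\inf_{n\ge1}\prod_{k\ne n}\left|\frac{z_k-z_n}{1-\bar z_k z_n}\right|>0$. $H^2$ is the Hardy space of $\mathbb{D}$ with norm $\|f\|_2=\lim_{r\to1^-}\big(\int_0^{2\pi}|f(re^{i\theta})|^2\,\frac{d\theta}{2\pi}\big)^{1/2}$, and $K_B=H^2\ominus BH^2$ is the orthogonal complement in $H^2$ of the closed subspace $BH^2$ (the model subspace generated by $B$). ''Increasing'' and ''decreasing'' are understood in the weak (non-strict) sense. *)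

(* Defs.v *)
From HB Require Import structures.
From mathcomp Require Import all_boot all_order all_algebra.
From mathcomp Require Import complex.
From mathcomp Require Import all_classical all_reals all_analysis.

Set Implicit Arguments.
Unset Strict Implicit.
Unset Printing Implicit Defensive.

Import Order.TTheory GRing.Theory Num.Theory.
Import numFieldNormedType.Exports.

Local Open Scope classical_set_scope.
Local Open Scope complex_scope.
Local Open Scope ring_scope.

(* The complex numbers are used as R[i]^o, the form in which R[i] carries its
   topology; derivatives of maps R[i]^o -> R[i]^o are then complex ones. *)

(* The real-valued modulus; Num.norm on R[i] takes its values in R[i]. *)
Definition cabs {R : realType} (z : R[i]^o) : R := ComplexField.Normc.normc z.

Definition polar {R : realType} (r t : R) : R[i]^o :=
  r%:C * (cos t +i* sin t).

Section hardy_space.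
Context {R : realType}.
Local Notation C := (R[i]^o).
Local Notation mu := (@lebesgue_measure R).
Implicit Types f g : C -> C.

(* Functions on the disc are total functions whose values off the disc are
   irrelevant. *)
Definition holomorphic_on_disc f : Prop :=
  forall z : C, cabs z < 1 -> derivable f z 1.

Definition circle_mean2 f (r : R) : R :=
  (2 * pi)^-1 * \int[mu]_(t in `[0, 2 * pi]) (cabs (f (polar r t)) ^+ 2).

Definition H2 f : Prop :=
  holomorphic_on_disc f /\
  exists M : R, forall r : R, 0 <= r < 1 -> circle_mean2 f r <= M.

Definition H2_norm f : R :=
  lim (Num.sqrt (circle_mean2 f r) @[r --> 1^'-]).

Definition circle_inner f g (r : R) : C :=
  let F t := f (polar r t) * conjc (g (polar r t)) in
  ((2 * pi)^-1)%:C *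
  (\int[mu]_(t in `[0, 2 * pi]) complex.Re (F t) +i*
   \int[mu]_(t in `[0, 2 * pi]) complex.Im (F t)).

(* The inner product inducing H2_norm is the limit of circle_inner as r tends
   to 1 from the left, which exists for f and g in H2. *)
Definition H2_orthogonal f g : Prop :=
  circle_inner f g r @[r --> 1^'-] --> (0 : C).

Definition model_space (B : C -> C) f : Prop :=
  H2 f /\ forall g, H2 g -> H2_orthogonal f (fun z => B z * g z).

End hardy_space.

(* Sequences are indexed from 0. *)
Section blaschke.
Context {R : realType}.
Local Notation C := (R[i]^o).
Implicit Type z : nat -> C.

Definition blaschke_sequence z : Prop :=
  (forall n, 0 < cabs (z n) < 1) /\ cvgn (series (fun n => 1 - cabs (z n))).

Definition blaschke_product z (w : C) : C :=
  limn ((fun N => \prod_(n < N)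
    ((cabs (z n))%:C / z n * ((z n - w) / (1 - conjc (z n) * w)))) : nat -> C).

(* The product over all k different from n. *)
Definition carleson_product z (n : nat) : R :=
  limn (fun N => \prod_(k < N | k != n :> nat)
    cabs ((z k - z n) / (1 - conjc (z k) * z n))).

Definition carleson_sequence z : Prop :=
  blaschke_sequence z /\ 0 < inf (range (carleson_product z)).

End blaschke.

(* Main.v *)
(* Every f in K_B is a superposition of reproducing kernels,
     f(w) = sum_n x_n (1 - |z_n|^2)^(1/2) / (1 - conj(z_n) w),
   with sum_n |x_n|^2 <= c ||f||_2^2. Such an identity holds exactly for the
   dilation f(r^2 w) and the first N zeros, up to the product of B_N(w) with
   the mean of f against B_N k_w on the circle of radius r; its coefficients
   come from the partial fractions of 1 / B_N, and are bounded because the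
   Gram matrix of the normalized kernels is bounded when the sequence is
   Carleson. Letting N and then r tend to their limits along an ultrafilter,
   the coefficients converge and the extra term disappears, as f is orthogonal
   to B H^2.

   Since sigma < 1, it follows that
     |f'(w)|^sigma <= sum_n |x_n|^sigma (1 - |z_n|^2)^(sigma/2)
                              |1 - conj(z_n) w|^(-2 sigma),
   and integrating the kernels over the angle and then over the radius gives
   (1 - r r_n)^(gamma + 2 - 2 sigma). Hoelder's inequality with exponents
   2/sigma and 2/(2 - sigma) leaves
     sum_n (1 - r_n)^(p/2) (1 - r r_n)^(A - p/2),
   where A = (1 - p) + (1 + gamma)(1 + p/2). As 1 - r r_n is at least 1 - r_n
   and at least 1 - r, the monotonicity of h(t)/t^(p/2) or that of h(t)/t^A
   bounds the n-th term by h(1 - r_n) (1 - r)^A / h(1 - r). *)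

Require Import Defs.
From HB Require Import structures.
From mathcomp Require Import all_boot all_order all_algebra.
From mathcomp Require Import complex.
From mathcomp Require Import all_classical all_reals all_analysis.
From mathcomp Require Import measurable_realfun.
From mathcomp Require Import ring lra.

Import Order.TTheory GRing.Theory Num.Theory.
Import numFieldNormedType.Exports.

Local Open Scope classical_set_scope.
Local Open Scope complex_scope.
Local Open Scope ring_scope.

Set Implicit Arguments.
Unset Strict Implicit.
Unset Printing Implicit Defensive.

(** Boundary values of H2 functions are avoided: formulas on the unit circle are applied only to
    functions holomorphic across it, such as dilations of f, and the norm and orthogonality are
    reached as limits from inside the disc. The coefficients depend on r and N without any
    monotonicity, so their limit is a matter of compactness, which an ultrafilter provides for all
    of them at once. This needs bounds independent of r and N. The Carleson condition supplies them
    twice: the residues of 1/B_N at z_n are at most (1 - |z_n|^2)/delta, and the sums over j of 1 -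
    rho_ij^2, rho the pseudohyperbolic distance, are at most 1/delta^2, which controls the Gram
    matrix. Among the exponents, p > 2/3 means 2 sigma > 1, so that the angular integral is governed
    by its peak; gamma > -1 makes the weight integrable up to rho = 1; gamma < 2 sigma - 2 makes the
    radial integral behave like a negative power of 1 - r r_n. The relation sigma (p + 2) = 2 p
    gives 1 - sigma/2 = 2/(p + 2), which matches Hoelder's exponents with p/2 and A - p/2. *)

Section integral_on_segment.
Context {R : realType}.
Local Notation mu := (@lebesgue_measure R).
Implicit Types (a b c k e : R) (f g : R -> R).

Definition itg (a b : R) (f : R -> R) : R := \int[mu]_(t in `[a, b]) f t.

(** Two-sided continuity at every point of the segment, end points included: the integrands extend
    beyond the segment, and closure under algebraic operations then needs no subspace topology. *)
Definition cont_on (a b : R) (f : R -> R) :=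
  forall x, a <= x <= b -> {for x, continuous f}.

Lemma cont_on_integrable a b f : cont_on a b f ->
  mu.-integrable `[a, b] (EFin \o f).
Proof.
move=> cf; apply: continuous_compact_integrable; first exact: segment_compact.
apply: continuous_in_subspaceT => x; rewrite inE/= in_itv/=; exact: cf.
Qed.

Lemma cont_onS a b c e f : a <= c -> e <= b -> cont_on a b f -> cont_on c e f.
Proof.
move=> ac eb cf x /andP[cx xe]; apply: cf.
by rewrite (le_trans ac)// (le_trans xe).
Qed.

Lemma cont_onD a b f g : cont_on a b f -> cont_on a b g ->
  cont_on a b (fun x => f x + g x).
Proof. by move=> cf cg x xab; apply: continuousD; [exact: cf|exact: cg]. Qed.

Lemma cont_onB a b f g : cont_on a b f -> cont_on a b g ->
  cont_on a b (fun x => f x - g x).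
Proof. by move=> cf cg x xab; apply: continuousB; [exact: cf|exact: cg]. Qed.

Lemma cont_onM a b f g : cont_on a b f -> cont_on a b g ->
  cont_on a b (fun x => f x * g x).
Proof. by move=> cf cg x xab; apply: continuousM; [exact: cf|exact: cg]. Qed.

Lemma cont_on_cst a b k : cont_on a b (fun=> k).
Proof. by move=> x _; exact: cst_continuous. Qed.

Lemma cont_onN a b f : cont_on a b f -> cont_on a b (fun x => - f x).
Proof. by move=> cf x xab; apply: continuousN; exact: cf. Qed.

Lemma eq_itg a b f g : (forall x, a <= x <= b -> f x = g x) ->
  itg a b f = itg a b g.
Proof.
by move=> fg; apply: eq_Rintegral => x; rewrite inE/= in_itv/=; exact: fg.
Qed.

Lemma itgD a b f g : cont_on a b f -> cont_on a b g ->
  itg a b (fun x => f x + g x) = itg a b f + itg a b g.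
Proof. by move=> cf cg; rewrite /itg RintegralD//; exact: cont_on_integrable. Qed.

Lemma itgB a b f g : cont_on a b f -> cont_on a b g ->
  itg a b (fun x => f x - g x) = itg a b f - itg a b g.
Proof. by move=> cf cg; rewrite /itg RintegralB//; exact: cont_on_integrable. Qed.

Lemma itgZ a b k f : cont_on a b f -> itg a b (fun x => k * f x) = k * itg a b f.
Proof. by move=> cf; rewrite /itg RintegralZl//; exact: cont_on_integrable. Qed.

Lemma itgN a b f : cont_on a b f -> itg a b (fun x => - f x) = - itg a b f.
Proof.
by move=> cf; rewrite -mulN1r -itgZ//; apply: eq_itg => x _; rewrite mulN1r.
Qed.

Lemma itg_cst a b k : a <= b -> itg a b (fun=> k) = k * (b - a).
Proof.
move=> ab.
have muE : mu `[a, b]%classic = (b - a)%:E.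
  rewrite lebesgue_measure_itv/= lte_fin; case: ltP => //= ba.
  by have -> : a = b by [apply/eqP; rewrite eq_le ab]; rewrite subrr.
by rewrite /itg Rintegral_cst//; congr (k * _); rewrite -[RHS]/(fine (b - a)%:E) -muE.
Qed.

Lemma le_itg a b f g : cont_on a b f -> cont_on a b g ->
  (forall x, a <= x <= b -> f x <= g x) -> itg a b f <= itg a b g.
Proof.
by move=> cf cg fg; rewrite /itg le_Rintegral//; exact: cont_on_integrable.
Qed.

Lemma itg_ge0 a b f : (forall x, a <= x <= b -> 0 <= f x) -> 0 <= itg a b f.
Proof. by move=> f0; apply: Rintegral_ge0 => x /=; rewrite in_itv; exact: f0. Qed.

Lemma normr_itg_le a b f e : a <= b -> cont_on a b f ->
  (forall x, a <= x <= b -> `|f x| <= e) -> `|itg a b f| <= e * (b - a).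
Proof.
move=> ab cf fe; rewrite ler_norml -mulNr -!itg_cst//.
have cc k := @cont_on_cst a b k.
by apply/andP; split; apply: le_itg => // x /fe; rewrite ler_norml => /andP[].
Qed.

Lemma itg_split a b c f : a <= c <= b -> cont_on a b f ->
  itg a b f = itg a c f + itg c b f.
Proof.
move=> /andP[ac cb] cf.
have := @Rintegral_itvB R f (BLeft a) (BRight b) c (cont_on_integrable cf).
rewrite !bnd_simp => /(_ ac cb) e.
rewrite /itg -(@Rintegral_itv_obnd_cbnd R c (BRight b))//; last first.
  apply: integrableS (cont_on_integrable cf) => //.
  by move=> x /=; rewrite !in_itv/= => /andP[/ltW/(le_trans ac)->].
by rewrite -e addrC subrK.
Qed.

End integral_on_segment.

(** * Goursat's theorem on rectangles, and circle averages *)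

Section goursat.
Context {R : realType}.
Implicit Types (P Q : R -> R -> R) (x y p q d e : R).

(* The real form P dx + Q dy is differentiable at (p, q), with
   dP/dy = dQ/dx there. *)
Definition closed_at P Q p q := exists a b c : R,
  forall e, 0 < e -> exists2 d, 0 < d & forall x y, `|x - p| < d ->
  `|y - q| < d ->
  `|P x y - P p q - (a * (x - p) + b * (y - q))| <= e * (`|x - p| + `|y - q|) /\
  `|Q x y - Q p q - (b * (x - p) + c * (y - q))| <= e * (`|x - p| + `|y - q|).

Lemma continuous_for_eps (f : R -> R) p :
  (forall e, 0 < e -> exists2 d, 0 < d &
    forall x, `|x - p| < d -> `|f x - f p| <= e) -> {for p, continuous f}.
Proof.
move=> H; apply/cvgrPdist_le => e /H[d d0 Hd].
by apply/nbhs_ballP; exists d => // x; rewrite /ball/= => pxd; rewrite distrC Hd// distrC.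
Qed.

Lemma closed_at_continuous P Q p q : closed_at P Q p q ->
  [/\ {for p, continuous (P ^~ q)}, {for p, continuous (Q ^~ q)},
      {for q, continuous (P p)} & {for q, continuous (Q p)}].
Proof.
move=> [a [b [c /(_ 1 ltr01) [d d0 H]]]].
have key (u v : R) : forall f : R -> R, (forall x, `|x - v| < d ->
    `|f x - f v - u * (x - v)| <= 1 * `|x - v|) -> {for v, continuous f}.
  move=> f Hf; apply: continuous_for_eps => e e0.
  have D0 : 0 < 1 + `|u| by rewrite ltr_wpDr.
  exists (Num.min d (e / (1 + `|u|))).
    by rewrite lt_min d0 divr_gt0.
  move=> x; rewrite lt_min => /andP[xd xe].
  rewrite -[f x - f v](subrK (u * (x - v))).
  apply: (le_trans (ler_normD _ _)); rewrite normrM.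
  apply: (le_trans (lerD (Hf _ xd) (lexx _))).
  by rewrite -mulrDl mulrC -ler_pdivlMr// ltW.
split; [apply: (key a)|apply: (key b)|apply: (key b)|apply: (key c)] => x xd.
- have := H x q xd; rewrite !(subrr, normr0, mulr0, addr0) => /(_ d0)[+ _].
  exact.
- have := H x q xd; rewrite !(subrr, normr0, mulr0, addr0) => /(_ d0)[_ +].
  exact.
- have := H p x; rewrite !(subrr, normr0, mulr0, add0r) => /(_ d0 xd)[+ _].
  exact.
- have := H p x; rewrite !(subrr, normr0, mulr0, add0r) => /(_ d0 xd)[_ +].
  exact.
Qed.

(** The integral of P dx + Q dy along the boundary of [x1, x2] x [y1, y2], counterclockwise, with
    opposite sides paired under one integral. *)
Definition loop P Q x1 x2 y1 y2 :=
  itg x1 x2 (fun x => P x y1 - P x y2) + itg y1 y2 (fun y => Q x2 y - Q x1 y).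

Definition closed_on P Q x1 x2 y1 y2 :=
  forall p q, x1 <= p <= x2 -> y1 <= q <= y2 -> closed_at P Q p q.

Lemma closed_onS P Q x1 x2 y1 y2 a b c d : x1 <= a -> b <= x2 -> y1 <= c ->
  d <= y2 -> closed_on P Q x1 x2 y1 y2 -> closed_on P Q a b c d.
Proof.
move=> xa bx yc dy H p q /andP[ap pb] /andP[cq qd]; apply: H.
  by rewrite (le_trans xa ap) (le_trans pb bx).
by rewrite (le_trans yc cq) (le_trans qd dy).
Qed.

Lemma closed_on_cont P Q x1 x2 y1 y2 : closed_on P Q x1 x2 y1 y2 ->
  (forall y, y1 <= y <= y2 -> cont_on x1 x2 (P ^~ y)) /\
  (forall x, x1 <= x <= x2 -> cont_on y1 y2 (Q x)).
Proof.
move=> H; split.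
  by move=> y yy x xx; have [] := closed_at_continuous (H _ _ xx yy).
by move=> x xx y yy; have [] := closed_at_continuous (H _ _ xx yy).
Qed.

Lemma loop_splitx P Q x1 x2 y1 y2 m : closed_on P Q x1 x2 y1 y2 ->
  y1 <= y2 -> x1 <= m <= x2 ->
  loop P Q x1 x2 y1 y2 = loop P Q x1 m y1 y2 + loop P Q m x2 y1 y2.
Proof.
move=> /closed_on_cont[cP cQ] y12 m12; have /andP[x1m mx2] := m12.
have x12 := le_trans x1m mx2.
have [y1i y2i x1i x2i] : [/\ y1 <= y1 <= y2, y1 <= y2 <= y2, x1 <= x1 <= x2 & x1 <= x2 <= x2].
  by rewrite !lexx y12 x12.
rewrite /loop (@itg_split _ x1 x2 m)//; last first.
  by apply: cont_onB; exact: cP.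
rewrite !itgB//; try exact: cQ.
all: try by [apply: cont_onS (cP _ _) => //; exact: lexx].
ring.
Qed.

Lemma loop_splity P Q x1 x2 y1 y2 m : closed_on P Q x1 x2 y1 y2 ->
  x1 <= x2 -> y1 <= m <= y2 ->
  loop P Q x1 x2 y1 y2 = loop P Q x1 x2 y1 m + loop P Q x1 x2 m y2.
Proof.
move=> /closed_on_cont[cP cQ] x12 m12; have /andP[y1m my2] := m12.
have y12 := le_trans y1m my2.
have [y1i y2i x1i x2i] : [/\ y1 <= y1 <= y2, y1 <= y2 <= y2, x1 <= x1 <= x2 & x1 <= x2 <= x2].
  by rewrite !lexx y12 x12.
rewrite /loop (@itg_split _ y1 y2 m)//; last first.
  by apply: cont_onB; exact: cQ.
rewrite !itgB//; try exact: cP.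
all: try by [apply: cont_onS (cQ _ _) => //; exact: lexx].
ring.
Qed.

(** The affine part of the form at (p, q) is closed because P and Q share the coefficient [b], so
    only the remainder contributes, at most e/2 times the half perimeter at each point of the
    boundary. *)
Lemma loop_small P Q p q e : closed_at P Q p q -> 0 < e ->
  exists2 d, 0 < d & forall x1 x2 y1 y2, x1 <= p <= x2 -> y1 <= q <= y2 ->
    x2 - x1 < d -> y2 - y1 < d -> closed_on P Q x1 x2 y1 y2 ->
    `|loop P Q x1 x2 y1 y2| <= e * (x2 - x1 + (y2 - y1)) ^+ 2.
Proof.
move=> [a [b [c H]]] e0; have [|d d0 Hd] := H (e / 2); first by rewrite divr_gt0.
exists d => // x1 x2 y1 y2 p12 q12 xd yd cl.
have /andP[x1p px2] := p12; have /andP[y1q qy2] := q12.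
have x12 := le_trans x1p px2; have y12 := le_trans y1q qy2.
have [y1i y2i x1i x2i] : [/\ y1 <= y1 <= y2, y1 <= y2 <= y2, x1 <= x1 <= x2 & x1 <= x2 <= x2].
  by rewrite !lexx y12 x12.
have [cP cQ] := closed_on_cont cl.
have dx x : x1 <= x <= x2 -> `|x - p| <= x2 - x1.
  by clear -x1p px2; move=> /andP[? ?]; rewrite ler_norml; apply/andP; split; lra.
have dy y : y1 <= y <= y2 -> `|y - q| <= y2 - y1.
  by clear -y1q qy2; move=> /andP[? ?]; rewrite ler_norml; apply/andP; split; lra.
set S := x2 - x1 + (y2 - y1).
have eS x y : x1 <= x <= x2 -> y1 <= y <= y2 ->
    e / 2 * (`|x - p| + `|y - q|) <= e / 2 * S.
  move=> xi yi; rewrite ler_pM2l ?divr_gt0//; apply: lerD; [exact: dx|exact: dy].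
have HP x y : x1 <= x <= x2 -> y1 <= y <= y2 ->
    `|P x y - P p q - (a * (x - p) + b * (y - q))| <= e / 2 * S.
  move=> xi yi; apply: le_trans (eS _ _ xi yi).
  by have [] := Hd x y (le_lt_trans (dx _ xi) xd) (le_lt_trans (dy _ yi) yd).
have HQ x y : x1 <= x <= x2 -> y1 <= y <= y2 ->
    `|Q x y - Q p q - (b * (x - p) + c * (y - q))| <= e / 2 * S.
  move=> xi yi; apply: le_trans (eS _ _ xi yi).
  by have [] := Hd x y (le_lt_trans (dx _ xi) xd) (le_lt_trans (dy _ yi) yd).
(* The subtracted constants integrate to opposite values, b (y1 - y2) (x2 - x1) and b (x2 - x1) (y2
   - y1). *)
have -> : loop P Q x1 x2 y1 y2 =
    itg x1 x2 (fun x => P x y1 - P x y2 - b * (y1 - y2)) +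
    itg y1 y2 (fun y => Q x2 y - Q x1 y - b * (x2 - x1)).
  have cc u v k := @cont_on_cst _ u v k.
  rewrite (@itgB _ x1 x2 (fun x => P x y1 - P x y2))//; last exact: (cont_onB (cP _ y1i) (cP _ y2i)).
  rewrite (@itgB _ y1 y2 (fun y => Q x2 y - Q x1 y))//; last exact: (cont_onB (cQ _ x2i) (cQ _ x1i)).
  by rewrite !itg_cst// /loop; ring.
have B1 : `|itg x1 x2 (fun x => P x y1 - P x y2 - b * (y1 - y2))| <= e * S * (x2 - x1).
  apply: normr_itg_le => //.
    apply: cont_onB; last exact: cont_on_cst.
    exact: (cont_onB (cP _ y1i) (cP _ y2i)).
  move=> x xi; have := HP _ _ xi y1i; have := HP _ _ xi y2i.
  clear; rewrite !ler_norml => /andP[? ?] /andP[? ?]; apply/andP; split; lra.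
have B2 : `|itg y1 y2 (fun y => Q x2 y - Q x1 y - b * (x2 - x1))| <= e * S * (y2 - y1).
  apply: normr_itg_le => //.
    apply: cont_onB; last exact: cont_on_cst.
    exact: (cont_onB (cQ _ x2i) (cQ _ x1i)).
  move=> x xi; have := HQ _ _ x1i xi; have := HQ _ _ x2i xi.
  clear; rewrite !ler_norml => /andP[? ?] /andP[? ?]; apply/andP; split; lra.
apply: (le_trans (ler_normD _ _)); apply: (le_trans (lerD B1 B2)).
by rewrite -mulrDr -mulrA expr2.
Qed.

(** Goursat's quartering: one of the four quarters carries at least a quarter of the modulus. After
    n steps the loop has modulus at least w / 4^n, whereas [loop_small] at the common point of the
    nested rectangles gives a small multiple of (L + M)^2 / 4^n. *)
Lemma goursat P Q x1 x2 y1 y2 : x1 <= x2 -> y1 <= y2 ->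
  closed_on P Q x1 x2 y1 y2 -> loop P Q x1 x2 y1 y2 = 0.
Proof.
move=> x12 y12 cl; set w := `|loop P Q x1 x2 y1 y2|.
suff : w <= 0 by rewrite normr_le0 => /eqP.
set L := x2 - x1; set M := y2 - y1.
have L0 : 0 <= L by rewrite subr_ge0.
have M0 : 0 <= M by rewrite subr_ge0.
pose sz (k : R) (n : nat) := k / 2 ^+ n.
have szS k n : sz k n.+1 = sz k n / 2 by rewrite /sz exprS invfM; ring.
have sz0 k n : 0 <= k -> 0 <= sz k n by move=> k0; rewrite divr_ge0// exprn_ge0.
(* [s] is the lower left corner of a rectangle of the n-th generation. *)
pose good (n : nat) (s : R * R) := [/\ x1 <= s.1, s.1 + sz L n <= x2, y1 <= s.2, s.2 + sz M n <= y2 &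
  w / 4 ^+ n <= `|loop P Q s.1 (s.1 + sz L n) s.2 (s.2 + sz M n)|].
have step n s : good n s -> exists s', good n.+1 s' /\
    [/\ s.1 <= s'.1, s'.1 + sz L n.+1 <= s.1 + sz L n, s.2 <= s'.2 & s'.2 + sz M n.+1 <= s.2 + sz M n].
  case: s => a b [/= xa ax yb by2 wn].
  have Ln := sz0 L n.+1 L0; have Mn := sz0 M n.+1 M0.
  have eL : sz L n = sz L n.+1 + sz L n.+1 by rewrite szS; lra.
  have eM : sz M n = sz M n.+1 + sz M n.+1 by rewrite szS; lra.
  set l := sz L n.+1 in Ln eL *; set m := sz M n.+1 in Mn eM *.
  have c1 : closed_on P Q a (a + sz L n) b (b + sz M n) by apply: closed_onS cl.
  have sx : loop P Q a (a + sz L n) b (b + sz M n) =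
     loop P Q a (a + l) b (b + sz M n) + loop P Q (a + l) (a + sz L n) b (b + sz M n).
    by apply: loop_splitx => //; [lra|apply/andP; split; lra].
  have sy1 : loop P Q a (a + l) b (b + sz M n) =
     loop P Q a (a + l) b (b + m) + loop P Q a (a + l) (b + m) (b + sz M n).
    by apply: loop_splity; [apply: closed_onS c1 => //; lra|lra|apply/andP; split; lra].
  have sy2 : loop P Q (a + l) (a + sz L n) b (b + sz M n) =
     loop P Q (a + l) (a + sz L n) b (b + m) +
     loop P Q (a + l) (a + sz L n) (b + m) (b + sz M n).
    by apply: loop_splity; [apply: closed_onS c1 => //; lra|lra|apply/andP; split; lra].
  have ex : exists s', [/\ (s'.1 = a \/ s'.1 = a + l), (s'.2 = b \/ s'.2 = b + m) &
      w / 4 ^+ n / 4 <= `|loop P Q s'.1 (s'.1 + l) s'.2 (s'.2 + m)|].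
    apply: contrapT => nex.
    have lt1 u v : u = a \/ u = a + l -> v = b \/ v = b + m ->
        `|loop P Q u (u + l) v (v + m)| < w / 4 ^+ n / 4.
      move=> hu hv; rewrite ltNge; apply/negP => h.
      by apply: nex; exists (u, v).
    have h1 := lt1 _ _ (or_introl erefl) (or_introl erefl).
    have h2 := lt1 _ _ (or_introl erefl) (or_intror erefl).
    have h3 := lt1 _ _ (or_intror erefl) (or_introl erefl).
    have h4 := lt1 _ _ (or_intror erefl) (or_intror erefl).
    move: wn; rewrite sx sy1 sy2 eL eM (addrA a) (addrA b); apply/negP; rewrite -ltNge.
    set A := loop _ _ _ _ _ _ in h1 *; set B := loop _ _ _ _ _ _ in h2 *.
    set C := loop _ _ _ _ _ _ in h3 *; set D := loop _ _ _ _ _ _ in h4 *.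
    have t1 := ler_normD (A + B) (C + D); have t2 := ler_normD C D.
    have t3 := ler_normD A B.
    set W := w / _ in h1 h2 h3 h4 *; clear -h1 h2 h3 h4 t1 t2 t3; lra.
  have [[a' b'] /= [ha hb hw]] := ex; exists (a', b'); split; last first.
    by rewrite /= -/l -/m eL eM; clear -Ln Mn ha hb; case: ha => ->; case: hb => ->; split; lra.
  rewrite /good /= -/l -/m; split; last by rewrite exprSr invfM mulrA.
  - by clear -xa ax Ln eL ha; case: ha => ->; lra.
  - by clear -xa ax Ln eL ha; case: ha => ->; lra.
  - by clear -yb by2 Mn eM hb; case: hb => ->; lra.
  - by clear -yb by2 Mn eM hb; case: hb => ->; lra.
have g0 : good 0%N (x1, y1).
  by rewrite /good /sz !expr0 !divr1 /= /L /M !(addrC _ (_ - _)) !subrK !lexx.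
have [st st0 stS] : exists2 st : nat -> R * R, good 0%N (st 0%N) & forall n, good n (st n) ->
   good n.+1 (st n.+1) /\ [/\ (st n).1 <= (st n.+1).1, (st n.+1).1 + sz L n.+1 <= (st n).1 +
       sz L n, (st n).2 <= (st n.+1).2 & (st n.+1).2 + sz M n.+1 <= (st n).2 + sz M n].
  (* The step number is carried along with the corner, so that one total choice function serves all
     generations; off [good] corners its value is arbitrary. *)
  have /choice[nx Hnx] : forall ns : nat * (R * R), exists s', good ns.1 ns.2 -> good ns.1.+1 s' /\
    [/\ ns.2.1 <= s'.1, s'.1 + sz L ns.1.+1 <= ns.2.1 + sz L ns.1, ns.2.2 <= s'.2 & s'.2 +
        sz M ns.1.+1 <= ns.2.2 + sz M ns.1].
    move=> [n s] /=; have [/step[s' H]|ng] := pselect (good n s); first by exists s'.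
    by exists s.
  exists (fix st n := if n is k.+1 then nx (k, st k) else (x1, y1)) => // n gn.
  exact: (Hnx (n, _)).
have stg n : good n (st n) by elim: n => // n /stS[].
have stm n : [/\ (st n).1 <= (st n.+1).1, (st n.+1).1 + sz L n.+1 <= (st n).1 + sz L n,
    (st n).2 <= (st n.+1).2 & (st n.+1).2 + sz M n.+1 <= (st n).2 + sz M n].
  by have [] := stS n (stg n).
have nested (a u : nat -> R) : (forall n, a n <= u n) -> (forall n, a n <= a n.+1) ->
    (forall n, u n.+1 <= u n) -> exists p, forall n, a n <= p <= u n.
  move=> au aS uS; have amono : {homo a : m n / (m <= n)%N >-> m <= n}.
    by apply: (@homo_leq _ _ (fun x y => x <= y)) => // ? ? ?; exact: le_trans.
  have umono : {homo u : m n / (m <= n)%N >-> n <= m}.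
    by apply: (@homo_leq _ _ (fun x y => y <= x)) => // x y z h1 h2; exact: le_trans h2 h1.
  have amu m n : a m <= u n.
    apply: le_trans (amono _ _ (leq_maxl m n)) _; apply: le_trans (au _) _.
    exact: umono (leq_maxr m n).
  exists (sup (range a)) => n; apply/andP; split.
    by apply: ub_le_sup; [exists (u n) => _ [m _ <-]|exists n].
  by apply: sup_le_ub; [exists (a 0%N), 0%N|move=> _ [m _ <-]].
have [p hp] : exists p, forall n, (st n).1 <= p <= (st n).1 + sz L n.
  by apply: nested => n; [rewrite lerDl sz0|case: (stm n)..].
have [q hq] : exists p, forall n, (st n).2 <= p <= (st n).2 + sz M n.
  by apply: nested => n; [rewrite lerDl sz0|case: (stm n)..].
have clpq : closed_at P Q p q.
  apply: cl; [have /andP[h1 h2] := hp 0%N|have /andP[h1 h2] := hq 0%N];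
  have [? ? ? ? _] := stg 0%N; apply/andP; split; lra.
apply/ler_addgt0Pr => e e0; rewrite add0r.
have S0 : 0 < (L + M + 1) ^+ 2 by rewrite exprn_gt0//; lra.
(* The 1 keeps the divisor positive when both sides have length 0. *)
have [d d0 Hd] := @loop_small _ _ _ _ (e / (L + M + 1) ^+ 2) clpq (divr_gt0 e0 S0).
have [n [nL nM]] : exists n, sz L n < d /\ sz M n < d.
  have cv k : (sz k : nat -> R) @ \oo --> 0.
    rewrite -[X in _ --> X](mulr0 k); apply: cvgM; first exact: cvg_cst.
    under eq_fun do rewrite -exprVn; apply: cvg_expr.
    by rewrite ger0_norm ?invr_ge0// invf_lt1// ltr1n.
  have cvd k : \forall n \near \oo, sz k n < d.
    have /cvgr_dist_lt/(_ _ d0) := cv k; apply: filterS => n.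
    by rewrite sub0r normrN; apply: le_lt_trans; exact: ler_norm.
  by have [n [? ?]] := filter_ex (filterI (cvd L) (cvd M)); exists n.
have [? ? ? ? wn] := stg n.
have := Hd _ _ _ _ (hp n) (hq n); rewrite !(addrC _ (sz _ _)) !addrK => /(_ nL nM).
have cln : closed_on P Q (st n).1 (sz L n + (st n).1) (st n).2 (sz M n + (st n).2).
  by rewrite !(addrC (sz _ _)); apply: closed_onS cl.
move=> /(_ cln); rewrite !(addrC (sz _ _) (_.1)) !(addrC (sz _ _) (_.2)) => le2.
have := le_trans wn le2.
have -> : sz L n + sz M n = (L + M) / 2 ^+ n by rewrite /sz; ring.
rewrite expr_div_n -exprM mulnC exprM (_ : 2 ^+ 2 = 4); last by ring.
rewrite mulrA ler_pM2r ?invr_gt0 ?exprn_gt0// => /le_trans; apply.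
rewrite mulrAC ler_pdivrMr// ler_pM2l// lerXn2r ?nnegrE//; lra.
Qed.

End goursat.

(** * The real-valued modulus and the topology of the complex plane *)

Section complex_modulus.
Context {R : realType}.
Local Notation C := (R[i]^o).
Implicit Types (z w : C) (x e : R).

Lemma cabsE z : cabs z = Num.sqrt (complex.Re z ^+ 2 + complex.Im z ^+ 2).
Proof. by case: z. Qed.

Lemma sqr_cabs z : cabs z ^+ 2 = complex.Re z ^+ 2 + complex.Im z ^+ 2.
Proof. by rewrite cabsE sqr_sqrtr// addr_ge0// sqr_ge0. Qed.

Lemma cabs_ge0 z : 0 <= cabs z.
Proof. by rewrite cabsE sqrtr_ge0. Qed.

Lemma normcR z : `|z| = (cabs z)%:C.
Proof. by case: z. Qed.

Lemma cabsM z w : cabs (z * w) = cabs z * cabs w.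
Proof. exact: ComplexField.Normc.normcM. Qed.

Lemma cabsV z : cabs z^-1 = (cabs z)^-1.
Proof. exact: ComplexField.Normc.normcV. Qed.

Lemma cabs_div z w : cabs (z / w) = cabs z / cabs w.
Proof. by rewrite cabsM cabsV. Qed.

Lemma cabs0 : cabs (0 : C) = 0.
Proof. exact: ComplexField.Normc.normc0. Qed.

Lemma cabs1 : cabs (1 : C) = 1.
Proof. exact: ComplexField.Normc.normc1. Qed.

Lemma cabs_eq0 z : (cabs z == 0) = (z == 0).
Proof.
apply/eqP/eqP => [|->]; last exact: cabs0.
exact: ComplexField.Normc.eq0_normc.
Qed.

Lemma cabs_gt0 z : (0 < cabs z) = (z != 0).
Proof. by rewrite lt_neqAle cabs_ge0 andbT eq_sym cabs_eq0. Qed.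

Lemma cabsN z : cabs (- z) = cabs z.
Proof. exact: normcN. Qed.

Lemma cabs_distC z w : cabs (z - w) = cabs (w - z).
Proof. by rewrite -cabsN opprB. Qed.

Lemma ler_cabsD z w : cabs (z + w) <= cabs z + cabs w.
Proof. exact: le_normcD. Qed.

Lemma ler_cabsB z w : cabs (z - w) <= cabs z + cabs w.
Proof. by rewrite -(cabsN w) ler_cabsD. Qed.

Lemma ler_cabs_sub z w : cabs z - cabs w <= cabs (z - w).
Proof. by rewrite lerBlDr (le_trans _ (ler_cabsD _ _))// subrK. Qed.

Lemma cabs_conj z : cabs (conjc z) = cabs z.
Proof. by case: z => a b; rewrite !cabsE/= sqrrN. Qed.

Lemma cabs_real x : cabs (x%:C : C) = `|x|.
Proof. by rewrite cabsE/= expr0n addr0 sqrtr_sqr. Qed.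

Lemma Re_le_cabs z : `|complex.Re z| <= cabs z.
Proof.
rewrite cabsE -sqrtr_sqr ler_sqrt ?addr_ge0 ?sqr_ge0//.
by rewrite lerDl sqr_ge0.
Qed.

Lemma Im_le_cabs z : `|complex.Im z| <= cabs z.
Proof.
rewrite cabsE -sqrtr_sqr ler_sqrt ?addr_ge0 ?sqr_ge0//.
by rewrite lerDr sqr_ge0.
Qed.

Lemma cabs_le_ReIm z : cabs z <= `|complex.Re z| + `|complex.Im z|.
Proof.
rewrite cabsE -[leRHS]ger0_norm ?addr_ge0// -sqrtr_sqr ler_sqrt ?sqr_ge0//.
rewrite sqrrD !real_normK ?num_real// addrAC lerDl mulrn_wge0// mulr_ge0//.
Qed.

Lemma mulc_conj z : z * conjc z = (cabs z ^+ 2)%:C.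
Proof. by rewrite sqr_cabs; case: z => a b; apply/eqP; rewrite eq_complex/=; apply/andP; split;
    apply/eqP; ring. Qed.

(** Balls of R[i] have radii in R[i]; positivity there forces a zero imaginary part, which reduces
    neighbourhoods to real radii. *)
Lemma nbhsC_cabs z (P : set C) :
  (\forall w \near z, P w) <->
  exists2 d : R, 0 < d & forall w, cabs (w - z) < d -> P w.
Proof.
split.
  move=> /nbhs_ballP[[a b] /=]; rewrite ltcE/= => /andP[/eqP b0 a0] H.
  exists a => // w wz; apply: H; rewrite /ball/= normcR cabs_distC b0.
  by rewrite -[_ +i* 0]/(a%:C) ltcR.
move=> [d d0 H]; apply/nbhs_ballP; exists (d%:C) => /=; first by rewrite ltcR.
by move=> w; rewrite /ball/= normcR ltcR cabs_distC => /H.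
Qed.

Lemma cvgC_cabs T (F : set_system T) {FF : Filter F} (f : T -> C) z :
  f @ F --> z <-> forall e, 0 < e -> \forall t \near F, cabs (f t - z) <= e.
Proof.
split.
  move=> /cvgrPdist_le H e e0; have := H (e%:C).
  rewrite ltcR => /(_ e0); apply: filterS => t.
  by rewrite normcR lecR cabs_distC.
move=> H; apply/cvgrPdist_le => -[a b]; rewrite ltcE/= => /andP[/eqP -> a0].
have := H _ a0; apply: filterS => t.
by rewrite normcR cabs_distC -[_ +i* 0]/(a%:C) lecR.
Qed.

(** The increment form has no division, so it also covers w = z; its converse [eps_derivable] lets
    derivability be proved from estimates. *)
Lemma derivable_eps (f : C -> C) z : derivable f z 1 ->
  forall e, 0 < e -> exists2 d : R, 0 < d & forall w, cabs (w - z) < d ->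
    cabs (f w - f z - derive1 f z * (w - z)) <= e * cabs (w - z).
Proof.
move=> df e e0.
have cv : h^-1 *: (f (h + z) - f z) @[h --> (0 : C)^'] --> derive1 f z.
  have /cvg_ex[/= l Hl] := df.
  have E : (fun h : C => h^-1 *: ((f \o shift z) (h *: 1) - f z)) =
      (fun h : C => h^-1 *: (f (h + z) - f z)).
    by apply/funext => h /=; rewrite /shift/= -[h *: 1]/(h * 1) mulr1.
  rewrite /derive1; apply: cvgP; rewrite E in Hl; exact: Hl.
have : \forall h \near (0 : C), h != 0 ->
    cabs (h^-1 *: (f (h + z) - f z) - derive1 f z) <= e.
  exact: (cvgC_cabs _ _).1 cv _ e0.
move=> /nbhsC_cabs[d d0 H]; exists d => // w wz.
have [->|nwz] := eqVneq w z; first by rewrite !subrr mulr0 subr0 cabs0 mulr0.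
have := H (w - z); rewrite subr0 subrK => /(_ wz).
rewrite subr_eq0 => /(_ nwz).
have -> : f w - f z - derive1 f z * (w - z) =
    ((w - z)^-1 *: (f w - f z) - derive1 f z) * (w - z).
  rewrite -[_ *: _]/(_ * _); field.
  by rewrite subr_eq0.
by move=> h; rewrite cabsM ler_wpM2r// cabs_ge0.
Qed.

Lemma eps_derivable (f : C -> C) z (A : C) : 
  (forall e, 0 < e -> exists2 d : R, 0 < d & forall w, cabs (w - z) < d ->
    cabs (f w - f z - A * (w - z)) <= e * cabs (w - z)) -> derivable f z 1.
Proof.
move=> H; apply/cvg_ex; exists A; apply/cvgC_cabs => e /H[d d0 Hd].
suff : \forall h \near (0 : C), h != 0 ->
    cabs (h^-1 *: ((f \o shift z) (h *: 1) - f z) - A) <= e by [].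
apply/nbhsC_cabs; exists d => // h; rewrite subr0 => hd nh.
have := Hd (h + z); rewrite addrK => /(_ hd) {}Hd.
rewrite -[h *: 1]/(h * 1) mulr1 /= /shift/=.
have -> : h^-1 *: (f (h + z) - f z) - A = (f (h + z) - f z - A * h) / h.
  by rewrite -[_ *: _]/(_ * _); field.
by rewrite cabs_div ler_pdivrMr// cabs_gt0.
Qed.

Lemma continuous_cabsP (f : C -> C) z : {for z, continuous f} <->
  forall e, 0 < e -> exists2 d : R, 0 < d & forall w, cabs (w - z) < d ->
    cabs (f w - f z) <= e.
Proof.
have E := @cvgC_cabs _ (nbhs z) _ f (f z); split.
  by move=> /E H e /H /nbhsC_cabs.
by move=> H; apply/E => e /H h; apply/nbhsC_cabs.
Qed.

Lemma derivable_continuous (f : C -> C) z : derivable f z 1 -> {for z, continuous f}.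
Proof. by move=> /derivable1_diffP; exact: differentiable_continuous. Qed.

(** Schwarz reflection: the derivative is the conjugate of f' at conj z. *)
Lemma derivable_conjconj (f : C -> C) z : derivable f (conjc z) 1 ->
  derivable (fun w => conjc (f (conjc w)) : C) z 1.
Proof.
move=> df; apply: (@eps_derivable _ _ (conjc (derive1 f (conjc z)))) => e /(derivable_eps df)[d d0 H].
exists d => // w wz; have := H (conjc w).
have -> : conjc w - conjc z = conjc (w - z) :> C by rewrite rmorphB.
rewrite cabs_conj => /(_ wz).
set A := derive1 f _ => h.
have -> : conjc (f (conjc w)) - conjc (f (conjc z)) - conjc A * (w - z) =
    conjc (f (conjc w) - f (conjc z) - A * conjc (w - z)) :> C.
  by rewrite !rmorphB rmorphM/= !rmorphB/= !conjcK.
by rewrite cabs_conj.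
Qed.

End complex_modulus.

(** * Means over circles and the Cauchy-Schwarz inequality *)

Section circle_average.
Context {R : realType}.
Local Notation C := (R[i]^o).
Implicit Types (F G H : R -> C) (r t e : R).

Lemma cvgC_ReIm T (A : set_system T) {FA : Filter A} (F : T -> C) (z : C) :
  complex.Re (F t) @[t --> A] --> complex.Re z ->
  complex.Im (F t) @[t --> A] --> complex.Im z -> F @ A --> z.
Proof.
move=> cR cI; apply/cvgC_cabs => e e0; have e20 : 0 < e / 2 by rewrite divr_gt0.
have /cvgrPdistC_le/(_ _ e20) := cR; have /cvgrPdistC_le/(_ _ e20) := cI.
apply: filterS2 => t hI hR; apply: (le_trans (cabs_le_ReIm _)).
by rewrite !raddfB/= [leRHS](splitr e) lerD.
Qed.

Lemma cvg_Re T (A : set_system T) {FA : Filter A} (F : T -> C) (z : C) :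
  F @ A --> z -> complex.Re (F t) @[t --> A] --> complex.Re z.
Proof.
move=> /cvgC_cabs cF; apply/cvgrPdistC_le => e /cF; apply: filterS => t.
by apply: le_trans; rewrite -raddfB Re_le_cabs.
Qed.

Lemma cvg_Im T (A : set_system T) {FA : Filter A} (F : T -> C) (z : C) :
  F @ A --> z -> complex.Im (F t) @[t --> A] --> complex.Im z.
Proof.
move=> /cvgC_cabs cF; apply/cvgrPdistC_le => e /cF; apply: filterS => t.
by apply: le_trans; rewrite -raddfB Im_le_cabs.
Qed.

Lemma cvg_conjc T (A : set_system T) {FA : Filter A} (F : T -> C) (z : C) :
  F @ A --> z -> (conjc (F t) : C) @[t --> A] --> (conjc z : C).
Proof.
move=> /cvgC_cabs cF; apply/cvgC_cabs => e /cF; apply: filterS => t.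
by rewrite -rmorphB cabs_conj.
Qed.

Lemma cvg_cabs T (A : set_system T) {FA : Filter A} (F : T -> C) (z : C) :
  F @ A --> z -> cabs (F t) @[t --> A] --> cabs z.
Proof.
move=> /cvgC_cabs cF; apply/cvgrPdistC_le => e /cF; apply: filterS => t.
apply: le_trans; rewrite ler_norml ler_cabs_sub andbT lerNl opprB.
by rewrite cabs_distC ler_cabs_sub.
Qed.

Lemma polarE r t : polar r t = (r * cos t) +i* (r * sin t) :> C.
Proof. by rewrite /polar/=; congr (_ +i* _); ring. Qed.

Lemma cabs_polar r t : 0 <= r -> cabs (polar r t : C) = r.
Proof.
move=> r0; rewrite polarE cabsE/= !exprMn -mulrDr cos2Dsin2 mulr1.
by rewrite sqrtr_sqr ger0_norm.
Qed.

Lemma polar_cvg T (A : set_system T) {FA : Filter A} (f g : T -> R) r t :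
  f @ A --> r -> g @ A --> t -> (polar (f u) (g u) : C) @[u --> A] --> (polar r t : C).
Proof.
move=> cf cg; apply: cvgC_ReIm.
  have -> : (fun u => complex.Re (polar (f u) (g u))) = (fun u => f u * cos (g u)).
    by apply/funext => u; rewrite polarE.
  by rewrite polarE/=; apply: cvgM => //; apply: continuous_cvg => //; exact: continuous_cos.
have -> : (fun u => complex.Im (polar (f u) (g u))) = (fun u => f u * sin (g u)).
  by apply/funext => u; rewrite polarE.
by rewrite polarE/=; apply: cvgM => //; apply: continuous_cvg => //; exact: continuous_sin.
Qed.

Lemma continuous_polar r : continuous (fun t => polar r t : C).
Proof. by move=> t; apply: polar_cvg; [exact: cvg_cst|exact: cvg_id]. Qed.

Lemma polar_per r t : polar r (t + 2 * pi) = polar r t :> C.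
Proof.
rewrite !polarE; have -> : 2 * pi = pi *+ 2 :> R by rewrite mulr2n; ring.
by rewrite cosD2pi sinD2pi.
Qed.

Lemma continuous_circle (f : C -> C) r :
  (forall t, {for polar r t, continuous f}) -> continuous (fun t => f (polar r t) : C).
Proof.
by move=> cf t; apply: (continuous_comp (@continuous_polar r t)); exact: cf.
Qed.

Definition ravg (f : R -> R) : R := (2 * pi)^-1 * itg 0 (2 * pi) f.

(** Has the shape of [circle_inner], so that statements on means apply to the inner products of the
    Hardy space by conversion. *)
Definition cavg F : C := ((2 * pi)^-1)%:C *
  (itg 0 (2 * pi) (fun t => complex.Re (F t)) +i*
   itg 0 (2 * pi) (fun t => complex.Im (F t))).

Lemma cavgE F : cavg F = ravg (fun t => complex.Re (F t)) +i*
  ravg (fun t => complex.Im (F t)).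
Proof. by rewrite /cavg/=; congr (_ +i* _); rewrite /ravg; ring. Qed.

Lemma circle_mean2E (f : C -> C) r :
  circle_mean2 f r = ravg (fun t => cabs (f (polar r t)) ^+ 2).
Proof. by []. Qed.

Lemma pi2_gt0 : 0 < 2 * pi :> R.
Proof. by rewrite mulr_gt0// pi_gt0. Qed.

Lemma cont_itv (a b : R) (f : R -> R) : continuous f -> cont_on a b f.
Proof. by move=> cf x _; exact: cf. Qed.

Lemma continuousRD (f g : R -> R) : continuous f -> continuous g ->
  continuous (fun t => f t + g t).
Proof. by move=> cf cg t; apply: (@continuousD _ R^o); [exact: cf|exact: cg]. Qed.

Lemma continuousRZ (k : R) (f : R -> R) : continuous f ->
  continuous (fun t => k * f t).
Proof. by move=> cf t; apply: continuousM; [exact: cvg_cst|exact: cf]. Qed.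

Lemma ravgD (f g : R -> R) : continuous f -> continuous g ->
  ravg (fun t => f t + g t) = ravg f + ravg g.
Proof. by move=> cf cg; rewrite /ravg itgD ?mulrDr//; exact: cont_itv. Qed.

Lemma ravgZ (k : R) (f : R -> R) : continuous f -> ravg (fun t => k * f t) = k * ravg f.
Proof. by move=> cf; rewrite /ravg itgZ; [rewrite mulrCA|exact: cont_itv]. Qed.

Lemma eq_ravg (f g : R -> R) : f =1 g -> ravg f = ravg g.
Proof. by move=> fg; rewrite /ravg; congr (_ * _); exact: eq_itg. Qed.

Lemma le_ravg (f g : R -> R) : continuous f -> continuous g -> (forall t, f t <= g t) ->
  ravg f <= ravg g.
Proof.
move=> cf cg fg; rewrite /ravg ler_pM2l ?invr_gt0 ?pi2_gt0//.
by apply: le_itg => //; exact: cont_itv.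
Qed.

Lemma ravg_cst (k : R) : ravg (fun=> k) = k.
Proof.
rewrite /ravg itg_cst ?(ltW pi2_gt0)// subr0 mulrC mulfK//.
by rewrite gt_eqF// pi2_gt0.
Qed.

Lemma ravg_ge0 (f : R -> R) : (forall t, 0 <= f t) -> 0 <= ravg f.
Proof.
by move=> f0; rewrite mulr_ge0 ?invr_ge0 ?(ltW pi2_gt0)// itg_ge0.
Qed.

Lemma continuous_Re F : continuous F -> continuous (fun t => complex.Re (F t)).
Proof. by move=> cF t; apply: cvg_Re; exact: cF. Qed.

Lemma continuous_Im F : continuous F -> continuous (fun t => complex.Im (F t)).
Proof. by move=> cF t; apply: cvg_Im; exact: cF. Qed.

Lemma continuous_conj F : continuous F -> continuous (fun t => conjc (F t) : C).
Proof. by move=> cF t; apply: cvg_conjc; exact: cF. Qed.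

Lemma continuous_cabs F : continuous F -> continuous (fun t => cabs (F t)).
Proof. by move=> cF t; apply: cvg_cabs; exact: cF. Qed.

Lemma continuousCM F G : continuous F -> continuous G -> continuous (fun t => F t * G t : C).
Proof. by move=> cF cG t; apply: (@continuousM R[i]); [exact: cF|exact: cG]. Qed.

Lemma continuousCD F G : continuous F -> continuous G -> continuous (fun t => F t + G t : C).
Proof. by move=> cF cG t; apply: continuousD; [exact: cF|exact: cG]. Qed.

Lemma continuousCB F G : continuous F -> continuous G -> continuous (fun t => F t - G t : C).
Proof. by move=> cF cG t; apply: continuousB; [exact: cF|exact: cG]. Qed.

Lemma continuous_sqr (f : R -> R) : continuous f -> continuous (fun t => f t ^+ 2).
Proof. by move=> cf t; apply: continuousM; exact: cf. Qed.

Lemma continuousC_sum (I : Type) (s : seq I) (F : I -> R -> C) :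
  (forall i, continuous (F i)) -> continuous (fun t => \sum_(i <- s) F i t).
Proof.
move=> cF; elim: s => [|i s IH].
  rewrite (_ : (fun t => _) = fun=> 0); first by move=> t; exact: cvg_cst.
  by apply/funext => t; rewrite big_nil.
rewrite (_ : (fun t => _) = fun t => F i t + \sum_(i <- s) F i t).
  exact: (continuousCD (cF i) IH).
by apply/funext => t; rewrite big_cons.
Qed.

Lemma eq_cavg F G : F =1 G -> cavg F = cavg G.
Proof. by move=> /funext ->. Qed.

Lemma cavgD F G : continuous F -> continuous G ->
  cavg (fun t => F t + G t) = cavg F + cavg G.
Proof.
move=> cF cG; rewrite !cavgE; apply/eqP; rewrite eq_complex/=.
rewrite -!ravgD ?(continuous_Re, continuous_Im)//; try exact: continuous_Re; try exact: continuous_Im.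
by apply/andP; split; apply/eqP; apply: eq_ravg => t; rewrite raddfD.
Qed.

Lemma cavgZ (k : C) F : continuous F -> cavg (fun t => k * F t) = k * cavg F.
Proof.
move=> cF; rewrite !cavgE; apply/eqP; rewrite eq_complex/=.
have cR := continuous_Re cF; have cI := continuous_Im cF.
case: k => a b /=; rewrite -mulNr -(ravgZ a cR) -(ravgZ (- b) cI) -(ravgZ a cI).
rewrite -(ravgZ b cR) -!ravgD; try exact: continuousRZ.
by apply/andP; split; apply/eqP; apply: eq_ravg => t; case: (F t) => c d /=; ring.
Qed.

Lemma cavg_cst (k : C) : cavg (fun=> k) = k.
Proof. by rewrite cavgE !ravg_cst; case: k. Qed.

Lemma cavg_sum (I : Type) (s : seq I) (F : I -> R -> C) :
  (forall i, continuous (F i)) ->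
  cavg (fun t => \sum_(i <- s) F i t) = \sum_(i <- s) cavg (F i).
Proof.
move=> cF; elim: s => [|i s IH].
  by rewrite big_nil (@eq_cavg _ (fun=> 0)) ?cavg_cst// => t; rewrite big_nil.
rewrite big_cons -IH -cavgD//; last exact: continuousC_sum.
by apply: eq_cavg => t; rewrite big_cons.
Qed.

Lemma cavg_conj F : continuous F -> cavg (fun t => conjc (F t)) = conjc (cavg F).
Proof.
move=> cF; rewrite !cavgE/=; congr (_ +i* _).
  by apply: eq_ravg => t; case: (F t).
rewrite -mulN1r -ravgZ; last exact: continuous_Im.
by apply: eq_ravg => t; rewrite mulN1r; case: (F t).
Qed.

Lemma cavg_sqr F : cavg (fun t => F t * conjc (F t)) = (ravg (fun t => cabs (F t) ^+ 2))%:C.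
Proof.
rewrite (@eq_cavg _ (fun t => (cabs (F t) ^+ 2)%:C)); last by move=> t; rewrite mulc_conj.
by rewrite cavgE/= ravg_cst.
Qed.

(** With I the mean on the left, the mean of |F - s I G|^2 is a nonnegative quadratic polynomial in
    the real number s, minimal at s = 1/n, where n is the mean of |G|^2. *)
Lemma cauchy_schwarz F G : continuous F -> continuous G ->
  cabs (cavg (fun t => F t * conjc (G t))) ^+ 2 <=
  ravg (fun t => cabs (F t) ^+ 2) * ravg (fun t => cabs (G t) ^+ 2).
Proof.
move=> cF cG; set I := cavg _.
set a := ravg _; set n := ravg (fun t => cabs (G t) ^+ 2).
have cFG : continuous (fun t => F t * conjc (G t) : C).
  exact: (continuousCM cF (continuous_conj cG)).
have cI : continuous (fun _ : R => conjc I : C) by move=> t; exact: cvg_cst.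
have a0 : 0 <= a by apply: ravg_ge0 => t; exact: sqr_ge0.
have n0 : 0 <= n by apply: ravg_ge0 => t; exact: sqr_ge0.
have key (s : R) : 0 <= a - 2 * s * cabs I ^+ 2 + s ^+ 2 * cabs I ^+ 2 * n.
  have : 0 <= ravg (fun t => cabs (F t - s%:C * I * G t) ^+ 2).
    by apply: ravg_ge0 => t; exact: sqr_ge0.
  have E t : cabs (F t - s%:C * I * G t) ^+ 2 = cabs (F t) ^+ 2 +
    ((- (2 * s)) * complex.Re (conjc I * (F t * conjc (G t))) +
     s ^+ 2 * cabs I ^+ 2 * cabs (G t) ^+ 2).
    by rewrite !sqr_cabs; case: (F t) => ? ?; case: (G t) => ? ?; case: (I) => ? ? /=; ring.
  have c1 : continuous (fun t => complex.Re (conjc I * (F t * conjc (G t)))).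
    exact: (continuous_Re (continuousCM cI cFG)).
  have c2 := continuous_sqr (continuous_cabs cG).
  rewrite (eq_ravg E) ravgD; last by apply: continuousRD; exact: continuousRZ.
    rewrite ravgD; try exact: continuousRZ.
    rewrite ravgZ// ravgZ//.
    have -> : ravg (fun t => complex.Re (conjc I * (F t * conjc (G t)))) = cabs I ^+ 2.
      transitivity (complex.Re (cavg (fun t => conjc I * (F t * conjc (G t))))).
      by rewrite cavgE.
    by rewrite cavgZ// -/I mulrC mulc_conj.
    by rewrite -/a -/n; lra.
  exact: continuous_sqr (continuous_cabs cF).
have [n1|n1] := eqVneq n 0.
  (* With n = 0 the polynomial is affine in s, and this s gives it the value -1 unless I = 0. *)
  have := key ((a + 1) / (2 * cabs I ^+ 2)); rewrite n1 !mulr0 addr0.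
  have [->|I0] := eqVneq (cabs I) 0; first by rewrite expr0n.
  suff -> : 2 * ((a + 1) / (2 * cabs I ^+ 2)) * cabs I ^+ 2 = a + 1 by lra.
  by field; rewrite I0.
have np : 0 < n by rewrite lt_neqAle eq_sym n1.
have := key (n^-1).
suff -> : a - 2 * n^-1 * cabs I ^+ 2 + n^-1 ^+ 2 * cabs I ^+ 2 * n = (a * n - cabs I ^+ 2) / n.
  by rewrite pmulr_lge0 ?invr_gt0// subr_ge0.
by field.
Qed.

End circle_average.

(** * Cauchy's formula and the Hardy norm *)

Section circle_invariance.
Context {R : realType}.
Local Notation C := (R[i]^o).
Implicit Types (r s t e x y : R).

Local Notation E x y := (polar (expR x) y : C).

Lemma derive_eps (f : R -> R) (a : R) e : is_derive (0 : R) (1 : R) f a -> 0 < e ->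
  exists2 d, 0 < d & forall t, `|t| < d -> `|f t - f 0 - a * t| <= e * `|t|.
Proof.
move=> [df fa] e0.
have cv : h^-1 *: (f h - f 0) @[h --> (0 : R)^'] --> a.
  have /cvg_ex[/= l Hl] := df.
  have -> : a = l by rewrite -fa; apply: cvg_lim.
  suff <- : (fun h : R => h^-1 *: ((f \o shift (0 : R^o)) (h *: (1 : R^o)) - f 0)) =
      (fun h : R => h^-1 *: (f h - f 0)) by [].
  by apply/funext => h /=; rewrite /shift/= -[h *: (1 : R^o)]/(h * 1) mulr1 addr0.
have : \forall h \near (0 : R), h != 0 -> `|h^-1 *: (f h - f 0) - a| <= e.
  by have /cvgrPdistC_le/(_ _ e0) := cv.
move=> /nbhs_ballP[d /= d0 H]; exists d => // t td.
have [->|t0] := eqVneq t 0; first by rewrite mulr0 !subrr normr0 mulr0.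
have := H t; rewrite /ball/= sub0r normrN => /(_ td t0).
have -> : f t - f 0 - a * t = (t^-1 *: (f t - f 0) - a) * t.
  by rewrite -[_ *: _]/(_ * _); field.
by rewrite normrM ler_pM2r// normr_gt0.
Qed.

(** [E x y] is exp(x + i y), whose derivative at 0 is 1. *)
Lemma polar_exp_eps e : 0 < e -> exists2 d, 0 < d & forall x y,
  `|x| < d -> `|y| < d -> cabs (E x y - 1 - (x +i* y)) <= e * (`|x| + `|y|).
Proof.
move=> e0.
pose k := Num.min e 1 / 8.
have k0 : 0 < k by rewrite divr_gt0// lt_min e0 ltr01.
have k1 : k <= 1 / 8 by rewrite ler_pM2r// ge_min lexx orbT.
have ke : k <= e / 8 by rewrite ler_pM2r// ge_min lexx.
have [d1 d10 H1] := derive_eps (is_derive_expR 0) k0.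
have [d2 d20 H2] := derive_eps (is_derive_cos 0) k0.
have [d3 d30 H3] := derive_eps (is_derive_sin 0) k0.
exists (Num.min (Num.min d1 k) (Num.min d2 d3)).
  by rewrite !lt_min d10 k0 d20 d30.
move=> x y; rewrite !lt_min => /andP[/andP[x1 xk] _] /andP[_ /andP[y2 y3]].
have := H1 x x1; have := H2 y y2; have := H3 y y3.
rewrite !(sin0, cos0, expR0, oppr0, mul0r, subr0, mul1r) => hs hc he.
apply: (le_trans (cabs_le_ReIm _)).
rewrite polarE/=.
set ex := expR x in he *; set c := cos y in hc *; set s := sin y in hs *.
have ex2 : `|ex| <= 2.
  have -> : ex = (ex - 1 - x) + x + 1 by ring.
  apply: (le_trans (ler_normD _ _)); rewrite normr1.
  have := ler_normD (ex - 1 - x) x.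
  have : k * `|x| <= 1 * `|x| by apply: ler_wpM2r => //; lra.
  lra.
have ex1 : `|ex - 1| <= 2 * k.
  have -> : ex - 1 = (ex - 1 - x) + x by ring.
  apply: (le_trans (ler_normD _ _)).
  have : k * `|x| <= 1 * `|x| by apply: ler_wpM2r => //; lra.
  lra.
have -> : ex * c - 1 - x = ex * (c - 1) + (ex - 1 - x) by ring.
have -> : ex * s - 0 - y = ex * (s - y) + (ex - 1) * y by ring.
have b1 : `|ex * (c - 1) + (ex - 1 - x)| <= 2 * (k * `|y|) + k * `|x|.
  by apply: (le_trans (ler_normD _ _)); rewrite normrM lerD// ler_pM.
have b2 : `|ex * (s - y) + (ex - 1) * y| <= 2 * (k * `|y|) + 2 * k * `|y|.
  by apply: (le_trans (ler_normD _ _)); rewrite !normrM lerD// ler_pM.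
apply: (le_trans (lerD b1 b2)).
have h1 : k * `|x| <= e / 8 * `|x| by rewrite ler_wpM2r.
have h2 : k * `|y| <= e / 8 * `|y| by rewrite ler_wpM2r.
have h3 : 0 <= e * `|x| by rewrite mulr_ge0// ltW.
have h4 : 0 <= e * `|y| by rewrite mulr_ge0// ltW.
lra.
Qed.

Lemma polarD (p q x y : R) : E (p + x) (q + y) = E p q * E x y.
Proof.
rewrite !polarE expRD cosD sinD; apply/eqP; rewrite eq_complex/=.
by apply/andP; split; apply/eqP; ring.
Qed.

(** The chain rule for f composed with exp, with A = f'(E p q) E p q. *)
Lemma log_derivable_eps (f : C -> C) p q : derivable f (E p q) 1 ->
  exists A : C, forall e, 0 < e -> exists2 d, 0 < d & forall x y, `|x - p| < d ->
    `|y - q| < d -> cabs (f (E x y) - f (E p q) - A * ((x - p) +i* (y - q))) <=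
    e * (`|x - p| + `|y - q|).
Proof.
move=> df; set z := E p q in df *; set D := derive1 f z.
exists (D * z) => e e0.
have Z0 : 0 < cabs z by rewrite cabs_polar ?expR_ge0// expR_gt0.
pose k1 := e / 2 / (cabs z * 2).
have k10 : 0 < k1 by rewrite !divr_gt0// mulr_gt0.
have [d1 d10 H1] := derivable_eps df k10.
pose k2 := Num.min 1 (e / 2 / (cabs D * cabs z + 1)).
have DZ0 : 0 < cabs D * cabs z + 1 by rewrite ltr_wpDl// mulr_ge0 ?cabs_ge0.
have k20 : 0 < k2 by rewrite lt_min ltr01 !divr_gt0.
have [d2 d20 H2] := polar_exp_eps k20.
exists (Num.min d2 (d1 / (4 * cabs z))).
  by rewrite lt_min d20 divr_gt0// mulr_gt0.
move=> x y; rewrite !lt_min => /andP[x2 x1] /andP[y2 y1].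
have EE : E x y = z * E (x - p) (y - q) by rewrite -polarD !subrKC.
have := H2 _ _ x2 y2; set u := E (x - p) (y - q) in EE *.
set v := _ +i* _; set S := `|x - p| + `|y - q| => Hu.
have vS : cabs v <= S by apply: le_trans (cabs_le_ReIm _) _.
have S0 : 0 <= S by rewrite addr_ge0.
have k2S : k2 * S <= S by rewrite ler_piMl// ge_min lexx.
have u1 : cabs (u - 1) <= 2 * S.
  have -> : u - 1 = (u - 1 - v) + v by rewrite subrK.
  apply: (le_trans (ler_cabsD _ _)); lra.
have Ez : E x y - z = z * (u - 1) by rewrite EE mulrBr mulr1.
have Ezd : cabs (E x y - z) < d1.
  rewrite Ez cabsM; apply: (@le_lt_trans _ _ (cabs z * (2 * S))).
    by rewrite ler_pM2l.
  rewrite mulrC -ltr_pdivlMr//.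
  have : d1 / cabs z = 4 * (d1 / (4 * cabs z)) by field; rewrite gt_eqF.
  move: x1 y1; rewrite /S; lra.
have := H1 _ Ezd; rewrite -/D Ez cabsM => Hf.
have -> : f (E x y) - f z - D * z * v =
   (f (E x y) - f z - D * (z * (u - 1))) + D * z * (u - 1 - v) by ring.
apply: (le_trans (ler_cabsD _ _)); rewrite [leRHS](_ : _ = e / 2 * S + e / 2 * S); last by field.
apply: lerD.
  apply: (le_trans Hf); rewrite /k1.
  have -> : e / 2 * S = e / 2 / (cabs z * 2) * (cabs z * (2 * S)) by field; rewrite gt_eqF.
  by rewrite ler_pM2l// ler_pM2l.
rewrite (cabsM (D * z)) (cabsM D); apply: (@le_trans _ _ ((cabs D * cabs z + 1) * (k2 * S))).
  apply: ler_pM.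
  - exact: mulr_ge0 (cabs_ge0 _) (cabs_ge0 _).
  - exact: cabs_ge0.
  - by rewrite lerDl.
  - exact: Hu.
have : k2 <= e / 2 / (cabs D * cabs z + 1) by rewrite ge_min lexx orbT.
by rewrite ler_pdivlMr// => h; rewrite mulrA ler_wpM2r// mulrC.
Qed.

(** For g = f(exp(x + i y)), the form g d(x + i y) has real part Re g dx - Im g dy and imaginary
    part Im g dx + Re g dy; the Cauchy-Riemann equations make both closed. *)
Lemma closed_at_log (f : C -> C) p q : derivable f (E p q) 1 ->
  closed_at (fun x y => complex.Re (f (E x y))) (fun x y => - complex.Im (f (E x y))) p q /\
  closed_at (fun x y => complex.Im (f (E x y))) (fun x y => complex.Re (f (E x y))) p q.
Proof.
move=> /log_derivable_eps[[a b] H]; split.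
- exists a, (- b), (- a) => e /H[d d0 Hd]; exists d => // x y xp yq.
  have {}Hd := Hd x y xp yq; split; apply: le_trans Hd.
    apply: le_trans (Re_le_cabs _); rewrite le_eqVlt; apply/orP; left; apply/eqP.
    by congr `|_|; case: (f _) => ? ?; case: (f _) => ? ? /=; ring.
  apply: le_trans (Im_le_cabs _); rewrite -normrN le_eqVlt; apply/orP; left; apply/eqP.
  by congr `|_|; case: (f _) => ? ?; case: (f _) => ? ? /=; ring.
- exists b, a, (- b) => e /H[d d0 Hd]; exists d => // x y xp yq.
  have {}Hd := Hd x y xp yq; split; apply: le_trans Hd.
    apply: le_trans (Im_le_cabs _); rewrite le_eqVlt; apply/orP; left; apply/eqP.
    by congr `|_|; case: (f _) => ? ?; case: (f _) => ? ? /=; ring.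
  apply: le_trans (Re_le_cabs _); rewrite le_eqVlt; apply/orP; left; apply/eqP.
  by congr `|_|; case: (f _) => ? ?; case: (f _) => ? ? /=; ring.
Qed.

Lemma polar_2pi r : polar r (2 * pi) = polar r 0 :> C.
Proof. by rewrite -(polar_per r 0) add0r. Qed.

(* E maps rectangles of height 2 pi to annuli; the horizontal sides of the loop
   integral cancel by periodicity. *)
Lemma circle_invariance_log (f : C -> C) x1 x2 : x1 <= x2 ->
  (forall p q, x1 <= p <= x2 -> derivable f (E p q) 1) ->
  cavg (fun t => f (E x1 t)) = cavg (fun t => f (E x2 t)).
Proof.
move=> x12 H; have pi0 := ltW (@pi2_gt0 R).
have x1i : x1 <= x1 <= x2 by rewrite lexx.
have x2i : x1 <= x2 <= x2 by rewrite lexx andbT.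
have cc x : x1 <= x <= x2 -> continuous (fun t => f (E x t) : C).
  by move=> xi; apply: continuous_circle => t; apply: derivable_continuous; exact: H.
have cR x (xi : x1 <= x <= x2) : cont_on 0 (2 * pi) (fun t => complex.Re (f (E x t))).
  by apply: cont_itv; apply: continuous_Re; exact: cc.
have cI x (xi : x1 <= x <= x2) : cont_on 0 (2 * pi) (fun t => complex.Im (f (E x t))).
  by apply: cont_itv; apply: continuous_Im; exact: cc.
have z0 : itg x1 x2 (fun=> 0) = 0 :> R by rewrite itg_cst// mul0r.
suff [hR hI] : itg 0 (2 * pi) (fun t => complex.Re (f (E x1 t))) =
      itg 0 (2 * pi) (fun t => complex.Re (f (E x2 t))) /\
    itg 0 (2 * pi) (fun t => complex.Im (f (E x1 t))) =
      itg 0 (2 * pi) (fun t => complex.Im (f (E x2 t))) by rewrite !cavgE /ravg hR hI.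
split; apply/eqP; rewrite -subr_eq0; apply/eqP.
- have := @goursat R (fun x y => complex.Im (f (E x y)))
    (fun x y => complex.Re (f (E x y))) x1 x2 0 (2 * pi) x12 pi0.
  rewrite /loop (@eq_itg _ x1 x2 _ (fun=> 0)) => [|x _]; last by rewrite polar_2pi subrr.
  rewrite z0 add0r itgB; [|exact: cR..] => h; apply/eqP; rewrite -oppr_eq0 opprB; apply/eqP; apply: h.
  by move=> p q pi _; have [] := closed_at_log (H p q pi).
- have := @goursat R (fun x y => complex.Re (f (E x y)))
    (fun x y => - complex.Im (f (E x y))) x1 x2 0 (2 * pi) x12 pi0.
  rewrite /loop (@eq_itg _ x1 x2 _ (fun=> 0)) => [|x _]; last by rewrite polar_2pi subrr.
  rewrite z0 add0r itgB; [|by apply: cont_onN; exact: cI..].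
  rewrite !itgN; [|exact: cI..]; rewrite opprK addrC => h; apply: h.
  by move=> p q pi _; have [] := closed_at_log (H p q pi).
Qed.

(** Convergence is uniform in the angle by compactness of [0, 2 pi]. The case r0 = 0, where the
    circle degenerates to a point, is the one that brings in the value at the centre. *)
Lemma cavg_cvg (f : C -> C) r0 : 0 <= r0 ->
  (forall t, {for polar r0 t, continuous f}) ->
  (\forall r \near r0, continuous (fun t => f (polar r t) : C)) ->
  (cavg (fun t => f (polar r t)) : C) @[r --> r0] --> (cavg (fun t => f (polar r0 t)) : C).
Proof.
move=> r00 cf cn.
have pi0 := @pi2_gt0 R.
have unif e : 0 < e -> \forall r \near r0, forall t, t \in `[0, 2 * pi] ->
    cabs (f (polar r t) - f (polar r0 t)) <= e.
  move=> e0.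
  have /compact_near_coveringP := @segment_compact R 0 (2 * pi).
  move=> /(_ R (nbhs r0) (fun r t => cabs (f (polar r t) - f (polar r0 t)) <= e)).
  move=> h; have {}h := h _; apply: filterS (h _ _) => // [r rt t ti|t _]; first exact: rt.
  have e20 : 0 < e / 2 by rewrite divr_gt0.
  pose A : set_system (R * R) := filter_prod (nbhs t) (nbhs r0).
  have FA : Filter A by exact: filter_prod_filter.
  have A1 : (fun tr : R * R => tr.1) @ A --> t by exact: cvg_fst.
  have A2 : (fun tr : R * R => tr.2) @ A --> r0 by exact: cvg_snd.
  have c0 : (fun tr : R * R => f (polar tr.2 tr.1) : C) @ A --> (f (polar r0 t) : C).
    apply: (@cvg_comp _ _ _ (fun tr : R * R => polar tr.2 tr.1 : C) f _ _ _ _ (cf t)).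
    exact: (polar_cvg A2 A1).
  have c1 : (fun tr : R * R => f (polar r0 tr.1) : C) @ A --> (f (polar r0 t) : C).
    apply: (@cvg_comp _ _ _ (fun tr : R * R => polar r0 tr.1 : C) f _ _ _ _ (cf t)).
    exact: (polar_cvg (cvg_cst r0) A1).
  have H0 := (@cvgC_cabs R _ A FA _ _).1 c0 _ e20.
  have H1 := (@cvgC_cabs R _ A FA _ _).1 c1 _ e20.
  change (A [set tr | cabs (f (polar tr.2 tr.1) - f (polar r0 tr.1)) <= e]).
  move: H1 H0; apply: filterS2 => tr h1 h2 /=.
  have -> : f (polar tr.2 tr.1) - f (polar r0 tr.1) =
    (f (polar tr.2 tr.1) - f (polar r0 t)) - (f (polar r0 tr.1) - f (polar r0 t)) by ring.
  by apply: (le_trans (ler_cabsB _ _)); rewrite [leRHS](splitr e) lerD.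
have c0 := continuous_circle cf.
have key (g : C -> R) (gE : forall u v, `|g u - g v| <= cabs (u - v))
    (gc : forall F : R -> C, continuous F -> continuous (fun t => g (F t))) :
    ravg (fun t => g (f (polar r t))) @[r --> r0] --> ravg (fun t => g (f (polar r0 t))).
  apply/cvgrPdistC_le => e e0; have := unif e e0; apply: filterS2 cn => r cr H.
  have n0 : (2 * pi : R) != 0 by rewrite gt_eqF.
  rewrite /ravg -mulrBr -itgB; [|exact/cont_itv/gc..].
  rewrite normrM gtr0_norm ?invr_gt0// mulrC ler_pdivrMr//.
  have := @normr_itg_le _ 0 (2 * pi) (fun t => g (f (polar r t)) - g (f (polar r0 t))) e.
  rewrite subr0; apply; first exact: ltW.
    by apply: cont_onB; exact/cont_itv/gc.
  by move=> t ti; apply: le_trans (gE _ _) _; apply: H; rewrite in_itv.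
apply: cvgC_ReIm; rewrite cavgE/=.
  have -> : (fun r => complex.Re (cavg (fun t => f (polar r t)))) = fun r => ravg (fun t =>
      complex.Re (f (polar r t))).
    by apply/funext => r; rewrite cavgE.
  by apply: key; [move=> u v; rewrite -raddfB Re_le_cabs|exact: continuous_Re].
have -> : (fun r => complex.Im (cavg (fun t => f (polar r t)))) = fun r => ravg (fun t =>
    complex.Im (f (polar r t))).
  by apply/funext => r; rewrite cavgE.
by apply: key; [move=> u v; rewrite -raddfB Im_le_cabs|exact: continuous_Im].
Qed.

End circle_invariance.

Section cauchy_formula.
Context {R : realType}.
Local Notation C := (R[i]^o).
Implicit Types (r s t e u : R) (f g : C -> C) (z w : C).

Lemma derivableCM f g z : derivable f z 1 -> derivable g z 1 ->
  derivable (fun x => f x * g x : C) z 1.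
Proof. by move=> df dg; exact: (@derivableM R[i] C f g z 1 df dg). Qed.

Lemma circle_invariance f r1 r2 : 0 < r1 -> r1 <= r2 ->
  (forall z, r1 <= cabs z <= r2 -> derivable f z 1) ->
  cavg (fun t => f (polar r1 t)) = cavg (fun t => f (polar r2 t)).
Proof.
move=> r10 r12 H; have r20 := lt_le_trans r10 r12.
have := @circle_invariance_log R f (ln r1) (ln r2).
rewrite !lnK ?posrE//; apply; first by rewrite ler_ln.
move=> p q /andP[h1 h2]; apply: H; rewrite cabs_polar ?expR_ge0//.
by move: h1 h2; rewrite -ler_expR -[p <= _]ler_expR !lnK ?posrE// => -> ->.
Qed.

(** The mean is constant in r on (0, r0) and on (r0, rho), and its continuity in r glues the two
    ranges and reaches f 0. Allowing mere continuity on one circle |z| = r0 lets Cauchy's formula go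
    through without removing a singularity. *)
Lemma circle_average_at0 f (rho r0 : R) : 0 <= r0 ->
  (forall z, cabs z < rho -> {for z, continuous f}) ->
  (forall z, 0 < cabs z < rho -> cabs z != r0 -> derivable f z 1) ->
  forall r, 0 < r < rho -> cavg (fun t => f (polar r t)) = f 0.
Proof.
move=> r00 cf df r /andP[rp rrho].
pose g r := cavg (fun t => f (polar r t)).
have lim_eq u : 0 <= u < rho -> g r @[r --> u] --> g u.
  move=> /andP[u0 ur]; apply: cavg_cvg => //.
    by move=> t; apply: cf; rewrite cabs_polar.
  have : \forall r \near u, `|r - u| < rho - u.
    apply/nbhs_ballP; exists (rho - u) => /=; first by rewrite subr_gt0.
    by move=> x; rewrite /ball/= distrC.
  apply: filterS => x; rewrite ltr_norml => /andP[x1 x2].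
  apply: continuous_circle => t; apply: cf.
  (* Radii near 0 may be negative, hence the absolute value. *)
  have -> : cabs (polar x t : C) = `|x|.
    by rewrite polarE cabsE/= !exprMn -mulrDr cos2Dsin2 mulr1 sqrtr_sqr.
  rewrite ltr_norml; apply/andP; split; lra.
have right_eq u v : 0 <= u -> u < v -> v < rho -> (u = 0 \/ u = r0) ->
    (forall x, u < x -> x < v -> g x = g v) -> g u = g v.
  move=> u0 uv vr _ H; apply/eqP; rewrite -subr_eq0 -cabs_eq0 -normr_le0 ger0_norm ?cabs_ge0//.
  apply/ler_addgt0Pr => e e0; rewrite add0r.
  have cu : g x @[x --> u^'+] --> g u by apply: cvg_at_right_filter; apply: lim_eq;
      rewrite u0 (lt_trans uv).
  have [x [[ux xv] xe]] := filter_ex (filterI (filterI (nbhs_right_gt u) (nbhs_right_lt uv))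
      ((cvgC_cabs _ _).1 cu _ e0)).
  by rewrite -(H x)// cabs_distC.
have left_eq u v : 0 < v -> v < u -> u < rho ->
    (forall x, v < x -> x < u -> g x = g v) -> g u = g v.
  move=> v0 vu ur H; apply/eqP; rewrite -subr_eq0 -cabs_eq0 -normr_le0 ger0_norm ?cabs_ge0//.
  apply/ler_addgt0Pr => e e0; rewrite add0r.
  have cu : g x @[x --> u^'-] --> g u by apply: cvg_at_left_filter; apply: lim_eq;
      rewrite ur ltW ?(lt_trans v0).
  have [x [[ux xv] xe]] := filter_ex (filterI (filterI (nbhs_left_lt u) (nbhs_left_gt vu))
      ((cvgC_cabs _ _).1 cu _ e0)).
  by rewrite -(H x)// cabs_distC.
have inv x y : 0 < x -> x <= y -> y < rho -> (r0 < x \/ y < r0) -> g x = g y.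
  move=> x0 xy yr h; apply: circle_invariance => // z /andP[xz zy]; apply: df.
    by rewrite (lt_le_trans x0)//= (le_lt_trans zy).
  by apply/eqP => zr; move: xz zy; rewrite zr; case: h => h1 h2 h3; lra.
have all0 v : 0 < v -> v < rho -> v <= r0 -> g 0 = g v.
  move=> v0 vr; rewrite le_eqVlt => /predU1P[vr0|vlt].
    have hv : 0 < v / 2 by rewrite divr_gt0.
    have hv2 : v / 2 < v by rewrite ltr_pdivrMr// ltr_pMr// ltr1n.
    have e1 : g v = g (v / 2).
      apply: left_eq => // x vx xv; apply/esym/inv => //; first exact: ltW.
        exact: lt_trans xv vr.
      by right; rewrite -vr0.
    rewrite e1; apply: right_eq => //; [exact: lt_trans vr|by left|].
    move=> x x0 xv; apply: inv => //; [exact: ltW|exact: lt_trans vr|].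
    by right; rewrite -vr0.
  apply: right_eq => //; [by left|].
  by move=> x x0 xv; apply: inv => //; [exact: ltW|right].
have g00 : g 0 = f 0.
  rewrite /g (@eq_cavg _ _ (fun=> f 0)) ?cavg_cst// => t.
  by congr f; rewrite polarE !mul0r.
rewrite -/(g r) -g00; have [rr0|rr0] := leP r r0; first by rewrite -all0.
have [r0e|r0n] := eqVneq r0 0.
  apply/esym/right_eq => //; [by left|].
  by move=> x x0 xr; apply: inv => //; [exact: ltW|left; rewrite r0e].
have r0p : 0 < r0 by rewrite lt_neqAle eq_sym r0n.
rewrite (@all0 r0) ?lexx//; last exact: lt_trans rrho.
apply/esym/right_eq => //; [by right|].
by move=> x x0 xr; apply: inv => //; [exact: lt_trans x0|exact: ltW|left].
Qed.

Lemma mean_value f (rho r : R) : 0 < r < rho ->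
  (forall z, cabs z < rho -> derivable f z 1) ->
  cavg (fun t => f (polar r t)) = f 0.
Proof.
move=> rr df; apply: (@circle_average_at0 f rho 0 (lexx 0) _ _ r rr).
  by move=> z zr; apply: derivable_continuous; exact: df.
by move=> z /andP[_ zr] _; exact: df.
Qed.

(** The reproducing kernel k_w of H2. *)
Definition szego w z : C := (1 - conjc w * z)^-1.

Lemma szego_den w z : cabs w * cabs z < 1 -> 1 - conjc w * z != 0 :> C.
Proof.
move=> h; rewrite -cabs_gt0; apply: lt_le_trans (ler_cabs_sub _ _).
by rewrite cabs1 cabsM cabs_conj subr_gt0.
Qed.

Lemma conj_szego w z : conjc (szego w z) = (1 - w * conjc z)^-1 :> C.
Proof. by rewrite /szego conjc_inv rmorphB rmorphM rmorph1/= conjcK. Qed.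

Lemma derivable_affine (a b z : C) : derivable (fun y : C => a + b * y : C) z 1.
Proof.
apply: (@eps_derivable _ _ _ b) => e e0; exists 1 => // w _.
rewrite (_ : _ - _ = 0) ?cabs0 ?mulr_ge0 ?cabs_ge0 ?(ltW e0)//.
ring.
Qed.

Lemma derivable_szego w z : cabs w * cabs z < 1 -> derivable (szego w) z 1.
Proof.
move=> h; apply: (@derivableV R[i] C (fun y : C => 1 - conjc w * y)).
  exact: szego_den.
have -> : (fun y : C => 1 - conjc w * y) = (fun y : C => 1 + (- conjc w) * y).
  by apply/funext => y; rewrite mulNr.
exact: derivable_affine.
Qed.

Lemma continuous_szego_circle w : cabs w < 1 -> continuous (fun t => szego w (polar 1 t) : C).
Proof.
move=> w1; apply: continuous_circle => t; apply: derivable_continuous.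
by apply: derivable_szego; rewrite cabs_polar// mulr1.
Qed.

Lemma polar_neq0 r t : 0 < r -> polar r t != 0 :> C.
Proof. by move=> r0; rewrite -cabs_gt0 cabs_polar// ltW. Qed.

Lemma cavg_szego w : cabs w < 1 -> cavg (fun t => szego w (polar 1 t)) = 1.
Proof.
move=> w1; have [->|w0] := eqVneq w 0.
  rewrite (@eq_cavg _ _ (fun=> 1)) ?cavg_cst// => t.
  by rewrite /szego conjc0 mul0r subr0 invr1.
have wp : 0 < cabs w by rewrite cabs_gt0.
rewrite (@mean_value _ (cabs w)^-1); last 2 first.
- by rewrite ltr01 invf_gt1.
- by move=> z zw; apply: derivable_szego; rewrite mulrC -ltr_pdivlMr// mul1r.
by rewrite /szego mulr0 subr0 invr1.
Qed.

Lemma conj_polar1 t : conjc (polar 1 t) = (polar 1 t)^-1 :> C.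
Proof.
have n0 := @polar_neq0 1 t ltr01.
by apply: (mulfI n0); rewrite divff// mulc_conj cabs_polar// expr1n.
Qed.

(** On the unit circle conj(k_w(v)) = v / (v - w), so the integrand is v q(v) + f(w) conj(k_w(v)),
    with q the difference quotient of f at w. The first term has mean 0, the value of z q(z) at 0;
    the second has mean f(w). *)
Theorem cauchy_formula f (rho : R) w : 1 < rho ->
  (forall z, cabs z < rho -> derivable f z 1) -> cabs w < 1 ->
  cavg (fun t => f (polar 1 t) * conjc (szego w (polar 1 t))) = f w.
Proof.
move=> rho1 df w1.
pose q z : C := if z == w then derive1 f w else (f z - f w) / (z - w).
have wr : cabs w < rho by apply: lt_trans rho1.
have cF (F : C -> C) : (forall z,
    cabs z < rho -> derivable F z 1) -> continuous (fun t => F (polar 1 t) : C).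
  move=> dF; apply: continuous_circle => t; apply/derivable_continuous/dF.
  by rewrite cabs_polar.
have dq z : cabs z < rho -> z != w -> derivable (fun z => z * ((f z - f w) / (z - w)) : C) z 1.
  move=> zr zw.
  have d1 : derivable (fun z : C => f z - f w : C) z 1.
    by apply: derivableB; [exact: df|exact: derivable_cst].
  have d2 : derivable (fun z : C => (z - w)^-1 : C) z 1.
    apply: (@derivableV R[i] C (fun y : C => y - w)); first by rewrite subr_eq0.
    by apply: derivableB; [exact: derivable_id|exact: derivable_cst].
  exact: (derivableCM (@derivable_id _ _ _ _) (derivableCM d1 d2)).
have nearq z : z != w -> \forall y \near z, (fun z => z * ((f z - f w) / (z - w)) : C) y = y * q y.
  move=> zw; apply/nbhsC_cabs; exists (cabs (z - w)); first by rewrite cabs_gt0 subr_eq0.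
  by move=> y yz; rewrite /q; case: eqP => // yw; move: yz; rewrite yw cabs_distC ltxx.
have dG z : cabs z < rho -> z != w -> derivable (fun z => z * q z : C) z 1.
  move=> zr zw; apply: eps_derivable => e /(derivable_eps (dq z zr zw))[d d0 H].
  have /nbhsC_cabs[d' d'0 H'] := nearq z zw.
  exists (Num.min d d'); first by rewrite lt_min d0.
  move=> y; rewrite lt_min => /andP[yd yd'].
  rewrite -(H' y yd') -(H' z); last by rewrite subrr cabs0.
  exact: H.
have cq : {for w, continuous q}.
  apply/continuous_cabsP => e e0; have [d d0 H] := derivable_eps (df w wr) e0.
  exists d => // y yd; rewrite /q eqxx; case: eqP => [_|/eqP yw].
    by rewrite subrr cabs0 ltW.
  have yw0 : y - w != 0 by rewrite subr_eq0.
  have -> : (f y - f w) / (y - w) - derive1 f w =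
    (f y - f w - derive1 f w * (y - w)) / (y - w) by field.
  by rewrite cabs_div ler_pdivrMr ?cabs_gt0//; exact: H.
have cG z : cabs z < rho -> {for z, continuous (fun z => z * q z : C)}.
  move=> zr; have [->|zw] := eqVneq z w.
    by apply: (@continuousM R[i] C id q); [exact: cvg_id|exact: cq].
  by apply: derivable_continuous; exact: dG.
(* The exceptional circle, where only continuity is used, is the one through [w]. *)
have avg0 : cavg (fun t => polar 1 t * q (polar 1 t)) = 0.
  have r1 : (0 : R) < 1 < rho by apply/andP; split.
  have dG' z : 0 < cabs z < rho -> cabs z != cabs w -> derivable (fun z => z * q z : C) z 1.
    move=> /andP[_ zr] zw; apply: (dG z zr).
    by apply: contra zw => /eqP ->.
  by rewrite (@circle_average_at0 (fun z => z * q z) rho (cabs w) (cabs_ge0 w) cG dG' 1 r1) mul0r.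
have cS : continuous (fun t => conjc (szego w (polar 1 t)) : C).
  by apply: continuous_conj; exact: continuous_szego_circle.
have key t : f (polar 1 t) * conjc (szego w (polar 1 t)) =
    polar 1 t * q (polar 1 t) + f w * conjc (szego w (polar 1 t)).
  set y : C := polar 1 t.
  have y1 : cabs y = 1 by rewrite cabs_polar.
  have yw : y - w != 0.
    by rewrite subr_eq0; apply: contraTneq w1 => <-; rewrite y1 ltxx.
  have y0 : y != 0 by exact: polar_neq0.
  have -> : conjc (szego w y) = y / (y - w).
    rewrite conj_szego (_ : conjc y = y^-1); last exact: conj_polar1.
    have -> : 1 - w * y^-1 = (y - w) / y by rewrite mulrBl divff.
    by rewrite invf_div.
  rewrite /q ifF; last by apply/negbTE; rewrite -subr_eq0.
  by field.
rewrite (eq_cavg key) cavgD; last 2 first.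
- apply: (@continuous_circle R (fun z => z * q z)) => t; apply: cG.
  by rewrite cabs_polar.
- have cw : continuous (fun _ : R => f w : C) by move=> ?; exact: cvg_cst.
  exact: (continuousCM cw cS).
rewrite avg0 add0r cavgZ// cavg_conj; last exact: continuous_szego_circle.
by rewrite cavg_szego// conjc1 mulr1.
Qed.

End cauchy_formula.

(** * Growth of the quadratic means with the radius *)

Section hardy_norm.
Context {R : realType}.
Local Notation C := (R[i]^o).
Implicit Types (r s t e u : R) (f g : C -> C) (z w : C).

Lemma derivableC_comp f g z : derivable f z 1 -> derivable g (f z) 1 ->
  derivable (fun x => g (f x) : C) z 1.
Proof.
move=> /derivable1_diffP df /derivable1_diffP dg; apply/derivable1_diffP.
exact: (differentiable_comp df dg).
Qed.

(* The substitution z -> u / conj z turns the integrand into a holomorphic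
   function on an annulus. *)
Lemma circle_inner_shift f g (r1 r2 s1 s2 : R) :
  (forall z, cabs z <= r2 -> derivable f z 1) ->
  (forall z, cabs z <= s1 -> derivable g z 1) ->
  0 < r1 -> r1 <= r2 -> 0 < s2 -> r1 * s1 = r2 * s2 ->
  cavg (fun t => f (polar r1 t) * conjc (g (polar s1 t))) =
  cavg (fun t => f (polar r2 t) * conjc (g (polar s2 t))).
Proof.
move=> df dg r10 r12 s20 eu; pose u := r1 * s1.
have r20 := lt_le_trans r10 r12.
have u0 : 0 < u by rewrite /u eu mulr_gt0.
pose gt z : C := conjc (g (conjc z)).
pose G z : C := f z * gt (u%:C / z).
have GE r s t : 0 < r -> r * s = u -> f (polar r t) * conjc (g (polar s t)) = G (polar r t).
  move=> r0 rs; rewrite /G /gt; congr (_ * conjc (g _)).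
  have p0 := @polar_neq0 R r t r0.
  have c2 : cos t ^+ 2 + sin t ^+ 2 = 1 :> R by rewrite cos2Dsin2.
  have h : conjc (polar s t) * polar r t = u%:C :> C.
    rewrite !polarE; apply/eqP; rewrite eq_complex/= -rs.
    apply/andP; split; apply/eqP; last by ring.
    transitivity (r * s * (cos t ^+ 2 + sin t ^+ 2)); first by ring.
    by rewrite c2; ring.
  by rewrite -h mulfK// conjcK.
rewrite (@eq_cavg _ _ (fun t => G (polar r1 t))); last by move=> t; exact: GE.
rewrite [RHS](@eq_cavg _ _ (fun t => G (polar r2 t))); last by move=> t; apply: GE.
apply: circle_invariance => // z /andP[z1 z2].
have z0 : z != 0 by rewrite -cabs_gt0 (lt_le_trans r10).
apply: derivableCM; first exact: df.
have d1 : derivable (fun z => u%:C / z : C) z 1.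
  apply: derivableCM; first exact: derivable_cst.
  by apply: (@derivableV R[i] C id) => //; exact: derivable_id.
apply: (derivableC_comp d1); apply: derivable_conjconj; apply: dg.
rewrite cabs_conj cabs_div cabs_real gtr0_norm//.
rewrite ler_pdivrMr ?cabs_gt0// /u mulrC ler_wpM2l//.
have : 0 < r1 * s1 by [].
by rewrite pmulr_rgt0// => /ltW.
Qed.

Lemma mean2_cavg f r : (circle_mean2 f r)%:C =
  cavg (fun t => f (polar r t) * conjc (f (polar r t))).
Proof. by rewrite cavg_sqr. Qed.

Section monotone.
Variable f : C -> C.
Hypothesis df : holomorphic_on_disc f.
Let m := circle_mean2 f.

Lemma continuous_on_circle r : 0 <= r < 1 -> continuous (fun t => f (polar r t) : C).
Proof.
move=> /andP[r0 r1]; apply: continuous_circle => t.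
by apply/derivable_continuous/df; rewrite cabs_polar.
Qed.

Lemma mean2_ge0 r : 0 <= m r.
Proof. by apply: ravg_ge0 => t; exact: sqr_ge0. Qed.

(** Hadamard's inequality for the radii r^2/s, r, s: the pairing of f with itself depends only on
    the product of the two radii, and Cauchy-Schwarz separates the shifted radii. *)
Lemma mean2_logconvex r s : 0 < r -> r < s -> s < 1 ->
  m r ^+ 2 <= m (r * (r / s)) * m s.
Proof.
move=> r0 rs s1; have s0 := lt_trans r0 rs.
have q1 : r / s < 1 by rewrite ltr_pdivrMr// mul1r.
have q0 : 0 < r / s by rewrite divr_gt0.
have rq : r * (r / s) < r by rewrite gtr_pMr.
have rq0 : 0 < r * (r / s) by rewrite mulr_gt0.
have r1 := lt_trans rs s1.
have : cavg (fun t => f (polar r t) * conjc (f (polar r t))) =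
    cavg (fun t => f (polar s t) * conjc (f (polar (r * (r / s)) t))).
  apply: circle_inner_shift => //.
  - by move=> z zs; apply: df; exact: le_lt_trans s1.
  - by move=> z zr; apply: df; exact: le_lt_trans r1.
  - exact: ltW.
  - by field; rewrite gt_eqF.
rewrite -mean2_cavg => /(congr1 (fun z => cabs z ^+ 2)).
rewrite cabs_real ger0_norm ?mean2_ge0// => ->; rewrite [leRHS]mulrC.
have c1 : continuous (fun t => f (polar s t) : C) by apply: continuous_on_circle; rewrite ltW.
have c2 : continuous (fun t => f (polar (r * (r / s)) t) : C).
  by apply: continuous_on_circle; rewrite ltW// (lt_trans rq).
exact: (cauchy_schwarz c1 c2).
Qed.

Lemma mean2_bounded_near0 : exists M d, [/\ 0 < d & forall r, 0 <= r < d -> m r <= M].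
Proof.
have c0 : {for 0, continuous f} by apply/derivable_continuous/df; rewrite cabs0.
have /continuous_cabsP/(_ _ ltr01)[d d0 H] := c0.
exists ((cabs (f 0) + 1) ^+ 2), (Num.min d 1); split; first by rewrite lt_min d0 ltr01.
move=> r /andP[r0]; rewrite lt_min => /andP[rd r1].
rewrite -[leRHS]ravg_cst; apply: le_ravg.
- by apply/continuous_sqr/continuous_cabs/continuous_on_circle; rewrite r0.
- by move=> t; exact: cvg_cst.
move=> t; rewrite lerXn2r ?nnegrE ?addr_ge0 ?cabs_ge0//.
have := H (polar r t); rewrite subr0 cabs_polar// => /(_ rd) h.
by have := ler_cabs_sub (f (polar r t)) (f 0); lra.
Qed.

(** Were m s < m r, log-convexity would multiply m by at least lam = m r / m s > 1 at each step
    along the radii s (r/s)^n, against its boundedness near 0. *)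
Lemma mean2_mono r s : 0 < r -> r < s -> s < 1 -> m r <= m s.
Proof.
move=> r0 rs s1; rewrite leNgt; apply/negP => msr.
have s0 := lt_trans r0 rs.
have ms0 : 0 <= m s := mean2_ge0 s.
have mr0 : 0 < m r := le_lt_trans ms0 msr.
have q1 : r / s < 1 by rewrite ltr_pdivrMr// mul1r.
have q0 : 0 < r / s by rewrite divr_gt0.
set q := r / s in q0 q1.
have ms : 0 < m s.
  have := mean2_logconvex r0 rs s1; rewrite lt_neqAle ms0 andbT eq_sym.
  by apply: contraTneq => ->; rewrite mulr0 -ltNge exprn_gt0.
pose rr n := s * q ^+ n.
have rr0 n : 0 < rr n by rewrite mulr_gt0// exprn_gt0.
have rrS n : rr n.+1 = rr n * q by rewrite /rr exprSr mulrA.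
have rrlt n : rr n.+1 < rr n by rewrite rrS gtr_pMr.
have rr1 n : rr n < 1.
  elim: n => [|n]; first by rewrite /rr expr0 mulr1.
  by apply: lt_trans.
pose lam := m r / m s.
have lam1 : 1 < lam by rewrite ltr_pdivlMr// mul1r.
have rr1E : rr 1%N = r by rewrite /rr expr1 /q mulrC divfK// gt_eqF.
have pos n : 0 < m (rr n) /\ lam * m (rr n) <= m (rr n.+1).
  elim: n => [|n [p0 IH]].
    by rewrite rr1E /rr expr0 mulr1 /lam divfK ?gt_eqF.
  have p1 : 0 < m (rr n.+1).
    by apply: lt_le_trans IH; rewrite mulr_gt0// (lt_trans ltr01).
  split=> //.
  have := mean2_logconvex (rr0 n.+1) (rrlt n) (rr1 n).
  have -> : rr n.+1 * (rr n.+1 / rr n) = rr n.+2.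
    by rewrite (rrS n.+1) (rrS n) [_ * q / _]mulrAC divff ?mul1r// gt_eqF.
  move=> h.
  rewrite -(ler_pM2r p0); apply: le_trans h.
  by rewrite expr2 mulrAC ler_pM2r.
have grow n : lam ^+ n * m s <= m (rr n).
  elim: n => [|n IH]; first by rewrite expr0 mul1r /rr expr0 mulr1.
  rewrite exprS -mulrA; apply: le_trans (pos n).2.
  by rewrite ler_pM2l// (lt_trans ltr01).
have [M [d [d0 HM]]] := mean2_bounded_near0.
have cvq : rr n @[n --> \oo] --> 0.
  rewrite -[X in _ --> X](mulr0 s); apply: cvgM; first exact: cvg_cst.
  by apply: cvg_expr; rewrite gtr0_norm.
have cvl : (lam^-1) ^+ n @[n --> \oo] --> 0.
  by apply: cvg_expr; rewrite gtr0_norm ?invf_lt1// ?invr_gt0 (lt_trans ltr01).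
have e0 : 0 < m s / (1 + `|M|) by rewrite divr_gt0// ltr_wpDr.
have n1 : \forall n \near \oo, `|rr n - 0| < d by exact: cvgr_distC_lt cvq _ d0.
have n2 : \forall n \near \oo, `|lam^-1 ^+ n - 0| < m s / (1 + `|M|).
  exact: cvgr_distC_lt cvl _ e0.
have [n [h1 h2]] := filter_ex (filterI n1 n2).
have lamn : 0 < lam ^+ n by rewrite exprn_gt0 ?(lt_trans ltr01).
move: h1 h2; rewrite !subr0 (gtr0_norm (rr0 n)) => h1.
rewrite exprVn gtr0_norm ?invr_gt0// => h2.
have hM : m (rr n) <= M by apply: HM; rewrite h1 ltW.
have M0 : 0 < 1 + `|M| by rewrite ltr_wpDr.
have h3 : 1 + `|M| < m s * lam ^+ n.
  have -> : 1 + `|M| = lam ^+ n * ((lam ^+ n)^-1 * (1 + `|M|)) by rewrite mulVKf ?gt_eqF.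
  by rewrite [ltRHS]mulrC ltr_pM2l// -ltr_pdivlMr.
by have := grow n; have := ler_norm M; rewrite [lam ^+ n * _]mulrC; lra.
Qed.

End monotone.

(** [H2_norm] is a [lim], meaningful only once convergence is known: it follows from monotonicity
    and from the bound in [H2]. *)
Lemma mean2_le_norm f : H2 f -> 0 <= H2_norm f /\
  forall r, 0 < r < 1 -> circle_mean2 f r <= H2_norm f ^+ 2.
Proof.
move=> [df [M HM]].
have mono x y : 0 < x -> x <= y -> y < 1 ->
    Num.sqrt (circle_mean2 f x) <= Num.sqrt (circle_mean2 f y).
  move=> x0; rewrite le_eqVlt => /predU1P[-> //|xy] y1.
  by rewrite ler_sqrt ?mean2_ge0//; exact: mean2_mono.
have cv : cvg (Num.sqrt (circle_mean2 f r) @[r --> 1^'-]).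
  apply: nondecreasing_at_left_is_cvgr.
    near=> x => a b; rewrite !in_itv/= => /andP[xa a1] /andP[xb b1] ab.
    apply: mono => //; apply: lt_trans xa.
    by near: x; exact: nbhs_left_gt.
  near=> x; exists (Num.sqrt M) => _ [y/= + <-]; rewrite in_itv/= => /andP[xy y1].
  have x0 : 0 < x by near: x; exact: nbhs_left_gt.
  have y0 := lt_trans x0 xy.
  have := HM y; rewrite ltW// y1 => /(_ isT) h.
  by rewrite ler_sqrt// (le_trans _ h)// mean2_ge0.
have key r : 0 < r < 1 -> Num.sqrt (circle_mean2 f r) <= H2_norm f.
  move=> /andP[r0 r1]; apply: limr_ge => //; near=> x.
  have xr : r <= x by near: x; exact: nbhs_left_ge.
  have x1 : x < 1 by near: x; exact: nbhs_left_lt.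
  exact: mono.
have n0 : 0 <= H2_norm f.
  apply: le_trans (key (1 / 2) _); rewrite ?sqrtr_ge0//.
  by apply/andP; split; lra.
split=> // r /key h; rewrite -[leLHS]sqr_sqrtr ?mean2_ge0//.
by rewrite lerXn2r// nnegrE sqrtr_ge0.
Unshelve. all: by end_near. Qed.

End hardy_norm.

(** * Finite Blaschke products and the coefficient bound *)

Section partial_fractions.
Context {R : realType}.
Local Notation C := (R[i]^o).

Lemma conjcM (x y : C) : conjc (x * y) = conjc x * conjc y.
Proof. exact: rmorphM. Qed.

Lemma conjcB (x y : C) : conjc (x - y) = conjc x - conjc y.
Proof. exact: rmorphB. Qed.

Lemma conjcD (x y : C) : conjc (x + y) = conjc x + conjc y.
Proof. exact: rmorphD. Qed.

Lemma conjc_sum (I : Type) (r : seq I) (P : pred I) (F : I -> C) :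
  conjc (\sum_(i <- r | P i) F i) = \sum_(i <- r | P i) conjc (F i).
Proof. exact: rmorph_sum. Qed.

Lemma conjc_prod (I : Type) (r : seq I) (P : pred I) (F : I -> C) :
  conjc (\prod_(i <- r | P i) F i) = \prod_(i <- r | P i) conjc (F i).
Proof. exact: rmorph_prod. Qed.

Variable z : nat -> C.
Hypothesis z_disc : forall n, 0 < cabs (z n) < 1.
Hypothesis z_inj : injective z.

Definition bfactor (a w : C) : C := (cabs a)%:C / a * ((a - w) / (1 - conjc a * w)).
Definition fblaschke N w : C := \prod_(n < N) bfactor (z n) w.
(** The pseudohyperbolic distance between z_k and z_n. *)
Definition pseudo_dist (k n : nat) : R := cabs ((z k - z n) / (1 - conjc (z k) * z n)).

Let z0 n : z n != 0.
Proof. by rewrite -cabs_gt0; have /andP[] := z_disc n. Qed.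
Let cn0 n : cabs (z n) != 0.
Proof. by rewrite cabs_eq0. Qed.
Let cz0 n : (cabs (z n))%:C != 0 :> C.
Proof. by rewrite -cabs_eq0 cabs_real normr_eq0 cabs_eq0. Qed.

Let unimod n : cabs (z n / (cabs (z n))%:C) = 1.
Proof. by rewrite cabs_div cabs_real ger0_norm ?cabs_ge0// divff. Qed.

Lemma disc_den (a b : C) : cabs a < 1 -> cabs b < 1 -> 1 - conjc a * b != 0 :> C.
Proof.
move=> a1 b1; apply: szego_den; rewrite -[ltRHS]mul1r.
by apply: ltr_pM; rewrite ?cabs_ge0.
Qed.

Lemma pseudo_dist_gt0 k n : k != n -> 0 < pseudo_dist k n.
Proof.
move=> kn; rewrite /pseudo_dist cabs_gt0 mulf_neq0 ?invr_eq0//.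
  by rewrite subr_eq0 (inj_eq z_inj).
by apply: disc_den; have /andP[] := z_disc k; have /andP[] := z_disc n.
Qed.

(* Homogeneous coordinates (x, y) cover both the point x/1 and the reflection
   1/y of a point of the disc, including y = 0. *)
Lemma partial_fractions N : exists (kappa : C) (A : nat -> C),
  (forall x y : C, (forall n, (n < N)%N -> x - z n * y != 0) ->
    \prod_(n < N) (z n / (cabs (z n))%:C * ((y - conjc (z n) * x) / (z n * y - x))) =
    kappa + \sum_(n < N) A n * (y / (x - z n * y))) /\
  forall n, (n < N)%N -> cabs (A n) * \prod_(k < N | k != n :> nat) pseudo_dist k n =
    1 - cabs (z n) ^+ 2.
Proof.
elim: N => [|N [kappa [A [HA Hb]]]].
  exists 1, (fun=> 0); split=> // x y _; by rewrite !big_ord0 addr0.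
set a := z N; pose u := a / (cabs a)%:C.
(* One factor splits as [al] + [be] y / (x - a y). Multiplying by it scales the old residues by its
   value at z_n, and the new residue is [be] times the old product at a. *)
pose be : C := - u * (1 - a * conjc a).
pose al : C := u * conjc a.
pose A' n := if (n < N)%N then A n * (al + be / (z n - a)) else
  be * (kappa + \sum_(m < N) A m * (1 / (a - z m * 1))).
have facE x y : x - a * y != 0 -> u * ((y - conjc a * x) / (a * y - x)) =
    al + be * (y / (x - a * y)).
  move=> h; have h' : a * y - x != 0 by rewrite -opprB oppr_eq0.
  by rewrite /al /be; field; rewrite h h'.
have facn n : (n < N)%N -> cabs (al + be / (z n - a)) = (pseudo_dist N n)^-1.
  move=> nN; have h : z n - a * 1 != 0.
    by rewrite mulr1 subr_eq0 (inj_eq z_inj) ltn_eqF.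
  have := facE (z n) 1 h; rewrite mulr1 div1r => <-.
  rewrite cabsM cabs_div /u cabs_div cabs_real ger0_norm ?cabs_ge0//.
  by rewrite divff; [rewrite mul1r /pseudo_dist cabs_div invf_div|exact: cn0].
exists (kappa * al), A'; split.
  move=> x y h.
  have hN : forall n, (n < N)%N -> x - z n * y != 0 by move=> n nN; apply: h; rewrite ltnS ltnW.
  have ha : x - a * y != 0 by exact: h.
  rewrite !big_ord_recr/= (HA _ _ hN) -/a -/u (facE _ _ ha).
  rewrite [A' N]/A' ltnn.
  (* Resolves a product of two simple poles into a difference of simple poles. *)
  have split_e m : (m < N)%N -> be / (z m - a) * (y / (x - z m * y)) =
     be * (y / (x - a * y)) * (y / (x - z m * y)) + be / (z m - a) * (y / (x - a * y)).
    move=> mN; have h1 := hN _ mN.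
    have h2 : z m - a != 0 by rewrite subr_eq0 (inj_eq z_inj) ltn_eqF.
    by field; rewrite ha h1 h2.
  have -> : \sum_(m < N) A' m * (y / (x - z m * y)) =
      (\sum_(m < N) A m * (y / (x - z m * y))) * (al + be * (y / (x - a * y))) -
      (\sum_(m < N) A m * (1 / (a - z m * 1))) * (be * (y / (x - a * y))).
    rewrite !mulr_suml -sumrB; apply: eq_bigr => m _.
    rewrite /A' ltn_ord -mulrA mulrDl split_e//.
    have h2 : z m - a != 0 by rewrite subr_eq0 (inj_eq z_inj) ltn_eqF.
    have -> : 1 / (a - z m * 1) = - (z m - a)^-1.
      by rewrite mulr1 div1r -opprB invrN.
    ring.
  ring.
(* New index: |be| = 1 - |a|^2, and the old product at a has modulus inverse to the product of the
   distances. Old index: the new factor at z_n has modulus 1 / [pseudo_dist N n]. *)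
move=> n; rewrite ltnS leq_eqVlt => /predU1P[->|nN].
  rewrite big_mkcond big_ord_recr/= eqxx mulr1.
  rewrite (eq_bigr (fun k : 'I_N => pseudo_dist k N)); last first.
    by move=> k _; rewrite ltn_eqF.
  rewrite /A' ltnn -(HA a 1); last first.
    by move=> m mN; rewrite mulr1 subr_eq0 (inj_eq z_inj) gtn_eqF.
  have cprod (F : 'I_N -> C) : cabs (\prod_(i < N) F i) = \prod_(i < N) cabs (F i).
    by apply: (big_morph _ cabsM); exact: cabs1.
  rewrite cabsM cprod -mulrA -big_split/= big1 ?mulr1.
    rewrite /be cabsM cabsN /u cabs_div cabs_real ger0_norm ?cabs_ge0// divff; last exact: cn0.
    rewrite mul1r mulc_conj -/a -(rmorph1 (real_complex R)) -rmorphB cabs_real ger0_norm//.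
    by rewrite subr_ge0 expr_le1 ?cabs_ge0// ltW//; have /andP[] := z_disc N.
  move=> k _; have kN : nat_of_ord k != N by rewrite ltn_eqF.
  rewrite cabsM unimod.
  rewrite mul1r -/a /pseudo_dist cabs_div cabs_div mulr1.
  have n1 : cabs (z k - a) != 0 by rewrite cabs_eq0 subr_eq0 (inj_eq z_inj).
  have n2 : cabs (1 - conjc (z k) * a) != 0.
    by rewrite cabs_eq0; apply: disc_den; [have /andP[] := z_disc k|have /andP[] := z_disc N].
  by rewrite mulrC -/a; field; rewrite n1 n2.
rewrite /A' nN cabsM facn// big_mkcond big_ord_recr/= gtn_eqF//.
rewrite -big_mkcond/= -(Hb _ nN).
by rewrite mulrACA mulVf ?mulr1// gt_eqF// pseudo_dist_gt0// gtn_eqF.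
Qed.

(** The factor of [partial_fractions] at (x, y) = (1, conj w); [bfactor_inv] gives the one at (w,
    1). *)
Lemma bfactor_conj (w : C) n : conjc (bfactor (z n) w) =
  z n / (cabs (z n))%:C * ((conjc w - conjc (z n) * 1) / (z n * conjc w - 1)).
Proof.
rewrite /bfactor conjcM !conjcM !conjc_inv !conjcB conjcM conjcK conjc_real conjc1.
have -> : (cabs (z n))%:C / conjc (z n) = z n / (cabs (z n))%:C :> C.
  apply/eqP; rewrite eqr_div ?conjc_eq0// mulc_conj.
  by rewrite -rmorphM/= -expr2.
by rewrite mulr1 -(opprB (conjc w)) -(opprB (z n * _)) invrN mulrNN.
Qed.

Lemma bfactor_inv (w : C) n : (bfactor (z n) w)^-1 =
  z n / (cabs (z n))%:C * ((1 - conjc (z n) * w) / (z n * 1 - w)).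
Proof. by rewrite /bfactor mulr1 invfM !invf_div. Qed.

Lemma bfactor_circle (w : C) n : cabs w = 1 -> cabs (bfactor (z n) w) = 1.
Proof.
move=> w1; rewrite /bfactor cabsM !cabs_div cabs_real ger0_norm ?cabs_ge0//.
rewrite divff; last exact: cn0.
rewrite mul1r.
have w0 : w != 0 by rewrite -cabs_gt0 w1.
have -> : 1 - conjc (z n) * w = w * conjc (w - z n) :> C.
  by rewrite conjcB mulrBr mulc_conj w1 expr1n; ring.
rewrite cabsM w1 mul1r cabs_conj cabs_distC divff//.
by rewrite cabs_eq0 subr_eq0; apply: contraTneq (z_disc n) => <-; rewrite w1 ltxx andbF.
Qed.

Lemma bfactor_disc (w : C) n : cabs w < 1 -> cabs (bfactor (z n) w) <= 1.
Proof.
move=> w1; rewrite /bfactor cabsM !cabs_div cabs_real ger0_norm ?cabs_ge0//.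
rewrite divff; last exact: cn0.
rewrite mul1r.
have d0 : 0 < cabs (1 - conjc (z n) * w).
  by rewrite cabs_gt0; apply: disc_den => //; have /andP[] := z_disc n.
rewrite ler_pdivrMr// mul1r -ler_sqr ?nnegrE ?cabs_ge0//.
have /andP[_ zn1] := z_disc n.
have : 0 <= (1 - cabs (z n) ^+ 2) * (1 - cabs w ^+ 2).
  by rewrite mulr_ge0// subr_ge0 expr_le1 ?cabs_ge0// ltW.
by rewrite !sqr_cabs; case: (z n) => a b; case: (w) => c d /=; lra.
Qed.

Lemma fblaschke_circle N (w : C) : cabs w = 1 -> cabs (fblaschke N w) = 1.
Proof.
move=> w1; rewrite (big_morph _ cabsM cabs1) big1// => n _; exact: bfactor_circle.
Qed.

Lemma fblaschke_disc N (w : C) : cabs w < 1 -> cabs (fblaschke N w) <= 1.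
Proof.
move=> w1; rewrite (big_morph _ cabsM cabs1); apply: Num.Theory.prodr_ile1 => n _.
by rewrite cabs_ge0/=; exact: bfactor_disc.
Qed.

(** Subtract two instances of [partial_fractions], 1/B_N(v) and conj(B_N(w)): [kappa] cancels, and
    1/(v - z_n) - conj(w)/(1 - z_n conj(w)) = (1 - conj(w) v) / ((v - z_n)(1 - z_n conj(w))).
    Multiplying by B_N(v) k_w(v) removes the numerator. *)
Lemma szego_expansion N : exists A : nat -> C,
  (forall w t, cabs w < 1 ->
    let v := polar 1 t : C in
    conjc (szego w v) = fblaschke N w * conjc (fblaschke N v * szego w v) +
      \sum_(n < N) szego (z n) w * conjc (A n * fblaschke N v / (v - z n))) /\
  forall n, (n < N)%N -> cabs (A n) * \prod_(k < N | k != n :> nat) pseudo_dist k n =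
    1 - cabs (z n) ^+ 2.
Proof.
have [kappa [A [HA Hb]]] := partial_fractions N; exists A; split=> // w t w1 v.
have v1 : cabs v = 1 by rewrite cabs_polar.
have vz n : v - z n != 0.
  by rewrite subr_eq0; apply: contraTneq (z_disc n) => <-; rewrite v1 ltxx andbF.
have zw n : 1 - z n * conjc w != 0.
  rewrite -conjc_eq0 conjcB conjcM conjcK conjc1.
  by apply: disc_den => //; have /andP[] := z_disc n.
have e1 : (fblaschke N v)^-1 = kappa + \sum_(n < N) A n * (1 / (v - z n * 1)).
  rewrite -HA => [|n _]; last by rewrite mulr1.
  by rewrite /fblaschke -prodfV; apply: eq_bigr => n _; rewrite bfactor_inv.
have e2 : conjc (fblaschke N w) = kappa + \sum_(n < N) A n * (conjc w / (1 - z n * conjc w)).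
  rewrite -HA => [|n _]; last exact: zw.
  by rewrite /fblaschke conjc_prod; apply: eq_bigr => n _; rewrite -bfactor_conj.
have B0 : fblaschke N v != 0 by rewrite -cabs_eq0 fblaschke_circle// oner_eq0.
have wv : 1 - conjc w * v != 0 by apply: szego_den; rewrite v1 mulr1.
suff : szego w v = conjc (fblaschke N w) * (fblaschke N v * szego w v) +
    \sum_(n < N) conjc (szego (z n) w) * (A n * fblaschke N v / (v - z n)).
  move=> /(congr1 conjc) ->; rewrite conjcD (conjcM (conjc _)) conjcK; congr (_ + _).
  by rewrite conjc_sum; apply: eq_bigr => n _; rewrite (conjcM (conjc _)) conjcK.
have := congr2 (fun a b => (a - b) * (fblaschke N v * szego w v)) e1 e2.
rewrite mulrBl mulrA mulVf// mul1r => /eqP; rewrite subr_eq addrC => /eqP h; rewrite [LHS]h.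
congr (_ + _); rewrite opprD addrACA subrr add0r -sumrB mulr_suml.
apply: eq_bigr => n _; rewrite conj_szego /szego.
by have := zw n; have := vz n; move=> h1 h2; field; rewrite wv h2 h1.
Qed.

End partial_fractions.

(** * Finite inequalities behind the boundedness of Gram matrices *)

Section gram_matrix.
Context {R : realType}.

(* Vinogradov-Senichkin test: with M i j = s_i^3 s_j / tau_ij^2, the quasi
   triangle inequality gives M M^T <= 2 A (M + M^T) entrywise, hence
   |M^T a|^2 <= 4 A <a, M^T a>. *)
Lemma vinogradov_senichkin (I : finType) (s : I -> R) (tau : I -> I -> R) (A : R)
    (a : I -> R) : 0 < A -> (forall i, 0 < s i) -> (forall i j, 0 < tau i j) ->
  (forall i j, tau i j = tau j i) ->
  (forall i j k, tau i k <= tau i j + tau k j) ->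
  (forall i, \sum_j s i ^+ 2 * s j ^+ 2 / tau i j ^+ 2 <= A) ->
  (forall i, 0 <= a i) ->
  \sum_i \sum_j a i * a j * (s i * s j * (s i ^+ 2 + s j ^+ 2) / tau i j ^+ 2)
    <= 8 * A * \sum_i a i ^+ 2.
Proof.
move=> A0 s0 t0 tC tri HA a0.
pose M i j := s i ^+ 3 * s j / tau i j ^+ 2.
pose v j := \sum_i M i j * a i.
pose Q := \sum_j a j * v j.
have QE : Q = \sum_i \sum_j a i * a j * M i j.
  rewrite exchange_big/= /Q; apply: eq_bigr => j _; rewrite /v mulr_sumr.
  by apply: eq_bigr => i _; ring.
have QE' : Q = \sum_i \sum_j a i * a j * M j i.
  rewrite QE exchange_big/=; apply: eq_bigr => j _; apply: eq_bigr => i _.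
  by rewrite [a i * _]mulrC.
have -> : \sum_i \sum_j a i * a j * (s i * s j * (s i ^+ 2 + s j ^+ 2) / tau i j ^+ 2) = 2 * Q.
  rewrite mulrDl mul1r {1}QE QE' -big_split/=; apply: eq_bigr => i _.
  rewrite -big_split/=; apply: eq_bigr => j _; rewrite /M (tC j i); ring.
have vv : \sum_j v j ^+ 2 <= 4 * A * Q.
  have -> : \sum_j v j ^+ 2 = \sum_i \sum_k a i * a k * \sum_j M i j * M k j.
    transitivity (\sum_j \sum_i \sum_k a i * a k * (M i j * M k j)).
      apply: eq_bigr => j _; rewrite expr2 /v mulr_suml; apply: eq_bigr => i _.
      by rewrite mulr_sumr; apply: eq_bigr => k _; ring.
    rewrite exchange_big; apply: eq_bigr => i _; rewrite exchange_big.
    by apply: eq_bigr => k _; rewrite mulr_sumr.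
  have -> : 4 * A * Q = \sum_i \sum_k a i * a k * (2 * A * (M i k + M k i)).
    transitivity (2 * A * (Q + Q)); first by ring.
    rewrite {1}QE QE' -big_split/= mulr_sumr; apply: eq_bigr => i _.
    rewrite -big_split/= mulr_sumr; apply: eq_bigr => k _; ring.
  apply: ler_sum => i _; apply: ler_sum => k _; apply: ler_wpM2l; first exact: mulr_ge0.
  have tik := t0 i k.
  have si := s0 i; have sk := s0 k.
  (* The triangle inequality gives tau_ik^2 <= 2 (tau_ij^2 + tau_kj^2), which separates 1 /
     (tau_ij^2 tau_kj^2) into two sums of the kind bounded by A. *)
  apply: (@le_trans _ _ (s i ^+ 3 * s k ^+ 3 * (2 / tau i k ^+ 2) *
     (\sum_j (s j ^+ 2 / tau i j ^+ 2 + s j ^+ 2 / tau k j ^+ 2)))).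
    rewrite mulr_sumr; apply: ler_sum => j _.
    have tij := t0 i j; have tkj := t0 k j.
    have -> : M i j * M k j = s i ^+ 3 * s k ^+ 3 * (s j ^+ 2 / (tau i j ^+ 2 * tau k j ^+ 2)).
      by rewrite /M; field; rewrite !gt_eqF.
    rewrite -[leRHS]mulrA ler_pM2l ?mulr_gt0 ?exprn_gt0//.
    have -> : 2 / tau i k ^+ 2 * (s j ^+ 2 / tau i j ^+ 2 + s j ^+ 2 / tau k j ^+ 2) =
       s j ^+ 2 / (tau i j ^+ 2 * tau k j ^+ 2) * (2 * (tau i j ^+ 2 + tau k j ^+ 2) / tau i k ^+ 2).
      by field; rewrite !gt_eqF.
    apply: ler_peMr; first by apply: divr_ge0; [exact: sqr_ge0|apply: mulr_ge0; exact: sqr_ge0].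
    rewrite ler_pdivlMr ?exprn_gt0// mul1r.
    have h : tau i k ^+ 2 <= (tau i j + tau k j) ^+ 2.
      by rewrite lerXn2r ?nnegrE ?addr_ge0 ?(ltW tij) ?(ltW tkj) ?(ltW tik).
    apply: (le_trans h); have := sqr_ge0 (tau i j - tau k j); lra.
  have B1 (l : I) : \sum_j s j ^+ 2 / tau l j ^+ 2 <= A / s l ^+ 2.
    rewrite ler_pdivlMr ?exprn_gt0// mulr_suml; apply: le_trans (HA l).
    apply: ler_sum => j _; rewrite le_eqVlt; apply/orP; left; apply/eqP; ring.
  rewrite big_split/=.
  have B := lerD (B1 i) (B1 k).
  have P0 : 0 <= s i ^+ 3 * s k ^+ 3 * (2 / tau i k ^+ 2).
    by rewrite ltW// !mulr_gt0 ?exprn_gt0// invr_gt0 exprn_gt0.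
  apply: (le_trans (ler_wpM2l P0 B)).
  rewrite /M (tC k i) le_eqVlt; apply/orP; left; apply/eqP.
  by field; rewrite !gt_eqF.
(* Young's inequality 2 (4 A) a_j v_j <= v_j^2 + (4 A)^2 a_j^2; with [vv] it bounds Q by 4 A times
   the sum of the a_j^2. *)
have Q1 : 2 * (4 * A) * Q <= \sum_j v j ^+ 2 + (4 * A) ^+ 2 * \sum_j a j ^+ 2.
  rewrite /Q !mulr_sumr -big_split/=; apply: ler_sum => j _.
  have := sqr_ge0 (v j - 4 * A * a j); lra.
have : 4 * A * Q <= 4 * A * (4 * A * \sum_j a j ^+ 2).
  have -> : 4 * A * (4 * A * \sum_j a j ^+ 2) = (4 * A) ^+ 2 * \sum_j a j ^+ 2 by ring.
  lra.
by rewrite ler_pM2l ?mulr_gt0//; lra.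
Qed.

Lemma sum_mul_le (I : finType) (a s : I -> R) :
  \sum_i \sum_j a i * a j * (s i * s j) <= (\sum_i s i ^+ 2) * \sum_i a i ^+ 2.
Proof.
have -> : (\sum_i s i ^+ 2) * \sum_i a i ^+ 2 =
    \sum_i \sum_j (a i ^+ 2 * s j ^+ 2 + a j ^+ 2 * s i ^+ 2) / 2.
  transitivity (((\sum_i s i ^+ 2) * (\sum_i a i ^+ 2) + (\sum_i s i ^+ 2) * (\sum_i a i ^+ 2)) /
      2); first by field.
  rewrite -[\sum_i \sum_j _](_ : (\sum_i \sum_j (a i ^+ 2 * s j ^+ 2 + a j ^+ 2 * s i ^+ 2)) /
      2 = _); last first.
    by rewrite mulr_suml; apply: eq_bigr => i _; rewrite mulr_suml.
  congr (_ / 2); rewrite {1}mulrC !mulr_suml -big_split/=; apply: eq_bigr => i _.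
  rewrite !mulr_sumr -big_split/=; apply: eq_bigr => j _; ring.
apply: ler_sum => i _; apply: ler_sum => j _.
have := sqr_ge0 (a i * s j - a j * s i); lra.
Qed.

(* From 1/y >= 1 + (1 - y). *)
Lemma prod_sum_onem (I : Type) (r : seq I) (P : pred I) (y : I -> R) :
  (forall i, P i -> 0 < y i <= 1) ->
  (\prod_(i <- r | P i) y i) * (1 + \sum_(i <- r | P i) (1 - y i)) <= 1.
Proof.
move=> y01; elim: r => [|i r IH]; first by rewrite !big_nil mul1r addr0.
rewrite !big_cons; case: ifP => // Pi; have /andP[y0 y1] := y01 i Pi.
set p := \prod_(j <- r | P j) y j in IH *; set S := \sum_(j <- r | P j) (1 - y j) in IH *.
have p0 : 0 <= p by apply: prodr_ge0 => j /y01/andP[/ltW].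
have S0 : 0 <= S by apply: sumr_ge0 => j /y01/andP[_]; rewrite subr_ge0.
have h1 : p * (1 + S) * (y i * (2 - y i)) <= 1 * 1.
  apply: ler_pM => //; first by rewrite mulr_ge0// addr_ge0.
    by rewrite mulr_ge0// ?subr_ge0 ?(le_trans y1) ?ler1n// ltW.
  have := sqr_ge0 (1 - y i); lra.
have h2 : 0 <= p * S * y i * (1 - y i) by rewrite !mulr_ge0 ?(ltW y0)// subr_ge0.
lra.
Qed.

End gram_matrix.

(** * The finite kernel expansion and its coefficients *)

Section coefficient_bound.
Context {R : realType}.
Local Notation C := (R[i]^o).

(** Dividing by the left-hand side gives 1 - rho^2 = (1 - |a|^2)(1 - |b|^2) / |1 - conj(a) b|^2 for
    the pseudohyperbolic distance rho. *)
Lemma sqr_cabs_den (a b : C) : cabs (1 - conjc a * b) ^+ 2 =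
  cabs (a - b) ^+ 2 + (1 - cabs a ^+ 2) * (1 - cabs b ^+ 2).
Proof. by rewrite !sqr_cabs; case: a => a1 a2; case: b => b1 b2 /=; ring. Qed.

Lemma cabs_sub_le_den (a b : C) : cabs a < 1 -> cabs b < 1 ->
  cabs (a - b) <= cabs (1 - conjc a * b).
Proof.
move=> a1 b1; rewrite -ler_sqr ?nnegrE ?cabs_ge0// sqr_cabs_den lerDl.
by rewrite mulr_ge0// subr_ge0 expr_le1 ?cabs_ge0// ltW.
Qed.

(** |1 - conj(a) b| serves as [tau] in [vinogradov_senichkin]; unlike |a - b| it is positive on the
    diagonal. *)
Lemma den_triangle (a b c : C) : cabs a < 1 -> cabs b < 1 -> cabs c < 1 ->
  cabs (1 - conjc a * b) <= cabs (1 - conjc a * c) + cabs (1 - conjc b * c).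
Proof.
move=> a1 b1 c1.
have -> : 1 - conjc a * b = (1 - conjc a * c) + conjc a * (c - b) by ring.
apply: (le_trans (ler_cabsD _ _)); rewrite lerD2l cabsM cabs_conj.
rewrite cabs_distC; apply: le_trans (cabs_sub_le_den b1 c1).
by rewrite ler_piMl ?cabs_ge0// ltW.
Qed.

Lemma cabs_denC (a b : C) : cabs (1 - conjc a * b) = cabs (1 - conjc b * a).
Proof. by rewrite -cabs_conj conjcB conjcM conjcK conjc1 mulrC. Qed.

Lemma cavg_gram (I : finType) (H : I -> R -> C) (D : I -> C) :
  (forall i, continuous (H i)) ->
  (ravg (fun t => cabs (\sum_i D i * H i t) ^+ 2))%:C =
  \sum_i \sum_j D i * conjc (D j) * cavg (fun t => H i t * conjc (H j t)).
Proof.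
move=> cH; rewrite -cavg_sqr.
have cc (k : C) : continuous (fun _ : R => k) by move=> t; exact: cvg_cst.
have cHH i j := continuousCM (cH i) (continuous_conj (cH j)).
have cDH i j := continuousCM (cc (D i * conjc (D j))) (cHH i j).
have E t : (\sum_i D i * H i t) * conjc (\sum_i D i * H i t) =
    \sum_i \sum_j D i * conjc (D j) * (H i t * conjc (H j t)).
  rewrite conjc_sum mulr_suml; apply: eq_bigr => i _; rewrite mulr_sumr.
  by apply: eq_bigr => j _; rewrite conjcM; ring.
rewrite (eq_cavg E) cavg_sum; last by move=> i; apply: continuousC_sum; exact: cDH.
apply: eq_bigr => i _; rewrite cavg_sum; last exact: cDH.
by apply: eq_bigr => j _; rewrite cavgZ.
Qed.

Variable z : nat -> C.
Hypothesis z_disc : forall n, 0 < cabs (z n) < 1.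
Hypothesis z_inj : injective z.

Let zlt n : cabs (z n) < 1.
Proof. by have /andP[] := z_disc n. Qed.

(** The inverse of the H2 norm of the kernel [szego (z n)]. *)
Definition kweight n : R := Num.sqrt (1 - cabs (z n) ^+ 2).

Lemma kweight_sqr n : kweight n ^+ 2 = 1 - cabs (z n) ^+ 2.
Proof. by rewrite sqr_sqrtr// subr_ge0 expr_le1 ?cabs_ge0// ltW. Qed.

Lemma kweight_gt0 n : 0 < kweight n.
Proof. by rewrite sqrtr_gt0 subr_gt0 expr_lt1 ?cabs_ge0. Qed.

Let tau i j := cabs (1 - conjc (z i) * z j).

Let tau_gt0 i j : 0 < tau i j.
Proof. by rewrite cabs_gt0; exact: disc_den. Qed.

Lemma circle_sub_neq0 n t : polar 1 t - z n != 0 :> C.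
Proof.
rewrite subr_eq0; apply: contraTneq (z_disc n) => <-.
by rewrite cabs_polar// ltxx andbF.
Qed.

Lemma inv_circle_sub n t : (polar 1 t - z n)^-1 =
  conjc (polar 1 t) * conjc (szego (z n) (polar 1 t)) :> C.
Proof.
have h := circle_sub_neq0 n t; have v0 := @polar_neq0 R 1 t ltr01.
rewrite conj_szego conj_polar1 -invfM; congr (_^-1).
by rewrite mulrBr mulr1 mulrCA divff// mulr1.
Qed.

Lemma continuous_inv_circle_sub n : continuous (fun t => (polar 1 t - z n)^-1 : C).
Proof.
have -> : (fun t => (polar 1 t - z n)^-1) =
    fun t => conjc (polar 1 t) * conjc (szego (z n) (polar 1 t)).
  by apply/funext => t; exact: inv_circle_sub.
apply: (continuousCM (continuous_conj (@continuous_polar R 1))).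
exact: (continuous_conj (continuous_szego_circle (zlt n))).
Qed.

(** On the unit circle 1/(v - z_n) is the conjugate of v times the kernel at z_n, so these functions
    have the Gram matrix of the kernels, up to conjugation. *)
Lemma cavg_inv_circle_sub n m :
  cavg (fun t => (polar 1 t - z n)^-1 * conjc (polar 1 t - z m)^-1) = szego (z m) (z n).
Proof.
have m0 : 0 < cabs (z m) by have /andP[] := z_disc m.
rewrite -(@cauchy_formula R (szego (z m)) (cabs (z m))^-1 (z n)); last 3 first.
- by rewrite invf_gt1.
- by move=> w wr; apply: derivable_szego; rewrite mulrC -ltr_pdivlMr// mul1r.
- exact: zlt.
apply: eq_cavg => t; rewrite !inv_circle_sub (conjcM (conjc _)) !conjcK.
rewrite mulrACA [conjc (polar 1 t) * _]mulrC mulc_conj cabs_polar// expr1n mul1r.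
by rewrite mulrC.
Qed.

(** From 2 Re u = |u|^2 + 1 - |1 - u|^2 with u = 1 - conj(z_m) z_n. *)
Lemma two_Re_szego n m : 2 * complex.Re (szego (z m) (z n)) =
  1 + (1 - cabs (z m) ^+ 2 * cabs (z n) ^+ 2) / tau m n ^+ 2.
Proof.
have t0 := tau_gt0 m n; rewrite /tau in t0 *.
set u : C := 1 - conjc (z m) * z n in t0 *.
have t2 : cabs u ^+ 2 != 0 by rewrite expf_neq0// gt_eqF.
have uE : complex.Re (u^-1) = (complex.Re u : R) / cabs u ^+ 2.
  by rewrite sqr_cabs; case: (u).
rewrite /szego -/u uE.
suff : 2 * (complex.Re u : R) = cabs u ^+ 2 + (1 - cabs (z m) ^+ 2 * cabs (z n) ^+ 2).
  move=> h; apply: (@mulIf R (cabs u ^+ 2)) => //=.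
  by rewrite -mulrA divfK// h [RHS]mulrDl mul1r divfK.
rewrite /u; rewrite !sqr_cabs; case: (z m) => ? ?; case: (z n) => ? ? /=; ring.
Qed.

(** Adding the form Q' >= 0 built on the conjugate functions turns the entries of the Gram matrix
    into twice their real parts. These are nonnegative by [two_Re_szego], so the coefficients may be
    replaced by their moduli. *)
Lemma gram_le N (D : 'I_N -> C) :
  ravg (fun t => cabs (\sum_i D i * (polar 1 t - z i)^-1) ^+ 2) <=
  \sum_i \sum_j cabs (D i) * cabs (D j) *
    (1 + (kweight i ^+ 2 + kweight j ^+ 2) / tau i j ^+ 2).
Proof.
pose H (i : 'I_N) t : C := (polar 1 t - z i)^-1.
have cH i : continuous (H i) := @continuous_inv_circle_sub i.
have g1 := cavg_gram D cH.
have g2 := cavg_gram D (fun i => continuous_conj (cH i)).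
set Q := ravg _ in g1 *; set Q' := ravg _ in g2.
have Q'0 : 0 <= Q' by apply: ravg_ge0 => t; exact: sqr_ge0.
apply: (@le_trans _ _ (Q + Q')); first by rewrite lerDl.
have -> : Q + Q' = \sum_i \sum_j complex.Re (D i * conjc (D j)) * (2 * complex.Re (szego (z j) (z i))).
  transitivity (complex.Re (Q%:C + Q'%:C)); first by [].
  rewrite g1 g2 -big_split/= raddf_sum; apply: eq_bigr => i _.
  rewrite -big_split/= raddf_sum; apply: eq_bigr => j _.
  have -> : cavg (fun t => conjc (H i t) * conjc (conjc (H j t))) = conjc (szego (z j) (z i)).
    rewrite -cavg_inv_circle_sub -cavg_conj; last first.
      exact: (continuousCM (cH i) (continuous_conj (cH j))).
    by apply: eq_cavg => t; rewrite conjcM.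
  rewrite cavg_inv_circle_sub.
  by case: (D i * _) => ? ?; case: (szego _ _) => ? ? /=; ring.
apply: ler_sum => i _; apply: ler_sum => j _.
have K0 : 0 <= 2 * complex.Re (szego (z j) (z i)).
  rewrite two_Re_szego addr_ge0// divr_ge0 ?sqr_ge0// subr_ge0.
  by rewrite mulr_ile1 ?sqr_ge0// expr_le1 ?cabs_ge0// ltW.
apply: (@le_trans _ _ (cabs (D i) * cabs (D j) * (2 * complex.Re (szego (z j) (z i))))).
- apply: ler_wpM2r => //; apply: le_trans (ler_norm _) _; apply: le_trans (Re_le_cabs _) _.
  by rewrite cabsM cabs_conj.
- apply: ler_wpM2l; first exact: mulr_ge0 (cabs_ge0 _) (cabs_ge0 _).
  rewrite two_Re_szego lerD2l [tau i j](cabs_denC (z i)) ler_pM2r; last first.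
    by rewrite invr_gt0 exprn_gt0//; exact: tau_gt0.
  rewrite !kweight_sqr.
  have : 0 <= (1 - cabs (z i) ^+ 2) * (1 - cabs (z j) ^+ 2).
    by rewrite mulr_ge0// subr_ge0 expr_le1 ?cabs_ge0// ltW.
  lra.
Qed.

Variables (N : nat) (delta S : R).
Hypothesis delta_gt0 : 0 < delta.
Hypothesis carleson : forall n, (n < N)%N ->
  delta <= \prod_(k < N | k != n :> nat) pseudo_dist z k n.
Hypothesis sum_kweight : \sum_(n < N) kweight n ^+ 2 <= S.

Let S0 : 0 <= S.
Proof. by apply: le_trans sum_kweight; apply: sumr_ge0 => i _; exact: sqr_ge0. Qed.

(** The j-th term is 1 - rho_ij^2, equal to 1 for j = i. [prod_sum_onem] bounds the sum by the
    inverse of the product of the rho_ij^2 over j <> i, and this product is at least delta^2. *)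
Lemma sum_kweight_den (i : 'I_N) :
  \sum_(j < N) kweight i ^+ 2 * kweight j ^+ 2 / tau i j ^+ 2 <= delta ^- 2.
Proof.
have E (j : 'I_N) : kweight i ^+ 2 * kweight j ^+ 2 / tau i j ^+ 2 = 1 - pseudo_dist z j i ^+ 2.
  rewrite !kweight_sqr /pseudo_dist cabs_div expr_div_n /tau cabs_denC.
  have t0 : cabs (1 - conjc (z j) * z i) ^+ 2 != 0.
    by rewrite expf_neq0// gt_eqF//; exact: tau_gt0.
  have h (a b : R) : b != 0 -> 1 - a / b = (b - a) / b.
    by move=> b0; rewrite mulrBl divff.
  rewrite (h _ _ t0); congr (_ / _); rewrite sqr_cabs_den; ring.
rewrite (eq_bigr _ (fun j _ => E j)) (bigD1 i)//=.
have -> : pseudo_dist z i i = 0 by rewrite /pseudo_dist subrr mul0r cabs0.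
rewrite expr0n subr0.
have := @prod_sum_onem R _ (index_enum 'I_N) (fun j : 'I_N => j != i) (fun j => pseudo_dist z j i ^+ 2).
set P := \prod_(_ <- _ | _) _; set T := \sum_(_ <- _ | _) _ => h.
have {}h : P * (1 + T) <= 1.
  apply: h => j ji; have jn : j != i :> nat by [].
  rewrite exprn_gt0 ?pseudo_dist_gt0//= expr_le1 ?cabs_ge0// /pseudo_dist cabs_div.
  by rewrite ler_pdivrMr; [rewrite mul1r cabs_sub_le_den|exact: tau_gt0].
have PE : P = (\prod_(k < N | k != i :> nat) pseudo_dist z k i) ^+ 2.
  by rewrite /P prodrXl.
have Pd : delta ^+ 2 <= P.
  by rewrite PE lerXn2r ?nnegrE ?(ltW delta_gt0)// ?(le_trans (ltW delta_gt0))// carleson.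
have T0 : 0 <= T.
  apply: sumr_ge0 => j ji; rewrite subr_ge0 expr_le1 ?cabs_ge0// /pseudo_dist cabs_div.
  by rewrite ler_pdivrMr; [rewrite mul1r cabs_sub_le_den|exact: tau_gt0].
rewrite -[leRHS]mul1r ler_pdivlMr ?exprn_gt0// mulrC.
by apply: le_trans h; rewrite ler_wpM2r// addr_ge0.
Qed.

(** The outer delta^2 comes from |A_n| <= (1 - |z_n|^2) / delta, used for two indices; S and 8 /
    delta^2 bound the contributions of the two summands 1 and (k_i^2 + k_j^2) / tau_ij^2 in
    [gram_le], where k is [kweight]. N does not occur. *)
Definition embedding_bound : R := (S + 8 / delta ^+ 2) / delta ^+ 2.

Lemma embedding_bound_ge0 : 0 <= embedding_bound.
Proof.
have d2 : 0 <= delta ^+ 2 by rewrite exprn_ge0// ltW.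
by apply: divr_ge0 => //; apply: addr_ge0; [exact: S0|exact: divr_ge0].
Qed.

(** Integrating [szego_expansion] against f gives the identity. The bound is by duality: with T the
    combination of the g_n with coefficients x_n / [kweight n], the sum X of the |x_n|^2 is the
    pairing of f with T, so X^2 <= ||f||^2 ||T||^2, and the Gram estimate bounds ||T||^2 by a
    multiple of X. *)
Lemma finite_expansion (f : C -> C) (rho : R) : 1 < rho ->
  (forall w, cabs w < rho -> derivable f w 1) ->
  exists x : nat -> C,
  (forall w, cabs w < 1 -> f w = fblaschke z N w *
      cavg (fun t => f (polar 1 t) * conjc (fblaschke z N (polar 1 t) * szego w (polar 1 t))) +
    \sum_(n < N) x n * (kweight n)%:C * szego (z n) w) /\
  \sum_(n < N) cabs (x n) ^+ 2 <= embedding_bound * circle_mean2 f 1.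
Proof.
move=> rho1 df; have [A [HA Hb]] := szego_expansion z_disc z_inj N.
pose g n t : C := A n * fblaschke z N (polar 1 t) / (polar 1 t - z n).
have cf : continuous (fun t => f (polar 1 t) : C).
  by apply: continuous_circle => t; apply/derivable_continuous/df; rewrite cabs_polar.
have cc (k : C) : continuous (fun _ : R => k) by move=> t; exact: cvg_cst.
have cb n : continuous (fun t => bfactor (z n) (polar 1 t) : C).
  have -> : (fun t => bfactor (z n) (polar 1 t)) = fun t =>
      (cabs (z n))%:C / z n * ((z n - polar 1 t) * szego (z n) (polar 1 t)) by [].
  apply: (continuousCM (cc _)); apply: (continuousCM _ (continuous_szego_circle (zlt n))).
  exact: (continuousCB (cc (z n)) (@continuous_polar R 1)).
have cB : continuous (fun t => fblaschke z N (polar 1 t) : C).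
  rewrite /fblaschke; elim: (N) => [|M IH].
    by under eq_fun do rewrite big_ord0; exact: cc.
  have -> : (fun t => \prod_(n < M.+1) bfactor (z n) (polar 1 t)) =
    fun t => (\prod_(n < M) bfactor (z n) (polar 1 t)) * bfactor (z M) (polar 1 t).
    by apply/funext => t; rewrite big_ord_recr.
  exact: (continuousCM IH (cb M)).
have cg n : continuous (g n).
  exact: (continuousCM (continuousCM (cc (A n)) cB) (@continuous_inv_circle_sub n)).
pose e n := cavg (fun t => f (polar 1 t) * conjc (g n t)).
pose x n : C := e n / (kweight n)%:C.
have k0 n : (kweight n)%:C != 0 :> C.
  by rewrite -cabs_gt0 cabs_real normr_gt0 gt_eqF// kweight_gt0.
exists x; split.
  move=> w w1; rewrite -(cauchy_formula rho1 df w1).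
  have E t : f (polar 1 t) * conjc (szego w (polar 1 t)) =
     fblaschke z N w * (f (polar 1 t) * conjc (fblaschke z N (polar 1 t) * szego w (polar 1 t))) +
     \sum_(n < N) szego (z n) w * (f (polar 1 t) * conjc (g n t)).
    rewrite HA// mulrDr mulrCA; congr (_ + _).
    by rewrite mulr_sumr; apply: eq_bigr => n _; rewrite mulrCA.
  have c1 : continuous (fun t => f (polar 1 t) * conjc (fblaschke z N (polar 1 t) *
      szego w (polar 1 t)) : C).
    exact: (continuousCM cf (continuous_conj (continuousCM cB (continuous_szego_circle w1)))).
  have c2 n := continuousCM (cc (szego (z n) w)) (continuousCM cf (continuous_conj (cg n))).
  rewrite (eq_cavg E) cavgD; last 2 first.
  - exact: (continuousCM (cc _) c1).
  - by apply: continuousC_sum => n; exact: c2.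
  rewrite cavgZ// cavg_sum; last by move=> n; exact: c2.
  congr (_ + _); apply: eq_bigr => n _.
  rewrite cavgZ; last exact: (continuousCM cf (continuous_conj (cg n))).
  by rewrite -/(e n) /x divfK// mulrC.
set X := \sum_(n < N) _.
have X0 : 0 <= X by apply: sumr_ge0 => n _; exact: sqr_ge0.
pose D (n : 'I_N) : C := x n * A n / (kweight n)%:C.
pose T t : C := \sum_(n < N) (x n / (kweight n)%:C) * g n t.
have cT : continuous T.
  by apply: continuousC_sum => n; exact: (continuousCM (cc _) (cg n)).
have XE : X%:C = cavg (fun t => f (polar 1 t) * conjc (T t)).
  have E t : f (polar 1 t) * conjc (T t) = \sum_(n < N) conjc (x n / (kweight n)%:C) *
      (f (polar 1 t) * conjc (g n t)).
    rewrite /T conjc_sum mulr_sumr; apply: eq_bigr => n _.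
    by rewrite (conjcM (x n / _)) mulrCA.
  rewrite (eq_cavg E) cavg_sum; last first.
    by move=> n; exact: (continuousCM (cc _) (continuousCM cf (continuous_conj (cg n)))).
  have -> : X%:C = \sum_(n < N) x n * conjc (x n).
    by rewrite /X rmorph_sum; apply: eq_bigr => n _; rewrite mulc_conj.
  apply: eq_bigr => n _; rewrite cavgZ; last exact: (continuousCM cf (continuous_conj (cg n))).
  rewrite -/(e n) -(divfK (k0 n) (e n)) -/(x n) conjcM conjc_inv conjc_real.
  by field; rewrite k0.
(* The unimodular factor B_N drops out on the circle, leaving the functions of [gram_le]. *)
have TE t : cabs (T t) = cabs (\sum_(n < N) D n * (polar 1 t - z n)^-1).
  have -> : T t = fblaschke z N (polar 1 t) * \sum_(n < N) D n * (polar 1 t - z n)^-1.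
    rewrite mulr_sumr; apply: eq_bigr => n _; rewrite /D /g.
    have h := circle_sub_neq0 n t; have h' := k0 n.
    by field; rewrite h h'.
  by rewrite cabsM fblaschke_circle// ?mul1r// cabs_polar.
have Qle : ravg (fun t => cabs (T t) ^+ 2) <= embedding_bound * X.
  rewrite (eq_ravg (fun t => congr1 (fun u => u ^+ 2) (TE t))).
  apply: le_trans (gram_le D) _.
  have Dle (i : 'I_N) : cabs (D i) <= cabs (x i) * kweight i / delta.
    have ki := kweight_gt0 i.
    rewrite /D cabs_div cabsM cabs_real gtr0_norm// -!mulrA ler_wpM2l ?cabs_ge0//.
    rewrite ler_pdivrMr// mulrAC -expr2 ler_pdivlMr// kweight_sqr -(Hb i)//.
    by rewrite ler_wpM2l ?cabs_ge0// carleson.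
  apply: (@le_trans _ _ (\sum_(i < N) \sum_(j < N) (cabs (x i) * kweight i / delta) *
      (cabs (x j) * kweight j / delta) * (1 + (kweight i ^+ 2 + kweight j ^+ 2) / tau i j ^+ 2))).
    apply: ler_sum => i _; apply: ler_sum => j _; apply: ler_wpM2r.
      by rewrite addr_ge0// divr_ge0 ?addr_ge0 ?sqr_ge0.
    by apply: ler_pM; rewrite ?cabs_ge0.
  have -> : \sum_(i < N) \sum_(j < N) (cabs (x i) * kweight i / delta) *
      (cabs (x j) * kweight j / delta) * (1 + (kweight i ^+ 2 + kweight j ^+ 2) / tau i j ^+ 2) =
    (\sum_(i < N) \sum_(j < N) cabs (x i) * cabs (x j) * (kweight i * kweight j) +
     \sum_(i < N) \sum_(j < N) cabs (x i) * cabs (x j) *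
       (kweight i * kweight j * (kweight i ^+ 2 + kweight j ^+ 2) / tau i j ^+ 2)) / delta ^+ 2.
    rewrite -big_split/= mulr_suml; apply: eq_bigr => i _.
    rewrite -big_split/= mulr_suml; apply: eq_bigr => j _.
    by field; rewrite !gt_eqF.
  rewrite /embedding_bound -[leRHS]mulrAC ler_pM2r ?invr_gt0 ?exprn_gt0//.
  rewrite mulrDl; apply: lerD.
    apply: le_trans (sum_mul_le (fun i : 'I_N => cabs (x i)) (fun i : 'I_N => kweight i)) _.
    by rewrite ler_wpM2r.
  apply: (@vinogradov_senichkin R 'I_N (fun i => kweight i) (fun i j => tau i j) (delta ^- 2)
      (fun i => cabs (x i))) => //.
  - by rewrite invr_gt0 exprn_gt0.
  - by move=> i; exact: kweight_gt0.
  - by move=> i j; exact: cabs_denC.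
  - by move=> i j k; exact: den_triangle.
  - exact: sum_kweight_den.
  - by move=> i; exact: cabs_ge0.
have := cauchy_schwarz cf cT; rewrite -XE cabs_real ger0_norm// -circle_mean2E => XX.
have m0 : 0 <= circle_mean2 f 1 := mean2_ge0 f 1.
have [->|Xn0] := eqVneq X 0; first by rewrite mulr_ge0// embedding_bound_ge0.
have Xp : 0 < X by rewrite lt_neqAle eq_sym Xn0.
rewrite -(ler_pM2r Xp) -expr2; apply: (le_trans XX).
have := ler_wpM2l m0 Qle; lra.
Qed.

End coefficient_bound.

(** * The kernel expansion in the model space *)

Section blaschke_limit.
Context {R : realType}.
Local Notation C := (R[i]^o).
Local Notation mu := (@lebesgue_measure R).

(** The limit is not assumed continuous; it is measurable as a pointwise limit, so nothing need be
    known about the regularity of the Blaschke product. *)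
Lemma itg_dominated (F_ : nat -> R -> R) (F : R -> R) (a b M : R) :
  (forall n, continuous (F_ n)) ->
  (forall n t, a <= t <= b -> `|F_ n t| <= M) ->
  (forall t, F_ n t @[n --> \oo] --> F t) ->
  itg a b (F_ n) @[n --> \oo] --> itg a b F.
Proof.
move=> cF FM FF.
have mab : measurable (`[a, b]%classic : set R) by exact: measurable_itv.
have mF_ n : measurable_fun `[a, b] (F_ n).
  apply: measurable_funTS; exact: continuous_measurable_fun (cF n).
have mF : measurable_fun `[a, b] F.
  by apply: (measurable_fun_cvg mF_) => x _; exact: FF.
have iM : mu.-integrable `[a, b] (EFin \o cst M).
  by apply: cont_on_integrable; exact: cont_on_cst.
have bF t : a <= t <= b -> `|F t| <= M.
  move=> tab; have /cvg_norm := FF t; move=> h; apply: (cvgr_to_le h).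
  by apply: nearW => n; exact: FM.
have iF : mu.-integrable `[a, b] (EFin \o F).
  apply: le_integrable iM => //; first exact/measurable_EFinP.
  by move=> t /=; rewrite in_itv/= lee_fin => /bF h; rewrite (le_trans h)// ler_norm.
have := @dominated_cvg _ _ _ mu _ mab (fun n => EFin \o F_ n) (EFin \o F) (EFin \o cst M).
move=> /(_ _ _ _ iM) h.
apply: fine_cvg; rewrite fineK; last exact: integrable_fin_num.
apply: h => //.
- by move=> n; apply/measurable_EFinP; exact: mF_.
- by move=> t _; apply: cvg_EFin; [exact: nearW|exact: FF].
Qed.

Lemma cavg_dominated (F_ : nat -> R -> C) (F : R -> C) (M : R) :
  (forall n, continuous (F_ n)) ->
  (forall n t, 0 <= t <= 2 * pi -> cabs (F_ n t) <= M) ->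
  (forall t, F_ n t @[n --> \oo] --> F t) ->
  (cavg (F_ n) : C) @[n --> \oo] --> (cavg F : C).
Proof.
move=> cF FM FF; apply: cvgC_ReIm; rewrite cavgE/=.
- have -> : (fun n => complex.Re (cavg (F_ n))) = (fun n => ravg (fun t => complex.Re (F_ n t))).
    by apply/funext => n; rewrite cavgE.
  apply: cvgM; first exact: cvg_cst.
  apply: (@itg_dominated _ _ _ _ M).
  + by move=> n; exact: (continuous_Re (cF n)).
  + by move=> n t ti; rewrite (le_trans (Re_le_cabs _))// FM.
  + by move=> t; exact: (cvg_Re (FF t)).
- have -> : (fun n => complex.Im (cavg (F_ n))) = (fun n => ravg (fun t => complex.Im (F_ n t))).
    by apply/funext => n; rewrite cavgE.
  apply: cvgM; first exact: cvg_cst.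
  apply: (@itg_dominated _ _ _ _ M).
  + by move=> n; exact: (continuous_Im (cF n)).
  + by move=> n t ti; rewrite (le_trans (Im_le_cabs _))// FM.
  + by move=> t; exact: (cvg_Im (FF t)).
Qed.

Lemma summable_steps_cvg (u : nat -> C) (v : nat -> R) :
  (forall n, cabs (u n.+1 - u n) <= v n) -> cvgn (series v) -> cvgn u.
Proof.
move=> uv cv.
have key (g : C -> R) (gE : forall a b, g a - g b = g (a - b))
    (gle : forall a, `|g a| <= cabs a) : cvgn (fun n => g (u n)).
  have E : (fun n => g (u n)) = (fun n => g (u 0%N) + series (telescope (fun n => g (u n))) n).
    by apply/funext => n; exact: (eq_sum_telescope (fun n => g (u n))).
  rewrite E; apply: is_cvgD; first exact: is_cvg_cst.
  apply: normed_cvg; apply: (series_le_cvg _ _ _ cv) => n.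
  - exact: normr_ge0.
  - exact: le_trans (cabs_ge0 _) (uv n).
  - apply: le_trans (uv n); apply: le_trans (gle _).
    by rewrite -gE.
have /cvg_ex[a ca] := key (@complex.Re R) (fun a b => esym (raddfB _ a b)) Re_le_cabs.
have /cvg_ex[b cb] := key (@complex.Im R) (fun a b => esym (raddfB _ a b)) Im_le_cabs.
by apply/cvg_ex; exists (a +i* b); apply: cvgC_ReIm.
Qed.

Variable z : nat -> C.
Hypothesis z_carleson : carleson_sequence z.

Lemma carleson_disc n : 0 < cabs (z n) < 1.
Proof. by case: z_carleson => -[]. Qed.

Let zlt n : cabs (z n) < 1.
Proof. by have /andP[] := carleson_disc n. Qed.

Definition carleson_delta : R := inf (range (carleson_product z)).

Lemma carleson_delta_gt0 : 0 < carleson_delta.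
Proof. by case: z_carleson. Qed.

Let pprod n N : R := \prod_(k < N | k != n :> nat) pseudo_dist z k n.

Lemma pseudo_dist_le1 k n : 0 <= pseudo_dist z k n <= 1.
Proof.
rewrite cabs_ge0/= /pseudo_dist cabs_div ler_pdivrMr; last first.
  by rewrite cabs_gt0; exact: disc_den.
by rewrite mul1r cabs_sub_le_den.
Qed.

(** Each factor is at most 1, so the partial products decrease to [carleson_product]; this also
    shows that its [limn] is a genuine limit. *)
Lemma carleson_delta_le n N : carleson_delta <= pprod n N.
Proof.
have p0 m M : 0 <= pprod m M by apply: prodr_ge0 => k _; exact: cabs_ge0.
have pdec m : nonincreasing_seq (pprod m).
  apply/nonincreasing_seqP => M; rewrite {1}/pprod big_mkcond big_ord_recr/= -big_mkcond/=.
  case: ifP => _; last by rewrite mulr1.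
  by rewrite ler_piMr ?p0//; have /andP[] := pseudo_dist_le1 M m.
have pcv m : cvgn (pprod m).
  by apply: nonincreasing_is_cvgn => //; exists 0 => _ [M _ <-].
have E m : carleson_product z m = limn (pprod m) by [].
apply: (@le_trans _ _ (carleson_product z n)).
  apply: ge_inf; last by exists n.
  exists 0 => _ [m _ <-]; rewrite E; apply: limr_ge => //.
  by apply: nearW => M; exact: p0.
by rewrite E; apply: nonincreasing_cvgn_ge.
Qed.

(** A repeated zero would put a factor 0 into the product of length k + 1. *)
Lemma carleson_inj : injective z.
Proof.
move=> k n zkn; apply/eqP; apply: contraT => kn.
have := carleson_delta_le n k.+1.
rewrite /pprod big_mkcond big_ord_recr/= kn.
have -> : pseudo_dist z k n = 0 by rewrite /pseudo_dist zkn subrr mul0r cabs0.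
by rewrite mulr0 leNgt carleson_delta_gt0.
Qed.

Lemma cvg_series_onem : cvgn (series (fun n => 1 - cabs (z n))).
Proof. by case: z_carleson => -[]. Qed.

Lemma cvg_series_kweight : cvgn (series (fun n => kweight z n ^+ 2)).
Proof.
have c2 : cvgn (series (fun n => 2 * (1 - cabs (z n)))) :=
    @is_cvg_seriesZ R (fun n => 1 - cabs (z n)) 2 cvg_series_onem.
apply: (series_le_cvg _ _ _ c2) => n /=.
- exact: sqr_ge0.
- by rewrite mulr_ge0// subr_ge0 ltW.
- rewrite kweight_sqr; last exact: carleson_disc.
  have := sqr_ge0 (1 - cabs (z n)); lra.
Qed.

Definition kweight_total : R := limn (series (fun n => kweight z n ^+ 2)).

Lemma sum_kweight_le N : \sum_(n < N) kweight z n ^+ 2 <= kweight_total.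
Proof.
have := @nondecreasing_cvgn_le R (series (fun n => kweight z n ^+ 2)) _ cvg_series_kweight N.
rewrite /series/= big_mkord; apply.
by apply/nondecreasing_seqP => n; rewrite big_nat_recr//= lerDl sqr_ge0.
Qed.

(** Since z_n conj(z_n) = |z_n|^2, the factor |z_n| - 1 splits off from the difference; the steps of
    the partial products are thus summable. *)
Lemma bfactor_onem (w : C) n : cabs w < 1 ->
  cabs (bfactor (z n) w - 1) <= (1 - cabs (z n)) * (2 / (1 - cabs w)).
Proof.
move=> w1; have /andP[zp z1] := carleson_disc n.
have z0 : z n != 0 by rewrite -cabs_gt0.
have d0 : 1 - conjc (z n) * w != 0 by exact: disc_den.
pose a : C := (cabs (z n))%:C.
have aa : z n * conjc (z n) = a * a by rewrite mulc_conj /a expr2 -rmorphM.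
have E : bfactor (z n) w - 1 = (a - 1) * ((z n + a * w) / ((1 - conjc (z n) * w) * z n)).
  rewrite /bfactor -/a.
  have -> : a / z n * ((z n - w) / (1 - conjc (z n) * w)) - 1 =
    (a * (z n - w) - (z n - (z n * conjc (z n)) * w)) / ((1 - conjc (z n) * w) * z n).
    by field; rewrite d0 z0.
  by rewrite aa; field; rewrite d0 z0.
have a1 : cabs (a - 1) = 1 - cabs (z n).
  rewrite /a -(rmorph1 (real_complex R)) -rmorphB cabs_real distrC ger0_norm//.
  by rewrite subr_ge0 ltW.
rewrite E cabsM a1 ler_wpM2l ?subr_ge0 ?(ltW z1)//.
rewrite cabs_div cabsM.
have dl : 1 - cabs w <= cabs (1 - conjc (z n) * w).
  apply: le_trans (ler_cabs_sub _ _); rewrite cabs1 cabsM cabs_conj lerD2l lerN2.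
  by rewrite ler_piMl ?cabs_ge0// ltW.
have w0 : 0 < 1 - cabs w by rewrite subr_gt0.
rewrite ler_pdivrMr; last by rewrite mulr_gt0// (lt_le_trans w0).
apply: (@le_trans _ _ (2 * cabs (z n))).
  apply: le_trans (ler_cabsD _ _) _; rewrite cabsM /a cabs_real ger0_norm ?cabs_ge0//.
  rewrite mulrDl mul1r lerD2l ler_piMr ?cabs_ge0// ltW//.
rewrite mulrA ler_pM2r// -[leLHS]mulr1 mulrAC -mulrA ler_pM2l//.
by rewrite ler_pdivlMr// mul1r.
Qed.

Lemma fblaschke_cvg (w : C) : cabs w < 1 ->
  fblaschke z N w @[N --> \oo] --> blaschke_product z w.
Proof.
move=> w1; suff : cvgn (fblaschke z ^~ w) by [].
apply: (@summable_steps_cvg _ (fun n => 2 / (1 - cabs w) * (1 - cabs (z n)))).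
  move=> n; rewrite /fblaschke big_ord_recr/= -[X in _ - X]mulr1 -mulrBr cabsM.
  rewrite [leRHS]mulrC -[leRHS]mul1r; apply: ler_pM; rewrite ?cabs_ge0//.
    exact: (fblaschke_disc carleson_disc n w1).
  exact: bfactor_onem.
exact: (@is_cvg_seriesZ R (fun n => 1 - cabs (z n)) (2 / (1 - cabs w)) cvg_series_onem).
Qed.

End blaschke_limit.

(** * Limits of bounded functions along an ultrafilter *)

Section ultrafilter_limits.
Context {R : realType} {T : Type} (U : set_system T) {UU : UltraFilter U}.
Local Notation C := (R[i]^o).

(** The limit is the supremum of the c such that c <= phi on a set of U. An ultrafilter contains the
    set where phi is at least sup S + e or its complement, and the former is excluded. *)
Lemma ultra_cvg (phi : T -> R) (M : R) : U [set t | `|phi t| <= M] ->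
  exists l : R, phi @ U --> l.
Proof.
move=> UM; pose S := [set c | U [set t | c <= phi t]].
have S0 : S !=set0.
  exists (- M); apply: filterS UM => t /=; by rewrite ler_norml => /andP[].
have Sb : ubound S (M + 1).
  move=> c Sc; have [t [/= h1 h2]] := filter_ex (filterI UM Sc).
  by move: h1; rewrite ler_norml => /andP[_ h1]; lra.
exists (sup S); apply/cvgrPdistC_le => e e0.
have h1 : U [set t | sup S - e <= phi t].
  have [c Sc ce] : exists2 c, S c & sup S - e < c.
    by apply: sup_adherent => //; split => //; exists (M + 1).
  by apply: filterS Sc => t /=; apply: le_trans; exact: ltW.
have h2 : U [set t | phi t <= sup S + e].
  have [|h] := @in_ultra_setVsetC T U [set t | sup S + e <= phi t] UU.
    move=> h; have : sup S + e <= sup S by apply: ub_le_sup => //; exists (M + 1).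
    by rewrite gerDl leNgt e0.
  by apply: filterS h => t /= /negP; rewrite -ltNge => /ltW.
apply: filterS2 h1 h2 => t /= h1 h2; rewrite ler_norml; apply/andP; split; lra.
Qed.

Lemma ultra_cvgC (phi : T -> C) (M : R) : U [set t | cabs (phi t) <= M] ->
  exists l : C, phi @ U --> l.
Proof.
move=> UM.
have [a ca] : exists l : R, (fun t => complex.Re (phi t)) @ U --> l.
  by apply: (@ultra_cvg _ M); apply: filterS UM => t /=; apply: le_trans; exact: Re_le_cabs.
have [b cb] : exists l : R, (fun t => complex.Im (phi t)) @ U --> l.
  by apply: (@ultra_cvg _ M); apply: filterS UM => t /=; apply: le_trans; exact: Im_le_cabs.
by exists (a +i* b); exact: cvgC_ReIm.
Qed.

End ultrafilter_limits.

(** * Finite expansions of dilations, uniformly in the radius and the degree *)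

Section model_space_expansion.
Context {R : realType}.
Local Notation C := (R[i]^o).
Variable z : nat -> C.
Hypothesis z_carleson : carleson_sequence z.

Let zd := carleson_disc z_carleson.
Let zlt n : cabs (z n) < 1.
Proof. by have /andP[] := zd n. Qed.
Let zinj := carleson_inj z_carleson.

Definition coef_const : R := embedding_bound (carleson_delta z) (kweight_total z).

Lemma coef_const_ge0 : 0 <= coef_const.
Proof.
apply: (@embedding_bound_ge0 R z 0) => //; first exact: carleson_delta_gt0.
exact: sum_kweight_le.
Qed.

Lemma derivable_fblaschke N (w : C) : cabs w <= 1 -> derivable (fblaschke z N) w 1.
Proof.
move=> w1; have db n : derivable (bfactor (z n)) w 1.
  have -> : bfactor (z n) = fun y => (cabs (z n))%:C / z n * ((z n + (-1) * y) * szego (z n) y).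
    by apply/funext => y; rewrite mulN1r.
  apply: derivableCM; first exact: derivable_cst.
  apply: derivableCM; first exact: derivable_affine.
  apply: derivable_szego; apply: le_lt_trans (zlt n).
  by rewrite ler_piMr ?cabs_ge0.
elim: N => [|N IH].
  have -> : fblaschke z 0 = fun=> 1 by apply/funext => y; rewrite /fblaschke big_ord0.
  exact: derivable_cst.
have -> : fblaschke z N.+1 = fun y => fblaschke z N y * bfactor (z N) y.
  by apply/funext => y; rewrite /fblaschke big_ord_recr.
exact: (derivableCM IH (db N)).
Qed.

Lemma derivable_fblaschke_szego N (u w : C) : cabs u < 1 -> cabs w <= 1 ->
  derivable (fun v => fblaschke z N v * szego u v : C) w 1.
Proof.
move=> u1 w1; apply: derivableCM; first exact: derivable_fblaschke.
apply: derivable_szego; apply: le_lt_trans u1.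
by rewrite ler_piMr ?cabs_ge0.
Qed.

(** The dilation is by r^2 because pairing f on the circle of radius r^2 with a function on the unit
    circle equals pairing both on the circle of radius r, the form in which orthogonality is given.
    F is holomorphic up to radius r^-2 > 1, as [finite_expansion] requires. *)
Lemma dilate_expansion (f : C -> C) (r : R) N : H2 f -> 0 < r < 1 ->
  exists x : nat -> C,
  (forall w, cabs w < 1 -> f ((r ^+ 2)%:C * w) = fblaschke z N w *
      circle_inner f (fun v => fblaschke z N v * szego w v) r +
    \sum_(n < N) x n * (kweight z n)%:C * szego (z n) w) /\
  \sum_(n < N) cabs (x n) ^+ 2 <= coef_const * H2_norm f ^+ 2.
Proof.
move=> hf /andP[r0 r1]; have [df _] := hf.
have r20 : 0 < r ^+ 2 by rewrite exprn_gt0.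
have r21 : r ^+ 2 < 1 by rewrite expr_lt1 ?ltW.
pose F (w : C) : C := f ((r ^+ 2)%:C * w).
have dF w : cabs w < r ^- 2 -> derivable F w 1.
  move=> wr.
  have dl : derivable (fun v : C => (r ^+ 2)%:C * v : C) w 1.
    by apply: (@derivableCM R (fun=> (r ^+ 2)%:C) id); [exact: derivable_cst|exact: derivable_id].
  apply: (derivableC_comp dl).
  by apply: df; rewrite cabsM cabs_real gtr0_norm// mulrC -ltr_pdivlMr// mul1r.
have rho1 : 1 < r ^- 2 by rewrite invf_gt1.
have Fp t : F (polar 1 t) = f (polar (r ^+ 2) t).
  by rewrite /F; congr f; rewrite /polar mulrA -rmorphM/= mulr1.
have [x [Hx Hb]] := @finite_expansion R z zd zinj N _ _ (carleson_delta_gt0 z_carleson)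
  (fun n _ => carleson_delta_le z_carleson n N) (sum_kweight_le z_carleson N) F _ rho1 dF.
exists x; split.
  move=> w w1; rewrite -/(F w) (Hx w w1).
  suff -> : cavg (fun t => F (polar 1 t) *
        conjc (fblaschke z N (polar 1 t) * szego w (polar 1 t))) =
      circle_inner f (fun v => fblaschke z N v * szego w v) r by [].
  transitivity (cavg (fun t => f (polar (r ^+ 2) t) *
      conjc (fblaschke z N (polar 1 t) * szego w (polar 1 t)))).
    by apply: eq_cavg => t; rewrite Fp.
  apply: (@circle_inner_shift R f (fun v => fblaschke z N v * szego w v)) => //.
  - by move=> v vr; apply: df; exact: le_lt_trans r1.
  - by move=> v vr; exact: derivable_fblaschke_szego.
  - by rewrite expr2 ler_piMl// ltW.
  - by rewrite expr2 mulr1.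
apply: (le_trans Hb); apply: ler_wpM2l; first exact: coef_const_ge0.
have -> : circle_mean2 F 1 = circle_mean2 f (r ^+ 2).
  by rewrite !circle_mean2E; apply: eq_ravg => t; rewrite Fp.
by have [_] := mean2_le_norm hf; apply; rewrite r20.
Qed.

Lemma circle_inner_fblaschke_cvg (f : C -> C) (r : R) (w : C) :
  holomorphic_on_disc f -> 0 < r < 1 -> cabs w < 1 ->
  (circle_inner f (fun v => fblaschke z N v * szego w v) r : C) @[N --> \oo] -->
  (circle_inner f (fun v => blaschke_product z v * szego w v) r : C).
Proof.
move=> df /andP[r0 r1] w1.
have cf : continuous (fun t => f (polar r t) : C).
  by apply: continuous_on_circle => //; rewrite ltW.
have pr t : cabs (polar r t : C) = r by rewrite cabs_polar// ltW.
have cg N : continuous (fun t => fblaschke z N (polar r t) * szego w (polar r t) : C).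
  apply: (@continuous_circle R (fun v => fblaschke z N v * szego w v)) => t.
  by apply/derivable_continuous/derivable_fblaschke_szego => //; rewrite pr ltW.
(* The empty product [fblaschke z 0] is 1: this is f conj(k_w), and the maximum of its modulus on
   the circle dominates for all N. *)
have cs : continuous (fun t => f (polar r t) * conjc (fblaschke z 0 (polar r t) * szego w (polar r t)) : C).
  exact: (continuousCM cf (continuous_conj (cg 0%N))).
have [c _ Hc] : exists2 c, c \in `[0, 2 * pi] & forall t, t \in `[0, 2 * pi] ->
    cabs (f (polar r t) * conjc (fblaschke z 0 (polar r t) * szego w (polar r t))) <=
    cabs (f (polar r c) * conjc (fblaschke z 0 (polar r c) * szego w (polar r c))).
  apply: EVT_max; first exact/ltW/pi2_gt0.
  by apply: continuous_subspaceT; exact: (continuous_cabs cs).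
apply: (@cavg_dominated R _ _ (cabs (f (polar r c) * conjc (fblaschke z 0 (polar r c) *
    szego w (polar r c))))).
- by move=> N; exact: (continuousCM cf (continuous_conj (cg N))).
- move=> N t ti; apply: le_trans (Hc t ti).
  rewrite !cabsM !cabs_conj !cabsM ler_wpM2l ?cabs_ge0// ler_wpM2r ?cabs_ge0//.
  rewrite [leRHS](_ : _ = 1); last by rewrite /fblaschke big_ord0 cabs1.
  by apply: fblaschke_disc => //; rewrite pr.
- move=> t; apply: (@cvgM R[i]); first exact: cvg_cst.
  apply: cvg_conjc; apply: (@cvgM R[i]); last exact: cvg_cst.
  by apply: fblaschke_cvg => //; rewrite pr.
Qed.

(** With s_n = [kweight z n], the inequality |X_n| s_n <= eta |X_n|^2 + s_n^2 / eta trades the bound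
    on the coefficients against the tail of the convergent series of the s_n^2, independently of
    N. *)
Lemma tail_bound (X k : nat -> C) (c E eta : R) M N : (M <= N)%N ->
  0 < eta -> (forall n, cabs (k n) <= c) ->
  \sum_(n < N) cabs (X n) ^+ 2 <= E ->
  cabs (\sum_(n < N) X n * (kweight z n)%:C * k n -
        \sum_(n < M) X n * (kweight z n)%:C * k n) <=
  c * (eta * E + (kweight_total z - \sum_(n < M) kweight z n ^+ 2) / eta).
Proof.
move=> MN eta0 kc XE.
have c0 : 0 <= c by apply: le_trans (kc 0%N); exact: cabs_ge0.
have splitE (V : zmodType) (F : nat -> V) : \sum_(n < N) F n - \sum_(n < M) F n = \sum_(M <= n < N) F n.
  by rewrite -!(big_mkord xpredT F) (big_cat_nat (leq0n M) MN)//= addrAC subrr add0r.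
rewrite (@splitE _ (fun n => X n * (kweight z n)%:C * k n)).
have cabs_sum (F : nat -> C) : cabs (\sum_(M <= n < N) F n) <= \sum_(M <= n < N) cabs (F n).
  elim/big_ind2: _ => //; first by rewrite cabs0.
  by move=> a b a' b' h1 h2; apply: le_trans (ler_cabsD _ _) _; exact: lerD.
apply: le_trans (cabs_sum _) _.
apply: (@le_trans _ _ (\sum_(M <= n < N) c * (eta * cabs (X n) ^+ 2 + kweight z n ^+ 2 / eta))).
  apply: ler_sum => n _; rewrite !cabsM cabs_real ger0_norm; last by rewrite ltW// kweight_gt0.
  rewrite mulrC; apply: ler_pM => //; rewrite ?mulr_ge0 ?cabs_ge0 ?(ltW (kweight_gt0 _ _))//.
  have := sqr_ge0 (eta * cabs (X n) - kweight z n / 2).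
  have s0 := sqr_ge0 (kweight z n).
  have h : eta * (eta * cabs (X n) ^+ 2 + kweight z n ^+ 2 / eta) = eta ^+ 2 * cabs (X n) ^+ 2 +
      kweight z n ^+ 2.
    by field; rewrite gt_eqF.
  by rewrite -(ler_pM2l eta0) h; lra.
rewrite -mulr_sumr ler_wpM2l// big_split/= lerD//.
  rewrite -mulr_sumr ler_pM2l//; apply: le_trans XE.
  rewrite -(@splitE _ (fun n => cabs (X n) ^+ 2)) lerBlDr lerDl.
  by apply: sumr_ge0 => n _; exact: sqr_ge0.
rewrite -mulr_suml ler_pM2r ?invr_gt0//.
rewrite -(@splitE _ (fun n => kweight z n ^+ 2)) lerD2r.
exact: sum_kweight_le.
Qed.

End model_space_expansion.

Section expansion.
Context {R : realType}.
Local Notation C := (R[i]^o).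

Lemma cvgC_Mr T (A : set_system T) {FA : Filter A} (F : T -> C) (l k : C) :
  F @ A --> l -> (fun t => F t * k : C) @ A --> (l * k : C).
Proof. by move=> cF; apply: (@cvgM R[i] _ A _ F (fun=> k) _ _ cF); exact: cvg_cst. Qed.

Lemma cvgC_D T (A : set_system T) {FA : Filter A} (F G : T -> C) (l k : C) :
  F @ A --> l -> G @ A --> k -> (fun t => F t + G t : C) @ A --> (l + k : C).
Proof. by move=> cF cG; exact: (cvgD cF cG). Qed.

Lemma cvgC_B T (A : set_system T) {FA : Filter A} (F G : T -> C) (l k : C) :
  F @ A --> l -> G @ A --> k -> (fun t => F t - G t : C) @ A --> (l - k : C).
Proof. by move=> cF cG; exact: (cvgB cF cG). Qed.

Variable z : nat -> C.
Hypothesis z_carleson : carleson_sequence z.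

Let zd := carleson_disc z_carleson.
Let zlt n : cabs (z n) < 1.
Proof. by have /andP[] := zd n. Qed.

Lemma cabs_szego_le (u w : C) : cabs u < 1 -> cabs w <= 1 ->
  cabs (szego u w) <= (1 - cabs u)^-1.
Proof.
move=> u1 w1; rewrite /szego cabsV.
have h : 1 - cabs u <= cabs (1 - conjc u * w).
  apply: le_trans (ler_cabs_sub _ _); rewrite cabs1 cabsM cabs_conj lerD2l lerN2.
  by rewrite ler_piMr ?cabs_ge0.
have u0 : 0 < 1 - cabs u by rewrite subr_gt0.
by rewrite lef_pV2// posrE// (lt_le_trans u0).
Qed.

Lemma cabs_szegoC (u w : C) : cabs (szego u w) = cabs (szego w u).
Proof. by rewrite /szego !cabsV cabs_denC. Qed.

(** The kernel is the test function to which orthogonality to B H2 is applied. *)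
Lemma H2_szego (w : C) : cabs w < 1 -> H2 (szego w).
Proof.
move=> w1; have hol : holomorphic_on_disc (szego w).
  move=> v v1; apply: derivable_szego; apply: le_lt_trans w1.
  by rewrite ler_piMr ?cabs_ge0// ltW.
split=> //; exists ((1 - cabs w)^-1 ^+ 2) => r r01.
have /andP[r0 r1] := r01.
rewrite circle_mean2E -[leRHS]ravg_cst; apply: le_ravg.
- exact: continuous_sqr (continuous_cabs (continuous_on_circle hol r01)).
- by move=> t; exact: cvg_cst.
move=> t; rewrite lerXn2r ?nnegrE ?cabs_ge0 ?invr_ge0 ?subr_ge0 ?(ltW w1)//.
by apply: cabs_szego_le => //; rewrite cabs_polar// ltW.
Qed.

(** An iterated limit: the threshold on N may depend on r, since convergence in N is known on each
    fixed circle only. *)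
Definition radius_then_degree : set_system (R * nat) :=
  [set P | \forall r \near 1^'-, \forall N \near \oo, P (r, N)].

Lemma radius_then_degree_proper : ProperFilter radius_then_degree.
Proof.
apply: Build_ProperFilter_ex.
  move=> P PF.
  have [r Pr] : exists r, \forall N \near \oo, P (r, N).
    exact: (@filter_ex _ (1 : R)^'- _ _ PF).
  have [N PN] : exists N, P (r, N) by exact: (@filter_ex _ \oo _ _ Pr).
  by exists (r, N).
split.
- by apply: nearW => r; apply: nearW.
- move=> P Q PF QF; apply: (@filterS2 _ (1 : R)^'- _ _ _ _ _ PF QF) => r Pr Qr.
  by apply: (@filterS2 _ \oo _ _ _ _ _ Pr Qr) => N; split.
- move=> P Q PQ PF; apply: (@filterS _ (1 : R)^'- _ _ _ _ PF) => r Pr.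
  by apply: (@filterS _ \oo _ _ _ _ Pr) => N; exact: PQ.
Qed.

Lemma model_space_expansion (f : C -> C) : model_space (blaschke_product z) f ->
  exists x : nat -> C,
    (forall N, \sum_(n < N) cabs (x n) ^+ 2 <= coef_const z * H2_norm f ^+ 2) /\
    forall w, cabs w < 1 ->
      (\sum_(n < N) x n * (kweight z n)%:C * szego (z n) w : C) @[N --> \oo] --> f w.
Proof.
move=> [hf orth]; have [df _] := hf.
pose E := coef_const z * H2_norm f ^+ 2.
have E0 : 0 <= E by rewrite mulr_ge0 ?sqr_ge0//; exact: coef_const_ge0.
(* One coefficient sequence per pair (r, N); the zero sequence is a default for r outside (0, 1). *)
have /choice[X HX] : forall p : R * nat, exists x : nat -> C, 0 < p.1 < 1 ->
  (forall w, cabs w < 1 -> f ((p.1 ^+ 2)%:C * w) = fblaschke z p.2 w *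
      circle_inner f (fun v => fblaschke z p.2 v * szego w v) p.1 +
    \sum_(n < p.2) x n * (kweight z n)%:C * szego (z n) w) /\
  \sum_(n < p.2) cabs (x n) ^+ 2 <= E.
  move=> [r N] /=; have [r01|nr01] := pselect (0 < r < 1); last by exists (fun=> 0).
  by have [x Hx] := dilate_expansion z_carleson N hf r01; exists x.
have FP := radius_then_degree_proper.
have [U [UU FU]] := ultraFilterLemma FP.
have FilU : Filter U by apply: filter_filter.
have Ur : U [set p | 0 < p.1 < 1].
  apply: FU; rewrite /radius_then_degree/=; near=> r; apply: nearW => N /=.
  by apply/andP; split; near: r; [exact: nbhs_left_gt|exact: nbhs_left_lt].
have UN M : U [set p | (M <= p.2)%N].
  apply: FU; apply: nearW => r; near=> N => /=; near: N; exact: nbhs_infty_ge.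
have bound n : U [set p | cabs (X p n) <= E + 1].
  have := UN n.+1; apply: filterS2 Ur => p /= /HX[_ hb] np.
  have : cabs (X p n) ^+ 2 <= E.
    apply: le_trans hb; rewrite (bigD1 (Ordinal np))//= lerDl.
    by apply: sumr_ge0 => k _; exact: sqr_ge0.
  have := sqr_ge0 (cabs (X p n) - 1 / 2); have := sqr_ge0 (cabs (X p n)); lra.
have /choice[x Hx] : forall n, exists l : C, (fun p => X p n) @ U --> l.
  by move=> n; exact: (@ultra_cvgC R _ U UU _ _ (bound n)).
have Xsum M : U [set p | \sum_(n < M) cabs (X p n) ^+ 2 <= E].
  apply: filterS2 Ur (UN M) => p /= /HX[_ hb] Mp; apply: le_trans hb.
  rewrite -!(big_mkord xpredT (fun n => cabs (X p n) ^+ 2)) (big_cat_nat (leq0n M) Mp)//= lerDl.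
  by apply: sumr_ge0 => k _; exact: sqr_ge0.
have cvgS (k : nat -> C) M : (fun p => \sum_(n < M) X p n * (kweight z n)%:C * k n : C) @ U -->
    (\sum_(n < M) x n * (kweight z n)%:C * k n : C).
  elim: M => [|M IH].
    rewrite big_ord0 (_ : (fun p => _) = fun=> 0); first exact: cvg_cst.
    by apply/funext => p; rewrite big_ord0.
  rewrite big_ord_recr/= (_ : (fun p => _) = fun p => (\sum_(n < M) X p n * (kweight z n)%:C * k n) +
    X p M * (kweight z M)%:C * k M); last by apply/funext => p; rewrite big_ord_recr.
  have c1 := @cvgC_Mr _ U FilU _ _ (k M) (@cvgC_Mr _ U FilU _ _ (kweight z M)%:C (Hx M)).
  exact: (@cvgC_D _ U FilU _ _ _ _ IH c1).
have cvgf (w : C) : cabs w < 1 ->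
   (fun p => \sum_(n < p.2) X p n * (kweight z n)%:C * szego (z n) w : C) @ U --> f w.
  move=> w1; apply/cvgC_cabs => e e0; have e30 : 0 < e / 3 by rewrite divr_gt0.
  have cr : (f ((r ^+ 2)%:C * w) : C) @[r --> 1^'-] --> f w.
    have cfw : {for w, continuous f} by apply/derivable_continuous/df.
    have cw : ((r ^+ 2)%:C * w : C) @[r --> 1^'-] --> w.
      rewrite -[X in _ --> X]mul1r; apply: (@cvgM R[i]); last exact: cvg_cst.
      apply: cvgC_ReIm => /=; last exact: cvg_cst.
      rewrite -[X in _ --> X](expr1n _ 2); apply: cvg_at_left_filter.
      by apply: cvgM; exact: cvg_id.
    exact: (cvg_comp _ _ cw cfw).
  have cr0 := orth _ (H2_szego w1).
  have h1 : \forall r \near (1 : R)^'-, cabs (f ((r ^+ 2)%:C * w) - f w) <= e / 3.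
    exact: (cvgC_cabs _ _).1 cr _ e30.
  have h2 : \forall r \near (1 : R)^'-,
      cabs (circle_inner f (fun v => blaschke_product z v * szego w v) r - 0) <= e / 3.
    exact: (cvgC_cabs _ _).1 cr0 _ e30.
  (* For fixed r, N is taken so large that B_N replaces B in the pairing up to e/3; the pairing with
     B is itself at most e/3 by orthogonality. *)
  have : U [set p : R * nat | cabs (f ((p.1 ^+ 2)%:C * w) - f w) <= e / 3 /\
      cabs (circle_inner f (fun v => fblaschke z p.2 v * szego w v) p.1) <= e / 3 + e / 3].
    apply: FU; have r0 : \forall r \near (1 : R)^'-, 0 < r < 1.
      near=> r; apply/andP; split; near: r; [exact: nbhs_left_gt|exact: nbhs_left_lt].
    apply: (@filterS3 _ (1 : R)^'- _ _ _ _ _ _ r0 h1 h2) => r r01 {}h1 {}h2.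
    have h3 : \forall N \near \oo, cabs (circle_inner f (fun v => fblaschke z N v * szego w v) r -
       circle_inner f (fun v => blaschke_product z v * szego w v) r) <= e / 3.
      exact: (cvgC_cabs _ _).1 (circle_inner_fblaschke_cvg z_carleson df r01 w1) _ e30.
    apply: (@filterS _ \oo _ _ _ _ h3) => N {}h3; split; first exact: h1.
    have := ler_cabsD (circle_inner f (fun v => fblaschke z N v * szego w v) r -
       circle_inner f (fun v => blaschke_product z v * szego w v) r)
       (circle_inner f (fun v => blaschke_product z v * szego w v) r).
    rewrite subrK => /le_trans; apply; apply: lerD; first exact: h3.
    by move: h2; rewrite subr0.
  apply: filterS2 Ur => p /= /HX[/(_ _ w1) hE _] [g1 g2].
  set S := \sum_(n < p.2) _ in hE *.
  have -> : S - f w = (f ((p.1 ^+ 2)%:C * w) - f w) - fblaschke z p.2 w *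
      circle_inner f (fun v => fblaschke z p.2 v * szego w v) p.1 by rewrite hE; ring.
  apply: le_trans (ler_cabsB _ _) _; rewrite cabsM.
  have b1 := fblaschke_disc zd p.2 w1.
  have b2 := ler_wpM2r (cabs_ge0 (circle_inner f (fun v => fblaschke z p.2 v * szego w v) p.1)) b1.
  rewrite mul1r in b2.
  by apply: (le_trans (lerD g1 (le_trans b2 g2))); lra.
exists x; split.
  move=> N; have c : (fun p => \sum_(n < N) cabs (X p n) ^+ 2) @ U --> \sum_(n < N) cabs (x n) ^+ 2.
    elim: (N) => [|M IH].
      rewrite big_ord0 (_ : (fun p => _) = fun=> 0); first exact: cvg_cst.
      by apply/funext => p; rewrite big_ord0.
    rewrite big_ord_recr/= (_ : (fun p => _) = fun p => (\sum_(n < M) cabs (X p n) ^+ 2) +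
      cabs (X p M) ^+ 2); last by apply/funext => p; rewrite big_ord_recr.
    have cM : (fun p => cabs (X p M)) @ U --> cabs (x M) by exact: (cvg_cabs (Hx M)).
    have cM2 : (fun p => cabs (X p M) ^+ 2) @ U --> cabs (x M) ^+ 2 by exact: (cvgM cM cM).
    exact: (cvgD IH cM2).
  apply: (cvgr_to_le c); exact: Xsum.
(* The sums of length p.2 and those of the limit coefficients are compared at a fixed length M;
   [tail_bound] is uniform in p and passes to the limit along U. *)
move=> w w1; apply/cvgC_cabs => e e0.
pose c := (1 - cabs w)^-1.
have c0 : 0 < c by rewrite invr_gt0 subr_gt0.
have kc n : cabs (szego (z n) w) <= c.
  by rewrite cabs_szegoC; apply: cabs_szego_le => //; exact: ltW.
have E10 : 0 < E + 1 by rewrite ltr_wpDl.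
(* Makes the coefficient part c eta E of [tail_bound] at most e/2, while [ct] makes the tail part at
   most e/2. E + 1 avoids a division by 0. *)
pose eta := e / (2 * c * (E + 1)).
have eta0 : 0 < eta by rewrite divr_gt0// !mulr_gt0.
have tl0 : 0 < eta * e / (2 * c) by rewrite divr_gt0// mulr_gt0.
have ct : \forall M \near \oo, kweight_total z - \sum_(n < M) kweight z n ^+ 2 < eta * e / (2 * c).
  have /cvgrPdist_lt/(_ _ tl0) : series (fun n => kweight z n ^+ 2) n @[n --> \oo] --> kweight_total z.
    exact: cvg_series_kweight.
  apply: filterS => M; rewrite /series/= big_mkord; apply: le_lt_trans; exact: ler_norm.
apply: filterS ct => M Mt; rewrite cabs_distC.
have cv : (fun p => cabs (\sum_(n < p.2) X p n * (kweight z n)%:C * szego (z n) w -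
   \sum_(n < M) X p n * (kweight z n)%:C * szego (z n) w)) @ U -->
   cabs (f w - \sum_(n < M) x n * (kweight z n)%:C * szego (z n) w).
  exact: (cvg_cabs (cvgC_B (cvgf w w1) (cvgS (fun n => szego (z n) w) M))).
apply: (cvgr_to_le cv); apply: filterS2 Ur (UN M) => p /= /HX[_ hb] Mp.
apply: le_trans (tail_bound z_carleson Mp eta0 kc hb) _.
have h1 : c * (eta * E) <= e / 2.
  have -> : c * (eta * E) = e / 2 * (E / (E + 1)) by rewrite /eta; field; rewrite !gt_eqF.
  rewrite ler_piMr ?divr_ge0 ?(ltW e0)// ler_pdivrMr// mul1r; lra.
have h2 : c * ((kweight_total z - \sum_(n < M) kweight z n ^+ 2) / eta) <= e / 2.
  have -> : e / 2 = c * ((eta * e / (2 * c)) / eta) by field; rewrite !gt_eqF.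
  by rewrite ler_pM2l// ler_pM2r ?invr_gt0// ltW.
by rewrite mulrDr; lra.
Unshelve. all: by end_near. Qed.

End expansion.

(** * The derivative of a kernel series *)

Section derivative.
Context {R : realType}.
Local Notation C := (R[i]^o).

Lemma szego_sub (u v w : C) : cabs u < 1 -> cabs v < 1 -> cabs w < 1 ->
  szego u v - szego u w = conjc u * (v - w) * szego u v * szego u w.
Proof.
move=> u1 v1 w1; rewrite /szego; field.
by rewrite !szego_den ?mulr_ilt1 ?cabs_ge0.
Qed.

(** A displacement of at most th (1 - |w|) changes |1 - conj(u) w| by at most the fraction th of
    itself, since 1 - |w| <= |1 - conj(u) w| for all u in the disc. *)
Lemma szego_perturb (u v w : C) (th : R) : cabs u < 1 -> cabs v < 1 -> cabs w < 1 ->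
  th < 1 -> cabs (v - w) <= th * (1 - cabs w) ->
  cabs (szego u v) <= cabs (szego u w) / (1 - th).
Proof.
move=> u1 v1 w1 th1 vw.
have d0 (y : C) : cabs y < 1 -> 0 < cabs (1 - conjc u * y).
  by move=> y1; rewrite cabs_gt0 szego_den ?mulr_ilt1 ?cabs_ge0.
rewrite /szego !cabsV -invfM lef_pV2 ?posrE ?mulr_gt0 ?d0 ?subr_gt0//.
have h1 : 1 - cabs w <= cabs (1 - conjc u * w).
  have := ler_cabs_sub 1 (conjc u * w); rewrite cabs1 cabsM cabs_conj => h.
  have := ler_piMl (cabs_ge0 w) (ltW u1); lra.
have h2 : cabs (1 - conjc u * w) - cabs (v - w) <= cabs (1 - conjc u * v).
  have -> : 1 - conjc u * w = (1 - conjc u * v) + conjc u * (v - w) by ring.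
  have := ler_cabsD (1 - conjc u * v) (conjc u * (v - w)); rewrite cabsM cabs_conj.
  have := ler_piMl (cabs_ge0 (v - w)) (ltW u1); lra.
have h0 := cabs_ge0 (v - w).
have th0 : 0 <= th.
  by rewrite -(pmulr_lge0 _ (_ : 0 < 1 - cabs w)) ?subr_gt0// (le_trans h0).
have := ler_wpM2l th0 h1; lra.
Qed.

(* Differentiating the expansion termwise is avoided: the difference quotients
   of the partial sums are bounded uniformly. *)
Lemma derivative_le (f : C -> C) (z c : nat -> C) (w : C) (Y : R) :
  (forall n, cabs (z n) < 1) -> cabs w < 1 -> derivable f w 1 ->
  (forall v, cabs v < 1 ->
    (\sum_(n < N) c n * szego (z n) v : C) @[N --> \oo] --> f v) ->
  (forall N, \sum_(n < N) cabs (c n) * cabs (szego (z n) w) ^+ 2 <= Y) ->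
  cabs (derive1 f w) <= Y.
Proof.
move=> z1 w1 df cf cY.
have Y0 : 0 <= Y by have := cY 0%N; rewrite big_ord0.
apply/ler_addgt0Pr => e e0.
have de0 : 0 < 1 - cabs w by rewrite subr_gt0.
have e20 : 0 < e / 2 by rewrite divr_gt0.
have [d d0 Hd] := derivable_eps df e20.
have Y1 : 0 < 4 * (Y + 1) by rewrite mulr_gt0// ltr_wpDl.
(* 1/2 keeps v in the disc and gives 1/(1 - th) <= 1 + 2 th; the second bound makes 2 th Y at most
   e/2. *)
pose th := Num.min (2^-1) (e / (4 * (Y + 1))).
have th0 : 0 < th by rewrite lt_min invr_gt0 ltr0n divr_gt0.
have th2 : th <= 2^-1 by rewrite ge_min lexx.
have the : th <= e / (4 * (Y + 1)) by rewrite ge_min lexx orbT.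
pose t := Num.min (d / 2) (th * (1 - cabs w)).
have t0 : 0 < t by rewrite lt_min divr_gt0// mulr_gt0.
have td : t < d by rewrite gt_min; apply/orP; left; lra.
have tth : t <= th * (1 - cabs w) by rewrite ge_min lexx orbT.
(* A real displacement suffices, the derivative being complex. *)
pose v : C := w + t%:C.
have vw : v - w = t%:C by rewrite /v addrC addKr.
have cvw : cabs (v - w) = t by rewrite vw cabs_real gtr0_norm.
have v1 : cabs v < 1.
  have := ler_cabsD w t%:C; rewrite cabs_real gtr0_norm// -/v.
  have : th * (1 - cabs w) <= 2^-1 * (1 - cabs w) by rewrite ler_pM2r.
  lra.
have th1 : 0 < 1 - th by lra.
have key : cabs (f v - f w) <= t * (Y / (1 - th)).
  have cv : (fun N => cabs (\sum_(n < N) c n * szego (z n) v - \sum_(n < N) c n * szego (z n) w))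
      @ \oo --> cabs (f v - f w) by exact: (cvg_cabs (cvgC_B (cf v v1) (cf w w1))).
  apply: (cvgr_to_le cv); apply: nearW => N /=.
  rewrite -sumrB.
  apply: (@le_trans _ _ (\sum_(n < N) t / (1 - th) * (cabs (c n) * cabs (szego (z n) w) ^+ 2))).
    elim/big_ind2 : _ => [|a b a' b' ha hb|n _]; first by rewrite cabs0.
      exact: le_trans (ler_cabsD _ _) (lerD ha hb).
    rewrite -mulrBr szego_sub// !cabsM cabs_conj cvw.
    have h := szego_perturb (z1 n) v1 w1 (_ : th < 1); rewrite cvw in h.
    have {}h : cabs (szego (z n) v) <= cabs (szego (z n) w) / (1 - th) by apply: h => //; lra.
    rewrite (_ : t / (1 - th) * _ = cabs (c n) * (1 * t * (cabs (szego (z n) w) / (1 - th)) *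
       cabs (szego (z n) w))); last by ring.
    rewrite ler_wpM2l ?cabs_ge0// ler_wpM2r ?cabs_ge0// ler_pM// ?mulr_ge0 ?cabs_ge0// ?(ltW t0)//.
    by rewrite ler_pM2r// ltW.
  rewrite -mulr_sumr mulrAC -mulrA ler_pM2l// ler_pM2r ?invr_gt0//.
have := Hd v; rewrite cvw => /(_ td).
set D := derive1 f w => hD.
have h1 : cabs D * t <= t * (Y / (1 - th)) + e / 2 * t.
  have -> : cabs D * t = cabs ((f v - f w) - (f v - f w - D * (v - w))).
    by rewrite opprB addrCA subrr addr0 cabsM cvw.
  exact: le_trans (ler_cabsB _ _) (lerD key hD).
have h2 : cabs D <= Y / (1 - th) + e / 2.
  by rewrite -(ler_pM2r t0); apply: le_trans h1 _; rewrite mulrDl mulrC.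
apply: le_trans h2 _.
have h3 : Y / (1 - th) <= Y * (1 + 2 * th).
  rewrite ler_wpM2l// -[leLHS]mul1r ler_pdivrMr//; nra.
have h4 : th * (4 * (Y + 1)) <= e by rewrite -ler_pdivlMr.
nra.
Qed.

End derivative.

(** * Integral estimates *)

Section nonneg_integral.
Local Open Scope ereal_scope.
Context d (T : measurableType d) (R : realType) (mu : {measure set T -> \bar R}).

Import HBNNSimple.

(* [ge0_le_integral] is not applicable to the double integral of |f'|^sigma: it
   would need the inner integral to be measurable in rho. *)
Lemma ge0_le_integral_patch (D E : set T) (f g : T -> \bar R) :
  (forall x, D x -> 0 <= f x) -> (forall x, E x -> 0 <= g x) ->
  (forall x, D x -> E x /\ f x <= g x) ->
  \int[mu]_(x in D) f x <= \int[mu]_(x in E) g x.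
Proof.
move=> f0 g0 fg; rewrite !ge0_integralE//.
apply: ge_ereal_sup => _ [h hf <-]; apply: ereal_sup_ubound; exists h => //= x.
apply: le_trans (hf x) _; rewrite /patch; case: ifPn => xD.
  by move: xD; rewrite inE => /fg[Ex fgx]; rewrite mem_set.
by case: ifPn => //; rewrite inE; exact: g0.
Qed.

End nonneg_integral.

Section power_integrals.
Context {R : realType}.
Local Notation mu := (@lebesgue_measure R).
Implicit Types a b k s e q t : R.

Lemma itg_EFin a b (f : R -> R) : cont_on a b f ->
  (\int[mu]_(t in `[a, b]) (f t)%:E = (itg a b f)%:E)%E.
Proof.
move=> cf; rewrite /itg /Rintegral fineK//.
exact: integrable_fin_num (cont_on_integrable cf).
Qed.

Lemma continuous_affine k s t : {for t, continuous (fun x : R => k + s * x)}.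
Proof.
apply: continuousD; first exact: cst_continuous.
by apply: continuousM; [exact: cst_continuous|exact: cvg_id].
Qed.

Lemma continuous_powR e t (f : R -> R) : {for t, continuous f} -> 0 < f t ->
  {for t, continuous (fun x => f x `^ e)}.
Proof.
move=> cf ft.
apply: (@continuous_comp _ _ _ f (@powR R ^~ e)) => //.
apply: differentiable_continuous; apply/derivable1_diffP.
by apply: derivable_powR; rewrite in_itv/= andbT.
Qed.

Lemma is_derive_powR_affine k s e t : 0 < k + s * t ->
  is_derive t (1 : R) (fun x : R => (k + s * x) `^ e) (s * (e * (k + s * t) `^ (e - 1))).
Proof.
move=> h.
have d1 : is_derive t (1 : R) (fun x : R => k + s * x) s.
  have := is_deriveD (is_derive_cst k t (1 : R)) (is_deriveZ s (is_derive_id t (1 : R))).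
  by rewrite add0r /GRing.scale/= mulr1.
have d2 := is_derive1_powR e h.
by have := @is_derive1_comp _ (@powR R ^~ e) (fun x => k + s * x) _ _ _ d2 d1; rewrite mulrC.
Qed.

Lemma itg_powR a b k s e : a < b -> s != 0 -> e != - 1 ->
  0 < k + s * a -> 0 < k + s * b ->
  itg a b (fun t => (k + s * t) `^ e) =
  ((k + s * b) `^ (e + 1) - (k + s * a) `^ (e + 1)) / (s * (e + 1)).
Proof.
move=> ab s0 e1 ka kb.
have pos t : a <= t <= b -> 0 < k + s * t.
  move=> /andP[at_ tb].
  case: (leP 0 s) => hs.
    by apply: lt_le_trans ka _; rewrite lerD2l ler_wpM2l.
  by apply: lt_le_trans kb _; rewrite lerD2l ler_wnM2l// ltW.
have e10 : e + 1 != 0 by apply: contra e1 => /eqP h; rewrite -subr_eq0 opprK h.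
pose F t := (s * (e + 1))^-1 * (k + s * t) `^ (e + 1).
have dF t : a <= t <= b -> is_derive t (1 : R) F ((k + s * t) `^ e).
  move=> /pos h; have H := is_deriveZ (s * (e + 1))^-1 (is_derive_powR_affine (e + 1) h).
  apply: (is_derive_eq H); rewrite addrK /GRing.scale/=.
  by field; rewrite e10.
have cF t : a <= t <= b -> {for t, continuous F}.
  move=> h; apply: differentiable_continuous; apply/derivable1_diffP.
  by have [] := dF t h.
have cf : cont_on a b (fun t => (k + s * t) `^ e).
  by move=> t h; apply: continuous_powR; [exact: continuous_affine|exact: pos].
have := @continuous_FTC2 R (fun t => (k + s * t) `^ e) F a b ab.
rewrite itg_EFin// => H.
have : (itg a b (fun t => (k + s * t) `^ e))%:E = ((F b)%:E - (F a)%:E)%E.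
  apply: H.
  - by apply: continuous_in_subspaceT => x; rewrite inE/= in_itv/=; exact: cf.
  - split.
    + move=> x; rewrite in_itv/= => /andP[ax xb].
      by have [] := dF x; rewrite ?(ltW ax) ?(ltW xb).
    + by apply: cvg_at_right_filter; apply: cF; rewrite lexx ltW.
    + by apply: cvg_at_left_filter; apply: cF; rewrite lexx ltW.
  - move=> x; rewrite in_itv/= => /andP[ax xb]; rewrite derive1E.
    have xab : a <= x <= b by rewrite !ltW.
    by have [_ ->] := dF x xab.
by rewrite -EFinB => -[->]; rewrite /F -mulrBr mulrC.
Qed.

Lemma itg_point a (f : R -> R) : itg a a f = 0.
Proof. by rewrite /itg set_itv1 Rintegral_set1. Qed.

Lemma le_powR_npos e s t : e <= 0 -> 0 < s -> s <= t -> t `^ e <= s `^ e.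
Proof.
move=> e0 s0 st; have t0 := lt_le_trans s0 st.
rewrite -(opprK e) !(powRN _ (- e)) lef_pV2 ?posrE ?powR_gt0//.
by apply: ge0_ler_powR => //; rewrite ?nnegrE ?oppr_ge0// ltW.
Qed.

Lemma cont_on_powR_shift a b eta tau e : 0 < eta ->
  cont_on a b (fun t => (eta + `|t - tau|) `^ e).
Proof.
move=> eta0 t _; apply: continuous_powR; last by rewrite ltr_wpDr.
apply: continuousD; first exact: cst_continuous.
apply: (@continuous_comp _ _ _ (fun t : R => t - tau) Num.norm).
  by apply: continuousB; [exact: cvg_id|exact: cst_continuous].
exact: norm_continuous.
Qed.

Lemma itg_powR_shift_right a b tau eta q : tau <= a -> a <= b -> 0 < eta -> 1 < q ->
  itg a b (fun t => (eta + `|t - tau|) `^ (- q)) <= eta `^ (1 - q) / (q - 1).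
Proof.
move=> ta; rewrite le_eqVlt => /predU1P[->|ab] eta0 q1.
  by rewrite itg_point divr_ge0 ?powR_ge0// subr_ge0 ltW.
have -> : itg a b (fun t => (eta + `|t - tau|) `^ (- q)) =
    itg a b (fun t => (eta - tau + 1 * t) `^ (- q)).
  by apply: eq_itg => t /andP[at_ _]; rewrite ger0_norm; [congr powR; ring|lra].
rewrite itg_powR ?oner_eq0//; [|by rewrite eqr_opp gt_eqF|lra|lra].
rewrite !mul1r [- q + 1]addrC (_ : 1 - q = - (q - 1)); last by ring.
rewrite invrN mulrN -mulNr opprB.
rewrite ler_pM2r ?invr_gt0 ?subr_gt0//.
have h : (eta - tau + a) `^ (- (q - 1)) <= eta `^ (- (q - 1)).
  by apply: le_powR_npos => //; lra.
have := powR_ge0 (eta - tau + b) (- (q - 1)); lra.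
Qed.

Lemma itg_powR_shift_left a b tau eta q : b <= tau -> a <= b -> 0 < eta -> 1 < q ->
  itg a b (fun t => (eta + `|t - tau|) `^ (- q)) <= eta `^ (1 - q) / (q - 1).
Proof.
move=> bt; rewrite le_eqVlt => /predU1P[->|ab] eta0 q1.
  by rewrite itg_point divr_ge0 ?powR_ge0// subr_ge0 ltW.
have -> : itg a b (fun t => (eta + `|t - tau|) `^ (- q)) =
    itg a b (fun t => (eta + tau + (-1) * t) `^ (- q)).
  by apply: eq_itg => t /andP[_ tb]; rewrite ler0_norm; [congr powR; ring|lra].
rewrite itg_powR ?oppr_eq0 ?oner_eq0//; [|by rewrite eqr_opp gt_eqF|lra|lra].
rewrite (_ : -1 * (- q + 1) = q - 1); last by ring.
rewrite [- q + 1]addrC (_ : 1 - q = - (q - 1)); last by ring.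
rewrite ler_pM2r ?invr_gt0 ?subr_gt0//.
have h : (eta + tau + -1 * b) `^ (- (q - 1)) <= eta `^ (- (q - 1)).
  by apply: le_powR_npos => //; lra.
have := powR_ge0 (eta + tau + -1 * a) (- (q - 1)); lra.
Qed.

(** There is at most one branch on each side of the peak tau, each contributing at most eta^(1 - q)
    / (q - 1); tau may lie outside [a, b]. *)
Lemma itg_powR_shift a b tau eta q : a <= b -> 0 < eta -> 1 < q ->
  itg a b (fun t => (eta + `|t - tau|) `^ (- q)) <= 2 * eta `^ (1 - q) / (q - 1).
Proof.
move=> ab eta0 q1.
have K0 : 0 <= eta `^ (1 - q) / (q - 1).
  by rewrite divr_ge0 ?powR_ge0// subr_ge0 ltW.
rewrite -mulrA; case: (leP tau a) => ta.
  by have := itg_powR_shift_right ta ab eta0 q1; lra.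
case: (leP b tau) => bt.
  by have := itg_powR_shift_left bt ab eta0 q1; lra.
rewrite (@itg_split _ a b tau); last exact: cont_on_powR_shift.
  have := itg_powR_shift_left (lexx tau) (ltW ta) eta0 q1.
  by have := itg_powR_shift_right (lexx tau) (ltW bt) eta0 q1; lra.
by rewrite !ltW.
Qed.

End power_integrals.

(** * Integration of a kernel over the angle *)

Section angular.
Context {R : realType}.
Local Notation C := (R[i]^o).

(** 1 - cos d = 2 sin(d/2)^2, and sin y >= c y on [0, 1/2] by the mean value theorem, with c =
    cos(1/2). This covers d <= 1; beyond, cos is decreasing and d^2 <= pi^2, whence the division by
    pi^2. *)
Lemma cos_quadratic : exists2 k : R, 0 < k <= 1 &
  forall d : R, 0 <= d <= pi -> k * d ^+ 2 <= 1 - cos d.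
Proof.
have pi2 := @pi_ge2 R; have pi0 := @pi_gt0 R.
pose c : R := cos 2^-1.
have c0 : 0 < c by apply: cos_gt0_pihalf; apply/andP; split; lra.
have c1 : c <= 1 by exact: cos_le1.
have sin_lb y : 0 <= y <= 2^-1 -> c * y <= sin y.
  move=> /andP[y0 y2].
  have dsin x : x \in `]0, y[%R -> is_derive x (1 : R) sin (cos x) by move=> _; exact: is_derive_sin.
  have [|x] := @MVT_segment R sin cos 0 y y0 dsin.
    exact/continuous_subspaceT/continuous_sin.
  rewrite in_itv/= sin0 !subr0 => /andP[x0 xy] ->; rewrite ler_wpM2r// /c leNgt ltr_cos.
  - by rewrite -leNgt; lra.
  - by rewrite in_itv/=; apply/andP; split; lra.
  - by rewrite in_itv/=; apply/andP; split; lra.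
have sin2 d : 1 - cos d = 2 * sin (d / 2) ^+ 2.
  have E : d = (d / 2) *+ 2 by rewrite mulr2n -splitr.
  by rewrite {1}E cos_mulr2n cos2sin2; ring.
have b1 d : 0 <= d <= 1 -> c ^+ 2 / 2 * d ^+ 2 <= 1 - cos d.
  move=> /andP[d0 d1]; rewrite sin2.
  have h : c * (d / 2) <= sin (d / 2) by apply: sin_lb; apply/andP; split; lra.
  have h0 : 0 <= c * (d / 2) by rewrite mulr_ge0 ?(ltW c0)//; lra.
  have := lerXn2r 2 h0 (le_trans h0 h) h; rewrite exprMn => h2; lra.
exists (c ^+ 2 / 2 / pi ^+ 2).
  rewrite !divr_gt0 ?exprn_gt0//= ler_pdivrMr ?exprn_gt0// mul1r.
  have := exprn_ile1 2 (ltW c0) c1; have : 4 <= pi ^+ 2 :> R by nra.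
  lra.
move=> d /andP[d0 dpi]; case: (leP d 1) => d1.
  apply: le_trans (b1 d _); last by rewrite d0.
  rewrite ler_wpM2r ?sqr_ge0// ler_pdivrMr ?exprn_gt0// ler_peMr//.
    by rewrite divr_ge0// sqr_ge0.
  nra.
have h1 : cos d <= cos 1.
  rewrite leNgt ltr_cos ?in_itv/= ?d0 ?dpi//; last by apply/andP; split; lra.
  by rewrite -leNgt ltW.
have := b1 1; rewrite expr1n mulr1 ler01 lexx => /(_ isT) h2.
apply: (@le_trans _ _ (c ^+ 2 / 2)); last lra.
rewrite -mulrA ler_piMr ?divr_ge0 ?sqr_ge0// mulrC ler_pdivrMr ?exprn_gt0//.
rewrite mul1r; nra.
Qed.

(** The arguments of the zeros are arbitrary reals; the angular estimate works with them in
    [0, 2 pi]. *)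
Lemma polar_reduce (b : R) : exists2 b', 0 <= b' <= 2 * pi &
  forall s : R, polar s b = polar s b' :> C.
Proof.
have p0 : 0 < 2 * pi :> R by rewrite mulr_gt0// pi_gt0.
have pern n s x : polar s (x + n%:R * (2 * pi)) = polar s x :> C.
  elim: n => [|n IH]; first by rewrite mul0r addr0.
  by rewrite -IH -[RHS]polar_per; congr polar; rewrite -natr1; ring.
have posc (x : R) : 0 <= x -> exists2 n : nat, n%:R * (2 * pi) <= x & x <= n%:R * (2 * pi) + 2 * pi.
  move=> x0; have h := truncn_itv (divr_ge0 x0 (ltW p0)).
  exists (Num.truncn (x / (2 * pi))).
    by rewrite -ler_pdivlMr//; case/andP: h.
  have /andP[_ /ltW] := h; rewrite ler_pdivrMr// -natr1; lra.
case: (leP 0 b) => b0.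
  have [n h1 h2] := posc b b0; exists (b - n%:R * (2 * pi)).
    by apply/andP; split; lra.
  by move=> s; rewrite -[RHS](pern n) subrK.
have [|n h1 h2] := posc (- b); first lra.
exists (b + n.+1%:R * (2 * pi)); last by move=> s; rewrite pern.
by rewrite -natr1; apply/andP; split; lra.
Qed.

(** The square of the modulus is (1 - a)^2 + 2 a (1 - cos d) with a = s rho; d stands for the
    distance of t and b modulo 2 pi. *)
Lemma cabs_polar_den : exists2 c : R, 0 < c & forall s rho b t d : R,
  0 <= s * rho <= 1 -> 0 <= d <= pi -> cos d = cos (t - b) ->
  c * ((1 - s * rho) + d) <= cabs (1 - conjc (polar s b) * polar rho t : C).
Proof.
have [k /andP[k0 k1] Hk] := cos_quadratic.
exists (Num.sqrt (k / 32)); first by rewrite sqrtr_gt0 divr_gt0.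
move=> s rho b t d /andP[a0 a1] d0pi cd.
set a := s * rho in a0 a1 *.
have dh := Hk d d0pi; have [d0 dpi] := andP d0pi.
rewrite -(ler_pXn2r (_ : (0 < 2)%N))// ?nnegrE ?cabs_ge0//; last first.
  by rewrite mulr_ge0 ?sqrtr_ge0// addr_ge0// subr_ge0.
rewrite exprMn sqr_sqrtr ?divr_ge0 ?(ltW k0)//.
have -> : cabs (1 - conjc (polar s b) * polar rho t : C) ^+ 2 =
   (1 - a) ^+ 2 + 2 * a * (1 - cos d).
  rewrite sqr_cabs !polarE cd cosB /= /a.
  have := cos2Dsin2 t; have := cos2Dsin2 b.
  move: (cos t) (sin t) (cos b) (sin b) => x y u v h1 h2.
  transitivity (1 - 2 * (s * rho) * (x * u + y * v) +
     s ^+ 2 * rho ^+ 2 * ((u ^+ 2 + v ^+ 2) * (x ^+ 2 + y ^+ 2))); first by ring.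
  by rewrite h1 h2; ring.
have X2 := cos_geN1 d; set X := 1 - cos d in dh *.
have X0 : 0 <= X by rewrite subr_ge0 cos_le1.
(* For a <= 1/2 the term (1 - a)^2 >= 1/4 absorbs X <= 2; otherwise 2 a X >= X. *)
have h1 : (1 - a) ^+ 2 / 2 + X / 16 <= (1 - a) ^+ 2 + 2 * a * X.
  have X2' : X <= 2 by rewrite /X; lra.
  case: (leP a 2^-1) => a2; nra.
apply: le_trans h1.
set e := 1 - a; have e0 : 0 <= e by rewrite subr_ge0.
have h2 : k * (e ^+ 2 + d ^+ 2) <= e ^+ 2 + X.
  by rewrite mulrDr lerD// ler_piMl// sqr_ge0.
have h3 : (e + d) ^+ 2 <= 2 * (e ^+ 2 + d ^+ 2).
  by have := sqr_ge0 (e - d); lra.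
have := ler_wpM2l (ltW k0) h3; have := sqr_ge0 e; lra.
Qed.

Lemma continuous_szego_polar (u : C) rho : cabs u < 1 -> 0 <= rho < 1 ->
  continuous (fun t : R => szego u (polar rho t) : C).
Proof.
move=> u1 /andP[r0 r1] t.
have cp : (polar rho x : C) @[x --> t] --> (polar rho t : C).
  by apply: polar_cvg; [exact: cvg_cst|exact: cvg_id].
have cs : {for (polar rho t : C), continuous (szego u : C -> C)}.
  apply: derivable_continuous; apply: derivable_szego.
  by rewrite cabs_polar// mulr_ilt1// cabs_ge0.
exact: (@continuous_comp _ _ _ (fun x : R => polar rho x : C) (szego u) t cp cs).
Qed.

Lemma cont_on_szego_powR (u : C) rho q a b : cabs u < 1 -> 0 <= rho < 1 ->
  cont_on a b (fun t => cabs (szego u (polar rho t)) `^ q).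
Proof.
move=> u1 rho1 t _.
have /andP[r0 r1] := rho1.
apply: (@continuous_powR _ q t (fun t => cabs (szego u (polar rho t)))).
  have ct : (fun x => szego u (polar rho x) : C) @ t --> (szego u (polar rho t) : C).
    exact: continuous_szego_polar.
  exact: (cvg_cabs ct).
rewrite /szego cabsV invr_gt0 cabs_gt0 szego_den// cabs_polar//.
by rewrite mulr_ilt1// cabs_ge0.
Qed.

(** For t and b in [0, 2 pi] the angular distance is |t - b|, |t - b - 2 pi| or |t - b + 2 pi|, so
    three shifted bumps dominate the integrand. Each has integral at most 2 e^(1 - q) / (q - 1) with
    e = 1 - s rho, whence the 6. *)
Lemma angular_estimate q : 1 < q -> exists2 K : R, 0 < K & forall s rho b : R,
  0 <= s < 1 -> 0 <= rho < 1 ->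
  itg 0 (2 * pi) (fun t => cabs (szego (polar s b) (polar rho t) : C) `^ q) <=
  K * (1 - s * rho) `^ (1 - q).
Proof.
move=> q1; have [c c0 Hc] := cabs_polar_den.
have p0 := @pi_gt0 R.
pose M := c `^ (- q); have M0 : 0 < M by rewrite powR_gt0.
exists (M * (6 / (q - 1))); first by rewrite mulr_gt0// divr_gt0// subr_gt0.
move=> s rho b0 /andP[s0 s1] /andP[r0 r1].
have [b /andP[b_0 b2] Eb] := polar_reduce b0; rewrite Eb => {b0 Eb}.
have a1 : s * rho < 1 by rewrite mulr_ilt1.
have a0 : 0 <= s * rho by rewrite mulr_ge0.
pose e := 1 - s * rho; have e0 : 0 < e by rewrite subr_gt0.
pose F (tau t : R) := (e + `|t - tau|) `^ (- q).
have F0 tau t : 0 <= F tau t by exact: powR_ge0.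
have cF tau : cont_on 0 (2 * pi) (F tau) by exact: cont_on_powR_shift.
have dom t d : 0 <= d <= pi -> cos d = cos (t - b) ->
    cabs (szego (polar s b) (polar rho t) : C) `^ q <= M * (e + d) `^ (- q).
  move=> dpi cd.
  have ed0 : 0 < e + d by case/andP: dpi => d0 _; rewrite ltr_wpDr.
  have h := Hc s rho b t d _ dpi cd.
  rewrite /M -powRM ?(ltW c0) ?(ltW ed0)//.
  rewrite /szego cabsV -powR_inv1 ?cabs_ge0// -powRrM mulN1r.
  apply: le_powR_npos; [by rewrite oppr_le0; lra|by rewrite mulr_gt0|].
  by apply: h; rewrite a0 ltW.
apply: (@le_trans _ _ (itg 0 (2 * pi) (fun t => M * (F b t + F (b - 2 * pi) t + F (b + 2 * pi) t)))).
  have cFF : cont_on 0 (2 * pi) (fun t => F b t + F (b - 2 * pi) t + F (b + 2 * pi) t).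
    by apply: cont_onD => //; exact: cont_onD.
  apply: le_itg.
  - by apply: cont_on_szego_powR; rewrite ?cabs_polar// r0.
  - by apply: cont_onM => //; exact: cont_on_cst.
  move=> t /andP[t0 t2].
  have [hb hb1 hb2] := And3 (F0 b t) (F0 (b - 2 * pi) t) (F0 (b + 2 * pi) t).
  have addM x y : x <= y -> M * x <= M * y by move=> ?; rewrite ler_pM2l.
  case: (leP `|t - b| pi) => tb.
    apply: le_trans (dom t `|t - b| _ _) _; rewrite ?normr_ge0 ?cos_norm//.
    by apply: addM; rewrite -/(F b t); lra.
  case: (leP b t) => bt.
    rewrite ger0_norm ?subr_ge0// in tb.
    apply: le_trans (dom t `|t - (b + 2 * pi)| _ _) _.
    - by rewrite normr_ge0 ler0_norm; lra.
    - rewrite cos_norm (_ : t - (b + 2 * pi) = t - b - pi - pi); last by ring.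
      by rewrite (cosB _ pi) (cosB (t - b) pi) (sinB _ pi) cospi sinpi; ring.
    - by apply: addM; rewrite -/(F (b + 2 * pi) t); lra.
  rewrite ltr0_norm ?subr_lt0// in tb.
  apply: le_trans (dom t `|t - (b - 2 * pi)| _ _) _.
  - by rewrite normr_ge0 ger0_norm; lra.
  - rewrite cos_norm (_ : t - (b - 2 * pi) = t - b + pi + pi); last by ring.
    by rewrite (cosD _ pi) (cosD (t - b) pi) (sinD _ pi) cospi sinpi; ring.
  - by apply: addM; rewrite -/(F (b - 2 * pi) t); lra.
rewrite itgZ; last by apply: cont_onD => //; exact: cont_onD.
rewrite !itgD//; last exact: cont_onD.
rewrite -mulrA ler_pM2l//.
have p20 : 0 <= 2 * pi :> R by lra.
have h1 := itg_powR_shift b p20 e0 q1.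
have h2 := itg_powR_shift (b - 2 * pi) p20 e0 q1.
have h3 := itg_powR_shift (b + 2 * pi) p20 e0 q1.
clear -h1 h2 h3; rewrite /F; lra.
Qed.

End angular.

(** * Integration over the radius *)

Section radial.
Context {R : realType}.
Local Notation mu := (@lebesgue_measure R).

(** The segments [0, c_n] with c_n = 1 - (1 - b)/(n + 1) exhaust (0, 1), and monotone convergence
    applies although f may be singular at 1. The bound is asked for c >= b only, so that estimates
    may split the segment at b. *)
Lemma integral_oo_le (b K : R) (f : R -> R) : 0 <= b < 1 ->
  (forall c, b <= c < 1 -> cont_on 0 c f) ->
  (forall x, 0 <= x < 1 -> 0 <= f x) ->
  (forall c, b <= c < 1 -> itg 0 c f <= K) ->
  (\int[mu]_(x in `]0%R, 1%R[) (f x)%:E <= K%:E)%E.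
Proof.
move=> /andP[b0 b1] cf f0 fK.
pose c n : R := 1 - (1 - b) / n.+1%:R.
have cb n : b <= c n < 1.
  have n0 : 0 < n.+1%:R :> R by rewrite ltr0n.
  have h1 : 0 < (1 - b) / n.+1%:R by rewrite divr_gt0// subr_gt0.
  have h2 : (1 - b) / n.+1%:R <= 1 - b.
    by rewrite ler_pdivrMr// ler_peMr ?subr_ge0 ?(ltW b1)// ler1n.
  by move: h1 h2; rewrite /c; move: (_ / _) => y h1 h2; apply/andP; split; lra.
pose F n : set R := `[0, c n]%classic.
have cvF : (\int[mu]_(x in F n) (f x)%:E @[n --> \oo] -->
    \int[mu]_(x in \bigcup_n F n) (f x)%:E)%E.
  apply: ge0_nondecreasing_set_cvg_integral.
  - move=> m n mn; apply/subsetPset => x; rewrite /F/= !in_itv/= => /andP[-> xm] /=.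
    apply: le_trans xm _; rewrite /c lerD2l lerN2 ler_pM2l ?subr_gt0//.
    by rewrite lef_pV2 ?posrE ?ltr0n// ler_nat.
  - by move=> n; exact: measurable_itv.
  - move=> n; have := cont_on_integrable (cf _ (cb n)).
    by move=> /integrableP[].
  - move=> n x; rewrite /F/= in_itv/= => /andP[x0 xc]; rewrite lee_fin f0// x0/=.
    by apply: le_lt_trans xc _; case/andP: (cb n).
apply: (@le_trans _ _ (\int[mu]_(x in \bigcup_n F n) (f x)%:E)%E).
  apply: ge0_le_integral_patch.
  - by move=> x /=; rewrite in_itv/= => /andP[x0 x1]; rewrite lee_fin f0// x1 ltW.
  - move=> x [n _]; rewrite /F/= in_itv/= => /andP[x0 xc]; rewrite lee_fin f0// x0/=.
    by apply: le_lt_trans xc _; case/andP: (cb n).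
  - move=> x /=; rewrite in_itv/= => /andP[x0 x1]; split => //.
    pose n := Num.truncn ((1 - b) / (1 - x)); exists n => //.
    rewrite /F/= in_itv/= (ltW x0)/= /c lerBrDl -lerBrDr ler_pdivrMr ?ltr0n//.
    rewrite mulrC -ler_pdivrMr ?subr_gt0//.
    have /truncn_itv/andP[_ /ltW//] : 0 <= (1 - b) / (1 - x).
    by rewrite divr_ge0// subr_ge0 ltW.
rewrite -(cvg_lim _ cvF)//; apply: lime_le; first by apply/cvg_ex; eexists; exact: cvF.
by apply: nearW => n; rewrite itg_EFin ?lee_fin; [exact: fK|exact: cf].
Qed.

(** Split at x = b. Below, 1 - b x >= 1 - x leaves the integral of (1 - x)^(gam + 1 - q); above, 1 -
    b x >= 1 - b leaves that of (1 - x)^gam. They give the two terms of the constant. *)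
Lemma radial_estimate (q gam : R) : 1 < q -> -1 < gam -> gam + 2 - q < 0 ->
  exists2 K : R, 0 < K & forall b : R, 0 <= b < 1 ->
  (\int[mu]_(x in `]0%R, 1%R[) ((1 - b * x) `^ (1 - q) * (1 - x) `^ gam)%:E <=
  (K * (1 - b) `^ (gam + 2 - q))%:E)%E.
Proof.
move=> q1 g1 gq.
exists ((q - 2 - gam)^-1 + (gam + 1)^-1); first by rewrite addr_gt0// invr_gt0; lra.
move=> b /andP[b0 b1].
have pos (x : R) : 0 <= x < 1 -> 0 < 1 - b * x /\ 0 < 1 - x.
  by move=> /andP[x0 x1]; split; rewrite subr_gt0// mulr_ilt1.
have cb (x : R) : 0 <= x < 1 -> {for x, continuous (fun x : R => (1 - b * x) `^ (1 - q))}.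
  move=> /pos[h _]; apply: continuous_powR => //.
  rewrite (_ : (fun x : R => 1 - b * x) = fun x => 1 + - b * x); first exact: continuous_affine.
  by apply/funext => y; rewrite mulNr.
have c1 (e x : R) : 0 <= x < 1 -> {for x, continuous (fun x : R => (1 + -1 * x) `^ e)}.
  move=> /pos[_ h]; apply: continuous_powR; first exact: continuous_affine.
  by rewrite mulN1r.
have cf (c : R) : c < 1 -> cont_on 0 c (fun x => (1 - b * x) `^ (1 - q) * (1 - x) `^ gam).
  move=> c1' x /andP[x0 xc].
  rewrite (_ : (fun x => _) = fun x : R => (1 - b * x) `^ (1 - q) * (1 + -1 * x) `^ gam); last first.
    by apply/funext => y; rewrite mulN1r.
  by apply: continuousM; [apply: cb|apply: c1]; rewrite x0 (le_lt_trans xc).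
apply: (@integral_oo_le b); rewrite ?b0//.
- by move=> c /andP[_]; exact: cf.
- by move=> x _; rewrite mulr_ge0 ?powR_ge0.
move=> c /andP[bc c_1].
rewrite (@itg_split _ 0 c b) ?b0 ?bc//; last exact: cf.
rewrite mulrDl; apply: lerD.
  move: b0; rewrite le_eqVlt => /predU1P[<-|b0].
    by rewrite itg_point mulr_ge0 ?powR_ge0// invr_ge0; lra.
  apply: (@le_trans _ _ (itg 0 b (fun x => (1 + -1 * x) `^ (gam + 1 - q)))).
    apply: le_itg.
    - by apply: (@cont_onS _ 0 c) => //; exact: cf.
    - move=> x /andP[x0 xb]; by apply: c1; rewrite x0 (le_lt_trans xb).
    - move=> x /andP[x0 xb]; have x1 := le_lt_trans xb b1.
      have [h1 h2] : 0 < 1 - b * x /\ 0 < 1 - x by apply: pos; rewrite x0.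
      rewrite mulN1r (_ : gam + 1 - q = (1 - q) + gam); last by ring.
      rewrite (@powRD _ (1 - x) (1 - q)); last by rewrite (gt_eqF h2) implybT.
      rewrite ler_wpM2r ?powR_ge0// le_powR_npos//; first lra.
      by rewrite lerD2l lerN2 ler_piMl// ltW.
  rewrite itg_powR//; [|by rewrite lt_eqF//; lra|lra].
  rewrite (_ : gam + 1 - q + 1 = gam + 2 - q); last by ring.
  rewrite mulr0 addr0 powR1 !mulN1r.
  rewrite (_ : - (gam + 2 - q) = q - 2 - gam); last by ring.
  by rewrite mulrC ler_pM2l ?invr_gt0; lra.
move: bc; rewrite le_eqVlt => /predU1P[<-|bc].
  by rewrite itg_point mulr_ge0 ?powR_ge0// invr_ge0; lra.
have cg : cont_on b c (fun x => (1 + -1 * x) `^ gam).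
  move=> x /andP[xb xc].
  by apply: c1; rewrite (le_trans b0)//= (le_lt_trans xc).
apply: (@le_trans _ _ (itg b c (fun x => (1 - b) `^ (1 - q) * (1 + -1 * x) `^ gam))).
  apply: le_itg.
  - by apply: (@cont_onS _ 0 c) => //; exact: cf.
  - by apply: cont_onM => //; exact: cont_on_cst.
  - move=> x /andP[xb xc]; rewrite mulN1r ler_wpM2r ?powR_ge0// le_powR_npos//.
    + lra.
    + by rewrite subr_gt0.
    + by rewrite lerD2l lerN2 ler_piMr// (le_trans xc)// ltW.
rewrite itgZ// itg_powR//; [|by rewrite gt_eqF//; lra|lra|lra].
rewrite !mulN1r.
have -> : ((1 - c) `^ (gam + 1) - (1 - b) `^ (gam + 1)) / - (gam + 1) =
   (gam + 1)^-1 * ((1 - b) `^ (gam + 1) - (1 - c) `^ (gam + 1)).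
  by rewrite invrN mulrN -mulNr opprB mulrC.
rewrite mulrCA ler_pM2l ?invr_gt0; last lra.
rewrite (_ : gam + 2 - q = (1 - q) + (gam + 1)); last by ring.
have b10 : 1 - b != 0 by rewrite gt_eqF// subr_gt0.
rewrite (@powRD _ (1 - b) (1 - q)); last by rewrite b10 implybT.
by rewrite ler_wpM2l ?powR_ge0// lerBlDr lerDl powR_ge0.
Qed.

End radial.

(** * Inequalities for sums of powers *)

Section power_sums.
Context {R : realType}.
Local Notation C := (R[i]^o).

(** From v <= v^s on [0, 1], applied to x/(x + y) and y/(x + y). *)
Lemma powR_subadd2 (s x y : R) : 0 < s <= 1 -> 0 <= x -> 0 <= y ->
  (x + y) `^ s <= x `^ s + y `^ s.
Proof.
move=> /andP[s0 s1] x0 y0.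
have := addr_ge0 x0 y0; rewrite le_eqVlt => /predU1P[<-|xy0].
  by rewrite powR0 ?gt_eqF// addr_ge0 ?powR_ge0.
have h (v : R) : 0 <= v -> v <= x + y -> v / (x + y) * (x + y) `^ s <= v `^ s.
  move=> v0 vxy; have vE : v = v / (x + y) * (x + y) by rewrite divfK// gt_eqF.
  have q0 : 0 <= v / (x + y) by rewrite divr_ge0// ltW.
  rewrite [in leRHS]vE powRM// ?(ltW xy0)// ler_wpM2r ?powR_ge0//.
  move: q0; rewrite le_eqVlt => /predU1P[<-|q0]; first exact: powR_ge0.
  by apply: ger1_powR => //; rewrite q0 ler_pdivrMr// mul1r.
have hx := h x x0; have hy := h y y0.
have -> : (x + y) `^ s = x / (x + y) * (x + y) `^ s + y / (x + y) * (x + y) `^ s.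
  by rewrite -mulrDl -mulrDl divff ?gt_eqF// mul1r.
by apply: lerD; [apply: hx|apply: hy]; lra.
Qed.

Lemma powR_subadd (s : R) (u : nat -> R) N : 0 < s <= 1 -> (forall n, 0 <= u n) ->
  (\sum_(n < N) u n) `^ s <= \sum_(n < N) u n `^ s.
Proof.
move=> s01 u0; elim: N => [|N IH].
  by rewrite !big_ord0 powR0//; case/andP: s01 => h _; rewrite gt_eqF.
rewrite !big_ord_recr/=; apply: le_trans (powR_subadd2 s01 _ (u0 N)) _.
  by rewrite sumr_ge0.
by rewrite lerD2r.
Qed.

(** Hoelder's inequality through Young's, after dividing v by E and w by V, upper bounds of the sums
    instead of the sums themselves. *)
Lemma sum_geometric_mean (al E V : R) (v w : nat -> R) N : 0 < al < 1 ->
  0 <= E -> 0 < V -> (forall n, 0 <= v n) -> (forall n, 0 <= w n) ->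
  \sum_(n < N) v n <= E -> \sum_(n < N) w n <= V ->
  \sum_(n < N) v n `^ al * w n `^ (1 - al) <= E `^ al * V `^ (1 - al).
Proof.
move=> /andP[a0 a1] E0 V0 v0 w0 hv hw.
have a10 : 0 < 1 - al by rewrite subr_gt0.
(* E = 0 has to be allowed, as E will be a multiple of the squared norm of f. *)
move: E0; rewrite le_eqVlt => /predU1P[E0|E0].
  rewrite big1 ?mulr_ge0 ?powR_ge0// => n _.
  have : v n <= 0.
    rewrite E0; apply: le_trans hv; rewrite (bigD1 n)//= lerDl sumr_ge0//.
  by move=> h; rewrite (_ : v n = 0) ?powR0 ?mul0r ?gt_eqF//; apply/eqP; rewrite eq_le h v0.
have amgm n : v n `^ al * w n `^ (1 - al) <=
    E `^ al * V `^ (1 - al) * (al * (v n / E) + (1 - al) * (w n / V)).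
  have vE : 0 <= v n / E by rewrite divr_ge0// ltW.
  have wV : 0 <= w n / V by rewrite divr_ge0// ltW.
  have hE : v n = E * (v n / E) by rewrite mulrC divfK// gt_eqF.
  have hV : w n = V * (w n / V) by rewrite mulrC divfK// gt_eqF.
  rewrite {1}hE {1}hV (powRM _ (ltW E0) vE) (powRM _ (ltW V0) wV).
  rewrite mulrACA ler_wpM2l ?mulr_ge0 ?powR_ge0//.
  have := @conjugate_powR R ((v n / E) `^ al) ((w n / V) `^ (1 - al)) al^-1 (1 - al)^-1.
  rewrite !powR_ge0 !invr_gt0 !invrK -!powRrM !mulfV ?gt_eqF// !powRr1// => /(_ isT isT a0 a10).
  by rewrite addrC subrK [_ * al]mulrC [_ * (1 - al)]mulrC; exact.
apply: (@le_trans _ _ (\sum_(n < N) E `^ al * V `^ (1 - al) * (al * (v n / E) + (1 - al) * (w n / V)))).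
  by apply: ler_sum => n _; exact: amgm.
rewrite -mulr_sumr ler_piMr ?mulr_ge0 ?powR_ge0//.
rewrite big_split/= -!mulr_sumr -!mulr_suml.
have h1 : (\sum_(n < N) v n) / E <= 1 by rewrite ler_pdivrMr// mul1r.
have h2 : (\sum_(n < N) w n) / V <= 1 by rewrite ler_pdivrMr// mul1r.
have := ler_wpM2l (ltW a0) h1; have := ler_wpM2l (ltW a10) h2; lra.
Qed.

(** With S the series, [derivative_le] applies with Y = S^(1/s), by subadditivity of the power s;
    for S infinite the bound is trivial. *)
Lemma derivative_powR_le (f : C -> C) (z c : nat -> C) (w : C) (s : R) : 0 < s <= 1 ->
  (forall n, cabs (z n) < 1) -> cabs w < 1 -> derivable f w 1 ->
  (forall v, cabs v < 1 ->
    (\sum_(n < N) c n * szego (z n) v : C) @[N --> \oo] --> f v) ->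
  ((cabs (derive1 f w) `^ s)%:E <=
    \sum_(0 <= n <oo) (cabs (c n) `^ s * cabs (szego (z n) w) `^ (2 * s))%:E)%E.
Proof.
move=> /andP[s0 s1] z1 w1 df cf.
pose u n : R := cabs (c n) * cabs (szego (z n) w) ^+ 2.
have u0 n : 0 <= u n by rewrite mulr_ge0 ?sqr_ge0 ?cabs_ge0.
have uE n : cabs (c n) `^ s * cabs (szego (z n) w) `^ (2 * s) = u n `^ s.
  by rewrite /u powRM ?sqr_ge0 ?cabs_ge0// powRrM powR_mulrn ?cabs_ge0.
under eq_eseriesr do rewrite uE.
have [fS|] := boolP ((\sum_(0 <= n <oo) (u n `^ s)%:E)%E \is a fin_num); last first.
  rewrite ge0_fin_numE ?nneseries_ge0// => [/negPf h|n _ _]; last by rewrite lee_fin powR_ge0.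
  by move: h => /negbT; rewrite -leNgt leye_eq => /eqP ->; rewrite leey.
set S := limn _ in fS *.
have S0 : 0 <= fine S by apply: fine_ge0; apply: nneseries_ge0 => n _ _; rewrite lee_fin powR_ge0.
have part N : \sum_(n < N) u n `^ s <= fine S.
  rewrite -lee_fin fineK// -sumEFin -(big_mkord xpredT (fun n => (u n `^ s)%:E)).
  by apply: nneseries_lim_ge => n _; rewrite lee_fin powR_ge0.
have key : cabs (derive1 f w) <= fine S `^ s^-1.
  apply: (derivative_le z1 w1 df cf) => N.
  have h := le_trans (powR_subadd N (_ : 0 < s <= 1) u0) (part N).
  have {}h : (\sum_(n < N) u n) `^ s <= fine S by apply: h; rewrite s0.
  have u0' : 0 <= \sum_(n < N) u n by rewrite sumr_ge0.
  have -> : \sum_(n < N) cabs (c n) * cabs (szego (z n) w) ^+ 2 =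
      ((\sum_(n < N) u n) `^ s) `^ s^-1.
    by rewrite -powRrM mulfV ?gt_eqF// powRr1.
  apply: ge0_ler_powR => //; rewrite ?nnegrE ?powR_ge0// invr_ge0 ltW//.
rewrite -(fineK fS) lee_fin.
have -> : fine S = (fine S `^ s^-1) `^ s by rewrite -powRrM mulVf ?gt_eqF// powRr1.
by apply: ge0_ler_powR => //; rewrite ?nnegrE ?powR_ge0 ?cabs_ge0// ltW.
Qed.

End power_sums.

Section weights.
Context {R : realType}.

Lemma weight_le (h : R -> R) (a b rn r : R) :
  (forall t : R, 0 < t < 1 -> 0 < h t) ->
  (forall s t : R, 0 < s -> s <= t -> t < 1 -> h t / t `^ a <= h s / s `^ a) ->
  (forall s t : R, 0 < s -> s <= t -> t < 1 -> h s / s `^ b <= h t / t `^ b) ->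
  b - a <= 0 -> 0 < rn < 1 -> 0 < r < 1 ->
  (1 - rn) `^ a * (1 - r * rn) `^ (b - a) <= h (1 - rn) * ((1 - r) `^ b / h (1 - r)).
Proof.
move=> h0 hd hi ba /andP[rn0 rn1] /andP[r0 r1].
set s := 1 - rn; set t := 1 - r.
have s0 : 0 < s by rewrite subr_gt0.
have t0 : 0 < t by rewrite subr_gt0.
have s1 : s < 1 by rewrite /s; lra.
have t1 : t < 1 by rewrite /t; lra.
have hs : 0 < h s by apply: h0; rewrite s0.
have ht : 0 < h t by apply: h0; rewrite t0.
have st : s <= 1 - r * rn by rewrite /s lerD2l lerN2 ler_piMl ?ltW.
have tt : t <= 1 - r * rn by rewrite /t lerD2l lerN2 ler_piMr ?ltW.
have pD x : 0 < x -> x `^ b = x `^ a * x `^ (b - a).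
  move=> x0; rewrite -powRD; last by rewrite (gt_eqF x0) implybT.
  by rewrite addrC subrK.
(* For s <= t the decreasing quotient is used, with 1 - r r_n >= t; for t < s the increasing one,
   with 1 - r r_n >= s. *)
case: (leP s t) => le_st.
  have := hd _ _ s0 le_st t1.
  rewrite ler_pdivrMr ?powR_gt0// mulrAC ler_pdivlMr ?powR_gt0// => H.
  apply: (@le_trans _ _ (s `^ a * t `^ (b - a))).
    by rewrite ler_wpM2l ?powR_ge0// le_powR_npos.
  rewrite mulrA ler_pdivlMr// (pD t)// mulrA mulrAC.
  by rewrite ler_wpM2r ?powR_ge0// mulrC.
have := hi _ _ t0 (ltW le_st) s1.
rewrite ler_pdivrMr ?powR_gt0// mulrAC ler_pdivlMr ?powR_gt0// => H.
apply: (@le_trans _ _ (s `^ a * s `^ (b - a))).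
  by rewrite ler_wpM2l ?powR_ge0// le_powR_npos.
by rewrite -pD// mulrA ler_pdivlMr// mulrC.
Qed.

End weights.

(** * The weighted area integral of a power of the derivative *)

Section area.
Context {R : realType}.
Local Notation C := (R[i]^o).
Local Notation mu := (@lebesgue_measure R).

Lemma nneseries_le (u : nat -> R) (M : R) : (forall n, 0 <= u n) ->
  (forall N, \sum_(n < N) u n <= M) -> (\sum_(0 <= n <oo) (u n)%:E <= M%:E)%E.
Proof.
move=> u0 uM; apply: lime_le; first by apply: is_cvg_nneseries => n _ _; rewrite lee_fin.
by apply: nearW => N; rewrite big_mkord sumEFin lee_fin.
Qed.

Lemma weight_onem_sqr (gam x : R) : gam <= 0 -> 0 < x < 1 ->
  x * (1 - x ^+ 2) `^ gam <= (1 - x) `^ gam.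
Proof.
move=> g0 /andP[x0 x1].
apply: (@le_trans _ _ ((1 - x ^+ 2) `^ gam)); first by rewrite ler_piMl ?powR_ge0// ltW.
apply: le_powR_npos => //; first by rewrite subr_gt0.
by rewrite lerD2l lerN2 expr2 ler_piMr// ltW.
Qed.

Lemma measurable_radial (b e g : R) (D : set R) : measurable D ->
  measurable_fun D (fun x : R => ((1 - b * x) `^ e * (1 - x) `^ g)%:E).
Proof.
move=> mD; apply/measurable_EFinP; apply: measurable_funTS.
apply: measurable_funM.
  apply: (measurableT_comp (measurable_powR e)).
  by apply: measurable_funB => //; exact: measurable_funM.
by apply: (measurableT_comp (measurable_powR g)); exact: measurable_funB.
Qed.

(** K is produced before the zeros, the coefficients, f and r, which makes the final constant
    independent of f and r. Sum and integrals are exchanged on the majorant only, so that no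
    measurability of |f'|^sig enters. *)
Lemma area_estimate (sig gam : R) : 1 < 2 * sig -> sig <= 1 -> -1 < gam ->
  gam < 2 * sig - 2 -> exists2 K : R, 0 < K &
  forall (rs thetas : nat -> R) (c : nat -> C) (f : C -> C) (r : R),
  (forall n, 0 < rs n < 1) -> (forall w : C, cabs w < 1 -> derivable f w 1) ->
  (forall w : C, cabs w < 1 ->
    (\sum_(n < N) c n * szego (polar (rs n) (thetas n)) w : C) @[N --> \oo] --> f w) ->
  0 < r < 1 ->
  (\int[mu]_(rho in `]0%R, 1%R[) \int[mu]_(theta in `[0%R, (2 * pi)%R])
     (cabs (derive1 f (polar (r * rho) theta)) `^ sig *
       (rho * (1 - rho ^+ 2) `^ gam))%:E <=
   \sum_(0 <= n <oo)
     (K * (cabs (c n) `^ sig * (1 - r * rs n) `^ (gam + 2 - 2 * sig)))%:E)%E.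
Proof.
move=> q1 s1 g1 gs.
have [K1 K10 ang] := angular_estimate q1.
have gq : gam + 2 - 2 * sig < 0 by lra.
have [K2 K20 rad] := radial_estimate q1 g1 gq.
exists (K1 * K2); first by rewrite mulr_gt0.
move=> rs thetas c f r rs01 df cf r01; have /andP[r0 r1] := r01.
pose z n : C := polar (rs n) (thetas n).
have z1 n : cabs (z n) < 1.
  by have /andP[h0 h1] := rs01 n; rewrite /z cabs_polar// ltW.
pose a n : R := cabs (c n) `^ sig.
have a0 n : 0 <= a n by exact: powR_ge0.
have sig01 : 0 < sig <= 1 by rewrite s1 andbT; lra.
(* [T] is the n-th term of the majorant, with rho (1 - rho^2)^gam already replaced by (1 - rho)^gam;
   [G] bounds its integral over the angle. *)
pose T rho n (t : R) : R := (1 - rho) `^ gam * a n * cabs (szego (z n) (polar (r * rho) t)) `^ (2 * sig).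
have T0 rho n t : 0 <= T rho n t by rewrite !mulr_ge0 ?powR_ge0.
pose G n (rho : R) : R := K1 * a n * ((1 - r * rs n * rho) `^ (1 - 2 * sig) * (1 - rho) `^ gam).
have G0 n rho : 0 <= G n rho by rewrite !mulr_ge0 ?powR_ge0 ?a0 ?(ltW K10).
have inner rho : 0 < rho < 1 ->
   (\int[mu]_(theta in `[0%R, (2 * pi)%R])
     (cabs (derive1 f (polar (r * rho) theta)) `^ sig *
       (rho * (1 - rho ^+ 2) `^ gam))%:E <= \sum_(0 <= n <oo) (G n rho)%:E)%E.
  move=> /andP[rho0 rho1].
  have rr0 : 0 <= r * rho by rewrite mulr_ge0 ?ltW.
  have rr1 : r * rho < 1 by rewrite mulr_ilt1 ?ltW.
  have cS n : cont_on 0 (2 * pi) (fun t => cabs (szego (z n) (polar (r * rho) t)) `^ (2 * sig)).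
    by apply: cont_on_szego_powR => //; rewrite rr0.
  have cT n : cont_on 0 (2 * pi) (T rho n).
    by apply: cont_onM => //; exact: cont_on_cst.
  apply: (@le_trans _ _ (\int[mu]_(theta in `[0%R, (2 * pi)%R])
      (\sum_(0 <= n <oo) (T rho n theta)%:E))%E).
    apply: ge0_le_integral_patch.
    - move=> t _; rewrite lee_fin !mulr_ge0 ?powR_ge0 ?(ltW rho0)//.
    - by move=> t _; apply: nneseries_ge0 => n _ _; rewrite lee_fin.
    move=> t Ht; split => //.
    have w1 : cabs (polar (r * rho) t : C) < 1 by rewrite cabs_polar.
    have h := derivative_powR_le sig01 z1 w1 (df _ w1) cf.
    have -> : (\sum_(0 <= n <oo) (T rho n t)%:E =
       ((1 - rho) `^ gam)%:E * \sum_(0 <= n <oo)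
         (a n * cabs (szego (z n) (polar (r * rho) t)) `^ (2 * sig))%:E)%E.
      rewrite -nneseriesZl; last by move=> n _; rewrite lee_fin mulr_ge0 ?powR_ge0.
      by apply: eq_eseriesr => n _; rewrite -EFinM mulrA.
    rewrite EFinM muleC; apply: lee_pmul => //.
    - by rewrite lee_fin mulr_ge0 ?powR_ge0 ?(ltW rho0).
    - by rewrite lee_fin powR_ge0.
    - by rewrite lee_fin weight_onem_sqr ?rho0//; lra.
  rewrite integral_nneseries//; last 2 first.
    by move=> n; have /integrableP[] := cont_on_integrable (cT n).
    by move=> n t _; rewrite lee_fin.
  apply: lee_nneseries.
    by move=> n _ _; apply: integral_ge0 => t _; rewrite lee_fin.
  move=> n _; rewrite itg_EFin// lee_fin /T itgZ//.
  have /andP[rn0 rn1] := rs01 n.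
  have := ang (rs n) (r * rho) (thetas n); rewrite rr0 rr1 (ltW rn0) rn1 => /(_ isT isT) H.
  rewrite /G (mulrAC r) -/(z n) -(mulrC (rs n)).
  have -> : K1 * a n * ((1 - rs n * (r * rho)) `^ (1 - 2 * sig) * (1 - rho) `^ gam) =
    (1 - rho) `^ gam * a n * (K1 * (1 - rs n * (r * rho)) `^ (1 - 2 * sig)) by ring.
  by rewrite ler_wpM2l// mulr_ge0 ?powR_ge0.
apply: (@le_trans _ _ (\int[mu]_(rho in `]0%R, 1%R[) (\sum_(0 <= n <oo) (G n rho)%:E))%E).
  apply: ge0_le_integral_patch.
  - move=> x; rewrite /= in_itv/= => /andP[x0 x1]; apply: integral_ge0 => t _.
    by rewrite lee_fin !mulr_ge0 ?powR_ge0 ?(ltW x0).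
  - by move=> x _; apply: nneseries_ge0 => n _ _; rewrite lee_fin.
  by move=> x; rewrite /= in_itv/= => x01; split => //; exact: inner.
have mR n := @measurable_radial (r * rs n) (1 - 2 * sig) gam `]0%R, 1%R[%classic (measurable_itv _).
rewrite integral_nneseries//; last 2 first.
- move=> n; rewrite (_ : (fun x => _) = fun x => ((K1 * a n)%:E *
      ((1 - r * rs n * x) `^ (1 - 2 * sig) * (1 - x) `^ gam)%:E)%E).
    by apply: measurable_funeM; exact: mR.
  by apply/funext => x; rewrite -EFinM.
- by move=> n t _; rewrite lee_fin.
apply: lee_nneseries.
  by move=> n _ _; apply: integral_ge0 => t _; rewrite lee_fin.
move=> n _; rewrite /G; under eq_integral do rewrite EFinM.
rewrite ge0_integralZl_EFin//; last 3 first.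
- by move=> x _; rewrite lee_fin mulr_ge0 ?powR_ge0.
- exact: mR.
- by rewrite mulr_ge0 ?(ltW K10).
have /andP[rn0 rn1] := rs01 n.
have := rad (r * rs n); rewrite mulr_ge0 ?(ltW r0) ?(ltW rn0)//= mulr_ilt1 ?(ltW r0) ?(ltW rn0)//
    => /(_ isT) H.
apply: (@le_trans _ _ ((K1 * a n)%:E * (K2 * (1 - r * rs n) `^ (gam + 2 - 2 * sig))%:E)%E).
  by apply: lee_wpmul2l => //; rewrite lee_fin mulr_ge0 ?(ltW K10).
by rewrite -EFinM lee_fin le_eqVlt; apply/orP; left; apply/eqP; rewrite /a; ring.
Qed.

End area.

(** * Hoelder's inequality over the zeros and the choice of the constants *)

Unset Implicit Arguments.
Set Strict Implicit.
Set Printing Implicit Defensive.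
Theorem theorem6p2 (R : realType) (h : R -> R)
  (h_gt0 : forall t : R, 0 < t < 1 -> 0 < h t)
  (h_cont : {within `]0, 1[, continuous h})
  (h_lim0 : h t @[t --> 0^'+] --> 0)
  (z : nat -> R[i]^o) (rs thetas : nat -> R)
  (rs_itv : forall n, 0 < rs n < 1)
  (z_polar : forall n, z n = polar (rs n) (thetas n))
  (z_carleson : carleson_sequence z)
  (h_summable : cvgn (series (fun n => h (1 - rs n))))
  (p sigma gamma : R)
  (p_itv : 2 / 3 < p < 1)
  (sigma_def : sigma = 2 * p / (p + 2))
  (gamma_itv : -1 < gamma < 2 * sigma - 2)
  (h_decr : forall s t : R, 0 < s -> s <= t -> t < 1 ->
    h t / t `^ (p / 2) <= h s / s `^ (p / 2))
  (h_incr : forall s t : R, 0 < s -> s <= t -> t < 1 ->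
    h s / s `^ ((1 - p) + (1 + gamma) * (1 + p / 2)) <=
    h t / t `^ ((1 - p) + (1 + gamma) * (1 + p / 2))) :
  exists C r0 : R, [/\ 0 < C, 0 < r0 < 1 &
    forall f : R[i]^o -> R[i]^o, model_space (blaschke_product z) f ->
    forall r : R, r0 < r < 1 ->
    ((\int[lebesgue_measure]_(rho in `]0%R, 1%R[)
        \int[lebesgue_measure]_(theta in `[0%R, (2 * pi)%R])
          (cabs (derive1 f (polar (r * rho) theta)) `^ sigma *
           (rho * (1 - rho ^+ 2) `^ gamma))%R%:E) `^ sigma^-1
     <= (C * H2_norm f /
         ((1 - r) `^ (- (1 - p) - (1 + gamma) * (1 + p / 2)) * h (1 - r))
           `^ p^-1)%R%:E)%E].
Proof.
have /andP[p1 p2] := p_itv; have /andP[g1 g2] := gamma_itv.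
have pp2 : 0 < p + 2 by lra.
have sp : sigma * (p + 2) = 2 * p by rewrite sigma_def divfK// gt_eqF.
have s_lo : 1 < 2 * sigma by rewrite sigma_def mulrA ltr_pdivlMr//; lra.
have s_hi : sigma < 1 by rewrite sigma_def ltr_pdivrMr//; lra.
have s0 : 0 < sigma by lra.
set A := (1 - p) + (1 + gamma) * (1 + p / 2) in h_incr *.
have [K K0 area] := area_estimate s_lo (ltW s_hi) g1 g2.
have hn n : 0 < h (1 - rs n).
  by apply: h_gt0; have /andP[a b] := rs_itv n; apply/andP; split; lra.
pose H := limn (series (fun n => h (1 - rs n))).
have hH N : \sum_(n < N) h (1 - rs n) <= H.
  rewrite -(big_mkord xpredT (fun n => h (1 - rs n))).
  apply: (nondecreasing_cvgn_le _ h_summable N); apply/nondecreasing_seqP => n.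
  by rewrite /series/= big_nat_recr//= lerDl ltW.
have H0 : 0 < H by apply: lt_le_trans (hH 1%N); rewrite big_ord1.
(* The 1 makes the final constant positive. *)
pose E1 := coef_const z + 1.
have E10 : 0 < E1 by rewrite ltr_wpDl// coef_const_ge0.
have zn n : cabs (z n) = rs n by rewrite z_polar cabs_polar// ltW//; have /andP[] := rs_itv n.
(* [K] integrates the kernels, 2^(sigma/2) comes from 1 - r_n^2 <= 2 (1 - r_n), [E1] from the
   coefficients and [H] from the sum of the h(1 - r_n). The value 1/2 for r_0 is arbitrary. *)
exists ((K * 2 `^ (sigma / 2)) `^ sigma^-1 * Num.sqrt E1 * H `^ p^-1), 2^-1; split.
- by rewrite !mulr_gt0 ?powR_gt0 ?sqrtr_gt0 ?mulr_gt0 ?powR_gt0.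
- by rewrite invr_gt0 ltr0n invf_lt1// ltr1n.
move=> f fmodel r /andP[r2 r1].
have r0 : 0 < r by lra.
have [[df fbd] _] := fmodel.
have H2f : H2 f by [].
have [nf0 _] := mean2_le_norm H2f.
have [x [x_sum x_exp]] := model_space_expansion z_carleson fmodel.
pose c n : R[i]^o := x n * (kweight z n)%:C.
have cE n : cabs (c n) `^ sigma <= 2 `^ (sigma / 2) * ((cabs (x n) ^+ 2) `^ (sigma / 2) *
    (1 - rs n) `^ (sigma / 2)).
  have /andP[rn0 rn1] := rs_itv n.
  have z1 m : 0 < cabs (z m) < 1 by rewrite zn.
  have e2 : sigma = 2%:R * (sigma / 2) by field.
  rewrite {1}e2 powRrM powR_mulrn ?cabs_ge0// /c cabsM cabs_real exprMn.
  rewrite (ger0_norm (ltW (kweight_gt0 z1 n))) (kweight_sqr z1) zn.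
  have le2 : 1 - rs n ^+ 2 <= 2 * (1 - rs n).
    by have := sqr_ge0 (1 - rs n); lra.
  have n0 : 0 <= 1 - rs n ^+ 2 by rewrite subr_ge0 expr_le1// ltW.
  have n1 : 0 <= 1 - rs n by rewrite subr_ge0 ltW.
  rewrite powRM ?sqr_ge0// mulrCA ler_wpM2l ?powR_ge0// -powRM//.
  by apply: ge0_ler_powR; rewrite ?nnegrE// ?mulr_ge0//; lra.
pose t := 1 - r; have t0 : 0 < t by rewrite subr_gt0.
have ht : 0 < h t by apply: h_gt0; rewrite t0/= /t; lra.
pose V := H * (t `^ A / h t).
have V0 : 0 < V by rewrite mulr_gt0// divr_gt0// powR_gt0.
(* The second factor in Hoelder's inequality: its power 1 - sigma/2 returns (1 - r_n)^(sigma/2) and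
   the weight of [area_estimate], see [wE]. *)
pose w n := (1 - rs n) `^ (p / 2) * (1 - r * rs n) `^ (A - p / 2).
(* By sigma (p + 2) = 2 p, this is a positive multiple of gamma + 2 - 2 sigma, which is negative. *)
have Ap : A - p / 2 = (gamma + 2 - 2 * sigma) * (p + 2) / 2.
  rewrite /A (_ : (gamma + 2 - 2 * sigma) * (p + 2) = (gamma + 2) * (p + 2) - 2 * (sigma * (p +
      2))); last by ring.
  by rewrite sp; field.
have Ap0 : A - p / 2 <= 0.
  have h2 : 0 <= (2 * sigma - 2 - gamma) * (p + 2) by apply: mulr_ge0; lra.
  by rewrite Ap; lra.
have wsum N : \sum_(n < N) w n <= V.
  apply: (@le_trans _ _ (\sum_(n < N) h (1 - rs n) * (t `^ A / h t))).
    apply: ler_sum => n _; rewrite /w /t; apply: weight_le => //.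
    by rewrite r0.
  by rewrite -mulr_suml ler_wpM2r ?hH// divr_ge0 ?powR_ge0 ?ltW.
have sE : 1 - sigma / 2 = 2 / (p + 2) by rewrite sigma_def; field; rewrite gt_eqF.
have wE n : w n `^ (1 - sigma / 2) =
    (1 - rs n) `^ (sigma / 2) * (1 - r * rs n) `^ (gamma + 2 - 2 * sigma).
  rewrite /w powRM ?powR_ge0// -!powRrM sE Ap; congr (_ `^ _ * _ `^ _).
    by rewrite sigma_def; field; rewrite gt_eqF.
  by field; rewrite gt_eqF.
pose E := E1 * H2_norm f ^+ 2.
have E0 : 0 <= E by rewrite mulr_ge0 ?sqr_ge0// ltW.
have xsum N : \sum_(n < N) cabs (x n) ^+ 2 <= E.
  by apply: le_trans (x_sum N) _; rewrite ler_wpM2r ?sqr_ge0// lerDl.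
pose M := K * (2 `^ (sigma / 2) * (E `^ (sigma / 2) * V `^ (1 - sigma / 2))).
have x_exp' (v : R[i]^o) : cabs v < 1 ->
   (\sum_(n < N) c n * szego (polar (rs n) (thetas n)) v : R[i]^o) @[N --> \oo] --> f v.
  move=> v1; rewrite (_ : (fun N => _) = fun N => \sum_(n < N) x n * (kweight z n)%:C * szego (z n) v).
    exact: x_exp.
  by apply/funext => N; apply: eq_bigr => n _; rewrite z_polar.
have r01 : 0 < r < 1 by rewrite r0.
have main := area rs thetas c f r rs_itv df x_exp' r01.
have bound : (\sum_(0 <= n <oo)
     (K * (cabs (c n) `^ sigma * (1 - r * rs n) `^ (gamma + 2 - 2 * sigma)))%:E <= M%:E)%E.
  apply: nneseries_le => [n|N]; first by rewrite !mulr_ge0 ?powR_ge0// ltW.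
  rewrite -mulr_sumr ler_pM2l//.
  apply: (@le_trans _ _ (\sum_(n < N) 2 `^ (sigma / 2) * ((cabs (x n) ^+ 2) `^ (sigma / 2) *
      w n `^ (1 - sigma / 2)))).
    apply: ler_sum => n _; rewrite wE !mulrA ler_wpM2r ?powR_ge0// -mulrA; exact: cE.
  rewrite -mulr_sumr ler_pM2l ?powR_gt0//.
  apply: (@sum_geometric_mean _ _ _ _ (fun n => cabs (x n) ^+ 2)) => //.
  - by apply/andP; split; lra.
  - by move=> n; exact: sqr_ge0.
  - by move=> n; rewrite mulr_ge0 ?powR_ge0.
have M0 : 0 <= M by rewrite !mulr_ge0 ?powR_ge0// ltW.
apply: (@le_trans _ _ (M%:E `^ sigma^-1)%E).
  apply: gt0_ler_poweR; rewrite ?invr_ge0 ?(ltW s0)//.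
  - rewrite in_itv/= leey andbT; apply: integral_ge0 => rho; rewrite /= in_itv/= => /andP[a b].
    by apply: integral_ge0 => th _; rewrite lee_fin !mulr_ge0 ?powR_ge0// ltW.
  - by rewrite in_itv/= leey andbT lee_fin.
  - exact: le_trans main bound.
(* What remains is an identity: after the power 1/sigma, E carries the exponent 1/2 and V the
   exponent 1/p. *)
rewrite poweR_EFin lee_fin le_eqVlt; apply/orP; left; apply/eqP.
have p0 : 0 < p by lra.
rewrite /M mulrA (@powRM _ (K * 2 `^ (sigma / 2))) ?mulr_ge0 ?powR_ge0 ?(ltW K0)//.
rewrite (powRM _ (powR_ge0 _ _) (powR_ge0 _ _)) -!powRrM.
have -> : sigma / 2 / sigma = 2^-1 by field; rewrite gt_eqF.
have -> : (1 - sigma / 2) / sigma = p^-1.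
  by rewrite sE sigma_def; field; rewrite !gt_eqF.
rewrite powR12_sqrt// /E sqrtrM ?(ltW E10)// sqrtr_sqr ger0_norm//.
have -> : - (1 - p) - (1 + gamma) * (1 + p / 2) = - A by rewrite /A; ring.
rewrite -/t /V; have -> : t `^ A / h t = (t `^ (- A) * h t)^-1 by rewrite powRN invfM invrK.
have y0 : 0 <= t `^ (- A) * h t by rewrite mulr_ge0 ?powR_ge0// ltW.
rewrite (@powRM _ H) ?(ltW H0) ?invr_ge0// -(powR_inv1 y0) (powRAC _ (-1)) powR_inv1 ?powR_ge0//.
rewrite powRM ?powR_ge0 ?(ltW K0)//; ring.
Qed.
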